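(* Let $\lambda=(\lambda_1,\dots,\lambda_n)$ be a strictly decreasing $n$-tuple of non-negative integers and let $\mu\in\mathbb{Z}^n$ be an integer point lying in the relative interior of the convex hull $\mathrm{SH}(\lambda)$ of all permutations of $\lambda$. Let $S_\lambda(x)$ be given by $\det[\exp(x_i\lambda_j)]_{1\le i,j\le n}\big/\prod_{1\le i<j\le n}(x_i-x_j)$ for $x\in\mathbb{R}^n$ with pairwise distinct entries, and be defined on all of $\mathbb{R}^n$ by continuity. Then $$\frac{\sqrt{(n-1)!}\,\exp(-n)}{\lambda_1^{n-1}n^{2n}}\;\le\;\frac{\mathrm{vol}(\mathrm{GT}(\lambda,\mu))}{\inf_{x\in\mathbb{R}^n}S_\lambda(x)\exp(-x^{T}\mu)}\;\le\;\sqrt{(n-1)!}\,\exp(n/2)\,\Gamma\!\left(\frac{n+1}{2}\right)\left(\frac{16\lambda_1n^3}{\sqrt\pi}\right)^{n-1}.$$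
   Context: Throughout $n\ge 3$ is an integer. A Gelfand–Tsetlin (GT) pattern with $n$ rows is a real triangular array $(x_{i,j})_{1\le j\le i\le n}$ with $x_{i+1,j}\ge x_{i,j}\ge x_{i+1,j+1}$ for $1\le i\le n-1$, $1\le j\le i$; $|x_{i,\cdot}|$ denotes the sum of row $i$, and $|x_{0,\cdot}|:=0$. $\mathrm{GT}(\lambda,\mu)$ is the set of GT patterns with $x_{n,j}=\lambda_j$ for $1\le j\le n$ and $|x_{i,\cdot}|-|x_{i-1,\cdot}|=\mu_i$ for $1\le i\le n$. Its volume $\mathrm{vol}(\mathrm{GT}(\lambda,\mu))$ is its $\frac{(n-1)(n-2)}{2}$-dimensional Hausdorff measure (normalized to agree with Lebesgue measure on subspaces). *)

(* Defs.v *)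
From HB Require Import structures.
From mathcomp Require Import all_boot all_order all_algebra all_fingroup.
From mathcomp Require Import all_classical all_reals all_analysis.

Set Implicit Arguments.
Unset Strict Implicit.
Unset Printing Implicit Defensive.

Import Order.TTheory GRing.Theory Num.Theory.
Import numFieldNormedType.Exports.

Local Open Scope classical_set_scope.
Local Open Scope ring_scope.

(* Euclidean distance on R^T; the library norm on matrices is the sup norm. *)
Definition euclid_dist (R : realType) (T : finType) (x y : T -> R) : R :=
  Num.sqrt (\sum_t (x t - y t) ^+ 2).

(* Equal to -oo when U is empty. *)
Definition ediam (R : realType) (T : finType) (U : set (T -> R)) : \bar R :=
  ereal_sup [set (euclid_dist p.1 p.2)%:E | p in U `*` U].

(* The case split makes the empty set contribute 0 also when d = 0, while a
   nonempty set then contributes 1. *)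
Definition hausdorff_weight (R : realType) (T : finType) (d : nat)
    (U : set (T -> R)) : \bar R :=
  if U == set0 then 0%E else (ediam U ^+ d)%E.

Definition hausdorff_pre (R : realType) (T : finType) (d : nat) (delta : R)
    (A : set (T -> R)) : \bar R :=
  ereal_inf [set (\sum_(0 <= k <oo) hausdorff_weight d (U k))%E |
    U in [set U : nat -> set (T -> R) |
      A `<=` \bigcup_k U k /\ forall k, (ediam (U k) <= delta%:E)%E]].

(* hausdorff_pre is nonincreasing in delta: the supremum is the limit as
   delta tends to 0. *)
Definition hausdorff_raw (R : realType) (T : finType) (d : nat)
    (A : set (T -> R)) : \bar R :=
  ereal_sup [set hausdorff_pre d delta A | delta in [set delta : R | 0 < delta]].

Definition unit_cube (R : realType) (d : nat) : set ('I_d -> R) :=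
  [set x | forall i, 0 <= x i <= 1].

(* On R^d, hausdorff_raw d is a translation invariant Borel measure that is
   positive and finite on the unit cube, hence a multiple of Lebesgue measure;
   dividing by its value on the unit cube makes it agree with Lebesgue measure
   on R^d and, being invariant under isometries, on every d-dimensional
   subspace of R^T. *)
Definition hausdorff (R : realType) (T : finType) (d : nat)
    (A : set (T -> R)) : \bar R :=
  (hausdorff_raw d A / hausdorff_raw d (@unit_cube R d))%E.

(* The positions of a triangular array: row i has the columns 0, ..., i. *)
Definition gt_index (n : nat) : Type := {p : 'I_n * 'I_n | (p.2 <= p.1)%N}.

(* One-based row and column numbers, so that the sum of row 0 is 0. *)
Definition gt_row (n : nat) (p : gt_index n) : nat := (val p).1.+1.
Definition gt_col (n : nat) (p : gt_index n) : nat := (val p).2.+1.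

Definition row_sum (R : realType) (n : nat) (x : gt_index n -> R) (i : nat) : R :=
  \sum_(p : gt_index n | gt_row p == i) x p.

Definition is_gt_pattern (R : realType) (n : nat) (x : gt_index n -> R) : Prop :=
  forall p q : gt_index n, gt_row q = (gt_row p).+1 ->
    (gt_col q = gt_col p -> x p <= x q) /\
    (gt_col q = (gt_col p).+1 -> x q <= x p).

Definition GT (R : realType) (n : nat) (lam mu : 'rV[R]_n) :
    set (gt_index n -> R) :=
  [set x | [/\ is_gt_pattern x,
    forall p, gt_row p = n -> x p = lam ord0 (val p).2 &
    forall i : 'I_n, row_sum x i.+1 - row_sum x i = mu ord0 i]].

Definition GT_vol (R : realType) (n : nat) (lam mu : 'rV[R]_n) : \bar R :=
  hausdorff ((n - 1) * (n - 2) %/ 2) (GT lam mu).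

Definition convex_hull (R : realType) (V : lmodType R) (A : set V) : set V :=
  smallest (@convex_set R V) A.

Definition affine_set (R : realType) (V : lmodType R) (A : set V) : Prop :=
  forall (x y : V) (t : R), A x -> A y -> A (t *: x + (1 - t) *: y).

Definition affine_hull (R : realType) (V : lmodType R) (A : set V) : set V :=
  smallest (@affine_set R V) A.

Definition relative_interior (R : realType) (V : normedModType R) (A : set V) :
    set V :=
  [set x | A x /\ \forall y \near x, affine_hull A y -> A y].

Definition SH (R : realType) (n : nat) (lam : 'rV[R]_n) : set 'rV[R]_n :=
  convex_hull [set \row_i lam ord0 (s i) | s in [set: {perm 'I_n}]].

Definition distinct_entries (R : realType) (n : nat) : set 'rV[R]_n :=
  [set x | injective (x ord0)].

Definition schur_ratio (R : realType) (n : nat) (lam x : 'rV[R]_n) : R :=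
  \det (\matrix_(i < n, j < n) expR (x ord0 i * lam ord0 j)) /
  \prod_(i < n) \prod_(j < n | (i < j)%N) (x ord0 i - x ord0 j).

(* The points with pairwise distinct entries are dense, and the ratio is
   continuous there, so the limit is its continuous extension to R^n. *)
Definition schur_exp (R : realType) (n : nat) (lam x : 'rV[R]_n) : R :=
  lim (schur_ratio lam y @[y --> within (@distinct_entries R n) (nbhs x)]).

Definition Gamma (R : realType) (s : R) : R :=
  \int[lebesgue_measure]_(t in `]0, +oo[) (t `^ (s - 1) * expR (- t)).

(* Main.v *)
Require Import Defs.
From HB Require Import structures.
From mathcomp Require Import all_boot all_order all_algebra all_fingroup.
From mathcomp Require Import all_classical all_reals all_analysis.
From mathcomp Require Import measurable_realfun.
From mathcomp Require Import lra zify.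
Import Order.TTheory GRing.Theory Num.Theory.
Import numFieldNormedType.Exports.
Set Implicit Arguments.
Unset Strict Implicit.
Unset Printing Implicit Defensive.
Local Open Scope classical_set_scope.
Local Open Scope ring_scope.

(* Row sums serve as diagonal coordinates of a triangular array with top row
   lambda. Integrating over the other coordinates, let f be the volume of the
   slice with given row sums; it is log-concave (Prekopa-Leindler). Expanding
   the determinant row by row gives
     S_lambda(x) exp(-x mu) = integral of exp(sum_i (x_i - x_(i+1)) h_i) f(b + h) dh,
   where b holds the partial sums of mu.
   A supergradient of log f at b yields an x for which the integrand is at most
   f(b), on a support inside [0, n lambda_1]^(n-1): this bounds the infimum from
   above. Since mu is an integer point of the relative interior, every
   majorization inequality holds with slack at least 1, hence all row sums within
   1/(2n) of b are attained (Rado), and interpolating with them gives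
   f(b + h) >= (1 - 1/n)^D f(b) for |h_i| <= 1/(2 n^2), where D = (n-1)(n-2)/2.
   For each x this holds on the half of that box where the exponent is
   nonnegative, which bounds the infimum from below.
   Finally the Hausdorff measure of GT(lambda, mu), a graph over its free
   coordinates, is between f(b) and kappa f(b): both bounds come from comparing
   distances, through dyadic cubes. *)

(** * Iterated integrals *)

(** The exact ratio of the Hausdorff measure to f(b) is sqrt((n-1)!): a row with i free entries,
    whose diagonal entry is a constant minus their sum, has Gram determinant 1 + i. The proof only
    brackets this ratio, and the surplus in the stated upper constant pays for kappa. The
    determinant formula is for pairwise distinct x. Its integral side makes sense for all x and
    changes by a factor of at most exp(C e) when the entries of x move by at most e, so it is the
    continuous extension. That b is attained does not give f(b) > 0, since its fibre might be flat,
    and without f(b) > 0 there is no logarithm to support. A pattern with margin 1/2 in every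
    inequality gives a point where f > 0, perhaps far from b. The segment from it through b can be
    prolonged to an attained point, and b, strictly inside, inherits positive volume. The parameter
    1/n is a compromise: it shrinks fibres by (1-1/n)^D, of order exp(-n/2), while the box stays
    polynomially small. Cutting half row sums into pieces of width 1/n puts the matching factor
    (1+1/n)^D into kappa; the quotient of the two is at most exp(n-2). *)

Definition upd {T : eqType} {X : Type} (x : T -> X) (t : T) (r : X) : T -> X :=
  fun s => if s == t then r else x s.

Lemma upd_id {T : eqType} {X : Type} (x : T -> X) t r : upd x t r t = r.
Proof. by rewrite /upd eqxx. Qed.

Lemma upd_neq {T : eqType} {X : Type} (x : T -> X) t r s :
  s != t -> upd x t r s = x s.
Proof. by rewrite /upd => /negbTE ->. Qed.

Lemma updC {T : eqType} {X : Type} (x : T -> X) s t a b :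
  s != t -> upd (upd x s a) t b = upd (upd x t b) s a.
Proof.
move=> st; apply/funext => u; rewrite /upd.
by case: (eqVneq u t) => [->|//]; rewrite eq_sym (negbTE st).
Qed.

Lemma upd_upd {T : eqType} {X : Type} (x : T -> X) t a b :
  upd (upd x t a) t b = upd x t b.
Proof. by apply/funext => u; rewrite /upd; case: eqP. Qed.

Section Env.
Context (R : realType) (T : choiceType).

Definition cylinders : set (set (T -> R)) :=
  [set A | exists t, exists2 B, measurable B & A = (fun x => x t) @^-1` B].

(* Points have arbitrarily many coordinates; integration runs over a finite list
   of them, the others being parameters. *)
Definition env := g_sigma_algebraType cylinders.

Lemma measurable_coord (t : T) : measurable_fun [set: env] (fun x : env => x t).
Proof.
move=> _ B mB; rewrite setTI; apply: sub_sigma_algebra.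
by exists t, B.
Qed.

Lemma measurable_envP d (X : measurableType d) (g : X -> env) :
  (forall t, measurable_fun [set: X] (fun x => g x t)) ->
  measurable_fun [set: X] g.
Proof.
move=> mg; apply: (@measurability _ _ X env setT g cylinders) => //.
move=> _ [A [t [B mB ->]] <-].
rewrite setTI -[X in measurable X]setTI; exact: (mg t measurableT B mB).
Qed.

Lemma measurable_upd (t : T) :
  measurable_fun [set: (env * measurableTypeR R)%type]
    (fun p : env * measurableTypeR R => (upd p.1 t p.2 : env)).
Proof.
apply: measurable_envP => s; rewrite /upd.
case: (s == t); first exact: measurable_snd.
apply: (@measurableT_comp _ _ _ _ _ _ (fun x : env => x s)) => //.
exact: measurable_coord.
Qed.

Local Open Scope ereal_scope.

(** The head of the list is the outermost variable. The result is again a function of the whole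
    point, so integrals nest and parameters stay available without product spaces. *)
Fixpoint Iint (ts : seq T) (F : env -> \bar R) : env -> \bar R :=
  if ts is t :: ts' then
    fun x => \int[lebesgue_measure]_r Iint ts' F (upd x t r)
  else F.

Lemma Iint_cat ts ts' F : Iint (ts ++ ts') F = Iint ts (Iint ts' F).
Proof.
elim: ts => //= t ts IH; apply/funext => x; apply: eq_integral => r _.
by rewrite IH.
Qed.

Lemma Iint_ge0 ts F : (forall x, 0 <= F x) -> forall x, 0 <= Iint ts F x.
Proof.
by move=> F0; elim: ts => //= t ts IH x; apply: integral_ge0 => r _; exact: IH.
Qed.

Lemma measurable_updF (t : T) (F : env -> \bar R) : measurable_fun [set: env] F ->
  measurable_fun setT (fun p : env * measurableTypeR R => F (upd p.1 t p.2)).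
Proof.
move=> mF; exact: (measurableT_comp mF (measurable_upd t)).
Qed.

Lemma measurable_upd1F (t : T) (x : env) (F : env -> \bar R) : measurable_fun [set: env] F ->
  measurable_fun setT (fun r : measurableTypeR R => F (upd x t r)).
Proof.
move=> mF.
exact: (measurableT_comp (measurable_updF t mF) (pair1_measurable x)).
Qed.

Lemma measurable_Iint ts F : measurable_fun [set: env] F -> (forall x, 0 <= F x) ->
  measurable_fun [set: env] (Iint ts F).
Proof.
move=> mF F0; elim: ts => //= t ts IH.
apply: (@measurable_fun_fubini_tonelli_F _ _ _ _ R lebesgue_measure
  (fun p : env * measurableTypeR R => Iint ts F (upd p.1 t p.2))).
  exact: measurable_updF.
by move=> p; exact: Iint_ge0.
Qed.

Lemma Iint_swap t s ts F : measurable_fun [set: env] F -> (forall x, 0 <= F x) ->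
  Iint (t :: s :: ts) F = Iint (s :: t :: ts) F.
Proof.
move=> mF F0; apply/funext => x /=.
have [->//|ts_neq] := eqVneq t s.
rewrite (fubini_tonelli (m1 := lebesgue_measure) (m2 := lebesgue_measure)
  (fun p : measurableTypeR R * measurableTypeR R =>
     Iint ts F (upd (upd x t p.1) s p.2))) /=.
- apply: eq_integral => r _; apply: eq_integral => r' _.
  by rewrite updC.
- apply: (measurableT_comp (measurable_Iint ts mF F0)).
  apply: measurable_envP => u; rewrite /upd.
  case: (u == s); first exact: measurable_snd.
  by case: (u == t); first exact: measurable_fst.
- by move=> p; exact: Iint_ge0.
Qed.

Lemma Iint_cons t ts F : Iint (t :: ts) F = Iint [:: t] (Iint ts F).
Proof. by []. Qed.

Lemma Iint_rem t ts F : measurable_fun [set: env] F -> (forall x, 0 <= F x) ->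
  t \in ts -> Iint ts F = Iint (t :: rem t ts) F.
Proof.
move=> mF F0; elim: ts => // s ts IH.
rewrite inE; case: (eqVneq s t) => [->|st /=]; first by rewrite /= eqxx.
case: eqVneq st => // _ _ tin.
by rewrite [RHS](@Iint_swap t s) // Iint_cons (IH tin).
Qed.

Lemma Iint_perm ts ts' F : measurable_fun [set: env] F -> (forall x, 0 <= F x) ->
  perm_eq ts ts' -> Iint ts F = Iint ts' F.
Proof.
move=> mF F0; elim: ts ts' => [|t ts IH] ts'.
  by rewrite perm_sym => /perm_nilP ->.
move=> pe; have tin : t \in ts' by rewrite -(perm_mem pe) mem_head.
rewrite (Iint_rem mF F0 tin) Iint_cons [RHS]Iint_cons; congr (Iint _ _).
apply: IH; rewrite -(perm_cons t).
by apply: perm_trans pe _; exact: perm_to_rem.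
Qed.

Lemma Iint_ext ts F G (x : env) :
  (forall y : env, (forall t, t \notin ts -> y t = x t) -> F y = G y) ->
  Iint ts F x = Iint ts G x.
Proof.
elim: ts x => [|t ts IH] x FG /=; first by apply: FG.
apply: eq_integral => r _; apply: IH => y yx; apply: FG => s.
by rewrite inE negb_or => /andP[st sts]; rewrite yx // upd_neq.
Qed.

Lemma le_Iint_fibre ts F G (x : env) :
  measurable_fun [set: env] F -> (forall x, 0 <= F x) ->
  measurable_fun [set: env] G -> (forall x, 0 <= G x) ->
  (forall y : env, (forall t, t \notin ts -> y t = x t) -> F y <= G y) ->
  Iint ts F x <= Iint ts G x.
Proof.
move=> mF F0 mG G0.
elim: ts x => [|t ts IH] x FG /=; first by apply: FG.
apply: ge0_le_integral => //.
- by move=> r _; exact: Iint_ge0.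
- by apply: measurable_upd1F; exact: measurable_Iint.
- by apply: measurable_upd1F; exact: measurable_Iint.
move=> r _; apply: IH => y yx; apply: FG => s.
by rewrite inE negb_or => /andP[st sts]; rewrite yx // upd_neq.
Qed.

Lemma Iint_nneseries ts (F : nat -> env -> \bar R) :
  (forall k, measurable_fun [set: env] (F k)) -> (forall k x, 0 <= F k x) ->
  forall x, Iint ts (fun y => \sum_(0 <= k <oo) F k y) x =
            \sum_(0 <= k <oo) Iint ts (F k) x.
Proof.
move=> mF F0; elim: ts => //= t ts IH x.
rewrite -integral_nneseries //.
- by apply: eq_integral => r _; rewrite IH.
- by move=> k; apply: measurable_upd1F; exact: measurable_Iint.
- by move=> k r _; exact: Iint_ge0.
Qed.

Lemma IintZ ts (c : \bar R) F : measurable_fun [set: env] F -> (forall x, 0 <= F x) ->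
  0 <= c -> forall x, Iint ts (fun y => c * F y) x = c * Iint ts F x.
Proof.
move=> mF F0 c0; elim: ts => //= t ts IH x.
rewrite -ge0_integralZl //.
- by apply: eq_integral => r _; rewrite IH.
- by apply: measurable_upd1F; exact: measurable_Iint.
- by move=> r _; exact: Iint_ge0.
Qed.

Lemma IintZ_fun ts (c F : env -> \bar R) :
  measurable_fun [set: env] F -> (forall x, 0 <= F x) -> (forall x, 0 <= c x) ->
  (forall t x r, t \in ts -> c (upd x t r) = c x) ->
  forall x, Iint ts (fun y => c y * F y) x = c x * Iint ts F x.
Proof.
move=> mF F0 c0; elim: ts => //= t ts IH ct x.
rewrite -ge0_integralZl //.
- apply: eq_integral => r _; rewrite IH ?ct ?mem_head// => s y r' sts.
  by rewrite ct // inE sts orbT.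
- by apply: measurable_upd1F; exact: measurable_Iint.
- by move=> r _; exact: Iint_ge0.
Qed.

Lemma Iint_agree ts F (x y : env) : (forall t, t \notin ts -> x t = y t) ->
  Iint ts F x = Iint ts F y.
Proof.
elim: ts x y => [|t ts IH] x y xy /=.
  by congr F; apply/funext => t; exact: xy.
apply: eq_integral => r _; apply: IH => s sts; rewrite /upd.
by case: eqVneq => // st; apply: xy; rewrite inE negb_or st.
Qed.

End Env.

(** * Affine substitutions in one variable *)

Section affine1.
Context (R : realType).
Local Open Scope ereal_scope.
Local Notation mu := (@lebesgue_measure R).

Lemma measurable_affine (a c : R) :
  measurable_fun [set: measurableTypeR R]
    (fun r : measurableTypeR R => (a * r + c)%R : measurableTypeR R).
Proof. by apply: measurable_funD => //; apply: measurable_funM. Qed.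

(** The push-forward scaled by [a] agrees with Lebesgue measure on half-open intervals, hence
    everywhere by uniqueness. *)
Lemma lebesgue_measure_affine (a c : R) (A : set R) : (0 < a)%R ->
  measurable A ->
  a%:E * mu ((fun r => (a * r + c)%R) @^-1` A) = mu A.
Proof.
move=> a0 mA.
pose phi := (fun r : measurableTypeR R => (a * r + c)%R : measurableTypeR R).
have a0' := ltW a0.
pose nu' := mscale (NngNum a0') (pushforward mu phi).
pose nu := nu' (measurable_affine a c).
rewrite -[LHS]/(nu A).
apply/esym/lebesgue_measure_unique => //= _ [[x y]] _ <-.
transitivity (a%:E * mu (phi @^-1` `]x, y]%classic)); last by [].
have -> : phi @^-1` `]x, y] = `]((x - c) / a)%R, ((y - c) / a)%R]%classic.
  apply/seteqP; split=> r /=; rewrite !in_itv /= /phi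
    ltr_pdivrMr // ler_pdivlMr // ltrBlDr lerBrDr mulrC //.
rewrite !lebesgue_measure_itv /= !lte_fin ltr_pM2r ?invr_gt0 // ltrD2r.
case: ifP => _; last by rewrite mule0.
rewrite -!EFinB -EFinM; congr EFin.
by rewrite -mulrBl mulrC divfK ?gt_eqF//; lra.
Qed.

Lemma integral_affine (a c : R) (g : R -> \bar R) : (0 < a)%R ->
  measurable_fun [set: R] g -> (forall r, 0 <= g r) ->
  a%:E * \int[mu]_r g (a * r + c)%R = \int[mu]_r g r.
Proof.
move=> a0 mg g0.
pose phi := (fun r : measurableTypeR R => (a * r + c)%R : measurableTypeR R).
have a0' := ltW a0.
pose nu' := mscale (NngNum a0') (pushforward mu phi).
pose nu := nu' (measurable_affine a c).
have -> : \int[mu]_r g (a * r + c)%R = \int[pushforward mu phi]_r g r.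
  by rewrite (ge0_integral_pushforward (measurable_affine a c)).
rewrite -[a]/((NngNum a0')%:num) -ge0_integral_mscale //.
  exact: measurable_affine.
move=> mphi; apply: eq_measure_integral => //= A mA _.
by rewrite -(lebesgue_measure_affine c a0 mA).
Qed.

End affine1.

Section EnvAffine.
Context (R : realType) (T : choiceType).
Local Notation env := (env R T).
Local Open Scope ereal_scope.

(** Translation invariance in one variable, by an amount that may depend on all the other
    coordinates: the elementary step of a shear. *)
Lemma Iint_shift1 t (c : env -> R) (F : env -> \bar R) (x : env) :
  measurable_fun [set: env] F -> (forall x, 0 <= F x) ->
  (forall r, c (upd x t r) = c x) ->
  Iint [:: t] (fun y => F (upd y t (y t + c y)%R)) x = Iint [:: t] F x.
Proof.
move=> mF F0 cx /=.
rewrite -[RHS](integral_affine (c x) (@ltr01 R)).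
- rewrite mul1e; apply: eq_integral => r _.
  by rewrite upd_upd upd_id cx mul1r.
- exact: measurable_upd1F.
- by move=> r.
Qed.

(* The one-dimensional substitution [r = a r' + b z t], coordinate by
   coordinate. *)
Lemma Iint_affine_le ts (a b : R) (z : env) (F G : env -> \bar R) :
  (0 < a)%R -> measurable_fun [set: env] F -> (forall x, 0 <= F x) ->
  measurable_fun [set: env] G -> (forall x, 0 <= G x) ->
  (forall x : env, F x <= G (fun s => a * x s + b * z s)%R) ->
  forall x : env, (a ^+ size ts)%:E * Iint ts F x <=
    Iint ts G (fun s => a * x s + b * z s)%R.
Proof.
move=> a0 mF F0 mG G0 FG; elim: ts => [|t ts IH] x /=.
  by rewrite expr0 mul1e.
rewrite -[leRHS](integral_affine (b * z t)%R a0); last 2 first.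
- by apply: measurable_upd1F; exact: measurable_Iint.
- by move=> r; exact: Iint_ge0.
rewrite exprS EFinM -muleA; apply: lee_wpmul2l.
  by rewrite lee_fin ltW.
rewrite -ge0_integralZl //; last 3 first.
- by apply: measurable_upd1F; exact: measurable_Iint.
- by move=> r _; exact: Iint_ge0.
- by rewrite lee_fin exprn_ge0 // ltW.
apply: ge0_le_integral => //.
- by move=> r _; rewrite mule_ge0 ?Iint_ge0 // lee_fin exprn_ge0 // ltW.
- apply: measurable_funeM.
  by apply: measurable_upd1F; exact: measurable_Iint.
- apply: (@measurableT_comp _ _ _ _ _ _ (fun r => Iint ts G
    (upd (fun s => a * x s + b * z s)%R t r))).
    by apply: measurable_upd1F; exact: measurable_Iint.
  exact: measurable_affine.
move=> r _; apply: le_trans (IH _) _.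
rewrite (_ : (fun s => _) = upd (fun s => a * x s + b * z s)%R t
  (a * r + b * z t)%R) //.
by apply/funext => s; rewrite /upd; case: eqVneq => [->|].
Qed.

End EnvAffine.

Section Leb.
Context (R : realType) (T : choiceType).
Local Notation env := (env R T).
Local Open Scope ereal_scope.

(** Lebesgue measure, in the coordinates [ts], of the slice of [A] on which the other coordinates
    are those of [x]. *)
Definition Leb (ts : seq T) (x : env) (A : set env) : \bar R :=
  Iint ts (fun y => (\1_A y)%:E) x.

Lemma measurable_indicE (A : set env) : measurable A ->
  measurable_fun [set: env] (fun y => (\1_A y : R)%:E).
Proof. by move=> mA; apply/measurable_EFinP; exact: measurable_indic. Qed.

Variables (ts : seq T) (x : env).

Let Leb0 : Leb ts x set0 = 0.
Proof.
rewrite /Leb; elim: ts x => [|t ts' IH] x' /=; first by rewrite indic0.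
by apply: integral0_eq => r _; exact: IH.
Qed.

Let Leb_ge0 A : 0 <= Leb ts x A.
Proof. by apply: Iint_ge0 => y; rewrite lee_fin indicE; case: (_ \in _). Qed.

Let Leb_sigma_additive : semi_sigma_additive (Leb ts x).
Proof.
move=> F mF tF mUF.
have -> : Leb ts x (\bigcup_n F n) = \sum_(0 <= k <oo) Leb ts x (F k).
  rewrite /Leb -Iint_nneseries.
  - by apply: Iint_ext => y _; rewrite indic_bigcup.
  - by move=> k; exact: measurable_indicE.
  - by move=> k y; rewrite lee_fin indicE; case: (_ \in _).
by apply: is_cvg_nneseries => k _ _; exact: Leb_ge0.
Qed.

HB.instance Definition _ :=
  isMeasure.Build _ _ _ (Leb ts x) Leb0 Leb_ge0 Leb_sigma_additive.

End Leb.

(** * Hausdorff measure *)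

Section Hausdorff.
Context (R : realType).
Local Open Scope ereal_scope.

Lemma hausdorff_weight_ge0 (T : finType) d (U : set (T -> R)) :
  0 <= hausdorff_weight d U.
Proof.
rewrite /hausdorff_weight; case: eqP => // U0.
apply: expe_ge0; have /set0P[u Uu] : U != set0 by apply/eqP.
apply: ereal_sup_ubound; exists (u, u) => //=; congr EFin.
by rewrite /euclid_dist big1 ?sqrtr0 // => i _; rewrite subrr expr0n.
Qed.

Lemma ediam_ge0 (T : finType) (U : set (T -> R)) : U !=set0 -> 0 <= ediam U.
Proof.
move=> [u Uu]; apply: ereal_sup_ubound; exists (u, u) => //=; congr EFin.
by rewrite /euclid_dist big1 ?sqrtr0 // => i _; rewrite subrr expr0n.
Qed.

(* Reduces countable subadditivity to the outer measure of the library, on the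
   discrete measurable space: sets that are too large get infinite weight. *)
Lemma hausdorff_preE (T : finType) d (delta : R) (A : set (T -> R)) :
  hausdorff_pre d delta A =
  mu_ext (fun U : set (g_sigma_algebraType [set: set (T -> R)]) =>
    if ediam U <= delta%:E then hausdorff_weight d U else +oo) A.
Proof.
have mall (U : set (g_sigma_algebraType [set: set (T -> R)])) : measurable U.
  exact: sub_sigma_algebra.
apply/eqP; rewrite eq_le; apply/andP; split.
- apply/ereal_infP => _ [U [_ AU] <-].
  case: (pselect (forall k, ediam (U k) <= delta%:E)) => [dU|].
    apply: ereal_inf_lbound; exists U => //.
    by apply: eq_eseriesr => k _; rewrite dU.
  move=> /existsNP[k /negP dk].
  rewrite (_ : \sum_(0 <= _ <oo) _ = +oo) ?leey //.
  apply: (@eseries_pinfty _ _ xpredT k) => //; last by rewrite (negbTE dk).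
  move=> i _; case: ifP => // _.
  by rewrite gt_eqF // (lt_le_trans _ (hausdorff_weight_ge0 _ _)).
- apply/ereal_infP => _ [U [AU dU] <-].
  apply: ereal_inf_lbound; exists U => //.
  by apply: eq_eseriesr => k _; rewrite dU.
Qed.

Lemma hausdorff_pre_ge0 (T : finType) d (delta : R) (A : set (T -> R)) :
  0 <= hausdorff_pre d delta A.
Proof.
apply/ereal_infP => _ [U _ <-].
by apply: nneseries_ge0 => k _ _; exact: hausdorff_weight_ge0.
Qed.

Lemma hausdorff_pre_sigma_subadditive (T : finType) d (delta : R) :
  sigma_subadditive (@hausdorff_pre R T d delta).
Proof.
move=> F; rewrite hausdorff_preE.
under eq_eseriesr => k _ do rewrite hausdorff_preE.
apply: mu_ext_sigma_subadditive => U; case: ifP => // _.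
exact: hausdorff_weight_ge0.
Qed.

Lemma hausdorff_pre_le_raw (T : finType) d (delta : R) (A : set (T -> R)) :
  (0 < delta)%R -> hausdorff_pre d delta A <= hausdorff_raw d A.
Proof. by move=> d0; apply: ereal_sup_ubound; exists delta. Qed.

Lemma hausdorff_raw_ge0 (T : finType) d (A : set (T -> R)) :
  0 <= hausdorff_raw d A.
Proof.
by apply: le_trans (hausdorff_pre_le_raw d A (@ltr01 R)); exact: hausdorff_pre_ge0.
Qed.

Lemma hausdorff_raw_sigma_subadditive (T : finType) d :
  sigma_subadditive (@hausdorff_raw R T d).
Proof.
move=> F; apply/ereal_supP => _ [delta /= d0 <-].
apply: le_trans (hausdorff_pre_sigma_subadditive d delta F) _.
apply: lee_nneseries => [k _ _|k _]; first exact: hausdorff_pre_ge0.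
exact: hausdorff_pre_le_raw.
Qed.

Lemma hausdorff_raw_le (T : finType) d (A B : set (T -> R)) :
  A `<=` B -> hausdorff_raw d A <= hausdorff_raw d B.
Proof.
move=> AB; apply/ereal_supP => _ [delta /= d0 <-].
apply: le_trans (hausdorff_pre_le_raw d B d0).
apply: le_ereal_inf => _ [U [BU dU] <-]; exists U => //.
by split => //; apply: subset_trans BU.
Qed.

Lemma hausdorff_pre_le_weight (T : finType) d (delta : R) (U : set (T -> R)) :
  ediam U <= delta%:E -> (0 <= delta)%R ->
  hausdorff_pre d delta U <= hausdorff_weight d U.
Proof.
move=> dU d0.
(* Padding by empty sets is free: they have weight 0 and diameter [-oo]. *)
pose V k := if k == 0%N then U else set0.
have -> : hausdorff_weight d U = \sum_(0 <= k <oo) hausdorff_weight d (V k).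
  rewrite nneseries_recl //; last by move=> k _; exact: hausdorff_weight_ge0.
  rewrite eseries0 ?adde0 // => k k1 _.
  by rewrite /V gtn_eqF // /hausdorff_weight eqxx.
apply: ereal_inf_lbound; exists V => //; split.
  by move=> u Uu; exists 0%N.
move=> k; rewrite /V; case: ifP => // _.
rewrite /ediam (_ : [set _ | _ in _] = set0) ?ereal_sup0 ?leNye //.
by apply/seteqP; split => // x [p []].
Qed.

Lemma hausdorff_pre0 (T : finType) d (delta : R) : (0 <= delta)%R ->
  hausdorff_pre d delta (@set0 (T -> R)) = 0.
Proof.
move=> d0; apply/eqP; rewrite eq_le hausdorff_pre_ge0 andbT.
apply: le_trans (hausdorff_pre_le_weight d _ d0) _; last first.
  by rewrite /hausdorff_weight eqxx.
rewrite /ediam (_ : [set _ | _ in _] = set0) ?ereal_sup0 ?leNye //.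
by apply/seteqP; split => // x [p []].
Qed.

Lemma hausdorff_raw0 (T : finType) d : hausdorff_raw d (@set0 (T -> R)) = 0.
Proof.
apply/eqP; rewrite eq_le hausdorff_raw_ge0 andbT.
apply/ereal_supP => _ [delta /= d0 <-].
by rewrite hausdorff_pre0 // ltW.
Qed.

Lemma lee_expe (x y : \bar R) d : 0 <= x -> x <= y -> x ^+ d <= y ^+ d.
Proof.
move=> x0 xy; elim: d => [|d IH]; first by rewrite !expe0.
by rewrite !expeS; apply: lee_pmul => //; exact: expe_ge0.
Qed.

Lemma EFin_mul_expe (r : R) (x : \bar R) d :
  (r%:E * x) ^+ d = (r ^+ d)%:E * x ^+ d.
Proof.
elim: d => [|d IH]; first by rewrite !expe0 mul1e.
by rewrite !expeS IH exprS EFinM muleACA.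
Qed.

Lemma hausdorff_raw_lipschitz (X : Type) (T T' : finType) d (A : set X)
    (g : X -> T -> R) (h : X -> T' -> R) (L : R) : (0 < L)%R ->
  (forall a b, A a -> A b ->
    (euclid_dist (g a) (g b) <= L * euclid_dist (h a) (h b))%R) ->
  hausdorff_raw d (g @` A) <= (L ^+ d)%:E * hausdorff_raw d (h @` A).
Proof.
move=> L0 gh; have Ld0 : (0 < L ^+ d)%R by rewrite exprn_gt0.
apply/ereal_supP => _ [delta /= d0 <-].
have dL0 : (0 < delta / L)%R by rewrite divr_gt0.
apply: (@le_trans _ _ ((L ^+ d)%:E * hausdorff_pre d (delta / L) (h @` A)));
  last first.
  by apply: lee_wpmul2l; [rewrite lee_fin ltW|exact: hausdorff_pre_le_raw].
rewrite -lee_pdivrMl //; apply/ereal_infP => _ [U [hU dU] <-].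
rewrite lee_pdivrMl // -nneseriesZl; last first.
  by move=> k _; exact: hausdorff_weight_ge0.
pose V k := g @` (A `&` h @^-1` (U k)).
have dV k : V k !=set0 -> U k !=set0 /\ ediam (V k) <= L%:E * ediam (U k).
  move=> [_ [a [Aa Ua] _]]; split; first by exists (h a).
  apply/ereal_supP => _ [[_ _] [[a1 [A1 U1] <-] [a2 [A2 U2] <-]] <-] /=.
  apply: (@le_trans _ _ (L * euclid_dist (h a1) (h a2))%:E).
    by rewrite lee_fin gh.
  rewrite EFinM; apply: lee_wpmul2l; first by rewrite lee_fin ltW.
  by apply: ereal_sup_ubound; exists (h a1, h a2).
apply: (@le_trans _ _ (\sum_(0 <= k <oo) hausdorff_weight d (V k))).
  apply: ereal_inf_lbound; exists V => //; split.
    move=> _ [a Aa <-]; have [k _ Uk] := hU (h a) (ex_intro2 _ _ a Aa erefl).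
    by exists k => //; exists a.
  move=> k; have [/dV[_ Vk]|] := pselect (V k !=set0).
    apply: le_trans Vk _; rewrite muleC -lee_pdivlMr // -EFinM; exact: dU.
  move=> /set0P/negP; rewrite negbK => /eqP ->.
  rewrite /ediam (_ : [set _ | _ in _] = set0) ?ereal_sup0 ?leNye //.
  by apply/seteqP; split => // x [p []].
apply: lee_nneseries => [k _ _|k _]; first exact: hausdorff_weight_ge0.
rewrite {1}/hausdorff_weight; case: eqP => V0.
  by rewrite mule_ge0 ?hausdorff_weight_ge0 // lee_fin ltW.
have Vne : V k !=set0 by apply/set0P/eqP.
have [Une le] := dV k Vne.
rewrite /hausdorff_weight; case: eqP => [U0|_].
  by move: Une; rewrite U0 => -[].
rewrite -EFin_mul_expe; apply: lee_expe => //; exact: ediam_ge0.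
Qed.

Lemma hausdorff_raw_isometry (X : Type) (T T' : finType) d (A : set X)
    (g : X -> T -> R) (h : X -> T' -> R) :
  (forall a b, A a -> A b ->
    (euclid_dist (g a) (g b) <= euclid_dist (h a) (h b))%R) ->
  hausdorff_raw d (g @` A) <= hausdorff_raw d (h @` A).
Proof.
move=> gh; rewrite -[leRHS]mul1e -(expr1n R d).
by apply: hausdorff_raw_lipschitz => // a b Aa Ab; rewrite mul1r gh.
Qed.

End Hausdorff.

(** * Dyadic cubes *)

Section Boxes.
Context (R : realType) (T : choiceType).
Local Notation env := (env R T).
Local Notation mu := (@lebesgue_measure R).
Local Open Scope ereal_scope.

Definition box (ts : seq T) (B : T -> set R) : set env :=
  [set y | forall t, t \in ts -> B t (y t)].

Lemma box_cons t ts B :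
  box (t :: ts) B = ((fun y : env => y t) @^-1` B t) `&` box ts B.
Proof.
apply/seteqP; split=> y /=.
  by move=> yB; split=> [|s sts]; apply: yB; rewrite inE ?eqxx // sts orbT.
by move=> [yt yB] s; rewrite inE => /predU1P[->|/yB].
Qed.

Lemma measurable_box ts B : (forall t, measurable (B t)) ->
  measurable (box ts B).
Proof.
move=> mB; elim: ts => [|t ts IH].
  by rewrite (_ : box _ _ = setT) //; apply/seteqP; split.
rewrite box_cons; apply: measurableI => //.
by rewrite -[X in measurable X]setTI; exact: measurable_coord.
Qed.

Lemma Leb_box ts (B : T -> set R) (l : T -> R) (x : env) : uniq ts ->
  (forall t, measurable (B t)) -> (forall t, mu (B t) = (l t)%:E) ->
  Leb ts x (box ts B) = (\prod_(t <- ts) l t)%:E.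
Proof.
move=> + mB lB; elim: ts x => [|t ts IH] x /=.
  by rewrite big_nil /Leb /= indicE mem_set // => s; rewrite in_nil.
move=> /andP[tts uts]; rewrite big_cons EFinM -lB -(IH x uts).
have mbox := measurable_box ts mB.
transitivity (\int[mu]_r ((\1_(B t) r)%:E * Leb ts x (box ts B))).
  rewrite /Leb /=; apply: eq_integral => r _.
  rewrite -[RHS]/((\1_(B t) r)%:E * Leb ts x (box ts B)).
  have -> : \1_(B t) r = \1_(B t) (upd x t r t) :> R by rewrite upd_id.
  have -> : Leb ts x (box ts B) = Leb ts (upd x t r) (box ts B) by rewrite !(IH _ uts).
  rewrite -(@IintZ_fun _ _ ts (fun y : env => (\1_(B t) (y t))%:E)).
  - apply: Iint_ext => y _.
    rewrite box_cons indicI /= EFinM; congr (_ * _).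
  - exact: measurable_indicE.
  - by move=> y; rewrite lee_fin.
  - by move=> y; rewrite lee_fin.
  - move=> s y r' sts; rewrite upd_neq //.
    by apply: contraNneq tts => ->.
rewrite ge0_integralZr //=.
- congr (_ * _); rewrite integral_indic ?setIT //; exact: mB.
- by apply/measurable_EFinP; apply: measurable_indic; exact: mB.
Qed.

End Boxes.

Section Cubes.
Context (R : realType) (T : choiceType).
Local Notation env := (env R T).
Local Notation mu := (@lebesgue_measure R).
Local Open Scope ereal_scope.

Lemma lebesgue_itv_co (a b : R) : (a <= b)%R -> mu `[a, b[ = (b - a)%:E.
Proof.
rewrite lebesgue_measure_itv /= lte_fin le_eqVlt => /predU1P[->|->//].
by rewrite ltxx subrr.
Qed.

Lemma lebesgue_itv_cc (a b : R) : (a <= b)%R -> mu `[a, b] = (b - a)%:E.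
Proof.
rewrite lebesgue_measure_itv /= lte_fin le_eqVlt => /predU1P[->|->//].
by rewrite ltxx subrr.
Qed.

Lemma floor_pre (m : nat) (z : int) :
  [set r : R | Num.floor (2 ^+ m * r) = z] =
  `[(z%:~R / 2 ^+ m)%R, ((z + 1)%:~R / 2 ^+ m)%R[%classic.
Proof.
have m0 : (0 < 2 ^+ m :> R)%R by rewrite exprn_gt0.
apply/seteqP; split=> r /=; rewrite in_itv /= ler_pdivrMr // ltr_pdivlMr //
    (mulrC r).
  by move=> <-; exact: floor_itv.
by move=> ?; exact: floor_def.
Qed.

(** Dyadic cubes as level sets of floors: they are half-open, those of one size partition the space,
    any member names its cube, and coordinates outside [ts] are unconstrained. *)
Definition cube (ts : seq T) (m : nat) (x : env) : set env :=
  box ts (fun t => [set r | Num.floor (2 ^+ m * r) = Num.floor (2 ^+ m * x t)]%R).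

Lemma measurable_cube ts m x : measurable (cube ts m x).
Proof. by apply: measurable_box => t; rewrite floor_pre. Qed.

Lemma Leb_cube ts m (x y : env) : uniq ts ->
  Leb ts y (cube ts m x) = (2 ^- m ^+ size ts)%:E.
Proof.
move=> uts; rewrite (Leb_box (l := fun=> 2 ^- m)) //.
- by rewrite big_const_seq count_predT iter_mulr_1.
- by move=> t; rewrite floor_pre.
move=> t; rewrite floor_pre lebesgue_itv_co.
  congr EFin; rewrite -mulrBl intrD /=; lra.
by rewrite ler_pM2r ?invr_gt0 ?exprn_gt0 // ler_int; lia.
Qed.

Definition key (ts : seq T) (m : nat) (x : env) : seq int :=
  [seq Num.floor (2 ^+ m * x t)%R | t <- ts].

Lemma cube_key ts m x y : cube ts m x y <-> key ts m y = key ts m x.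
Proof. by rewrite -eq_in_map. Qed.

Definition cubical (ts : seq T) (m : nat) (A : set env) : Prop :=
  forall x y, cube ts m x y -> A x -> A y.

Lemma cube_sym ts m x y : cube ts m x y -> cube ts m y x.
Proof. by rewrite !cube_key => ->. Qed.

Lemma cube_trans ts m x y z : cube ts m x y -> cube ts m y z -> cube ts m x z.
Proof. by rewrite !cube_key => <-. Qed.

Lemma floor_half (m : nat) (r s : R) :
  Num.floor (2 ^+ m.+1 * r)%R = Num.floor (2 ^+ m.+1 * s)%R ->
  Num.floor (2 ^+ m * r)%R = Num.floor (2 ^+ m * s)%R.
Proof.
move=> rs.
(* The coarse floor is the integer half of the fine one, which is why dyadic cubes are nested. *)
have h (q : R) : Num.floor (2 ^+ m * q)%R =
    (Num.floor (2 ^+ m.+1 * q)%R %/ 2)%Z.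
  apply: floor_def; set z := Num.floor (2 ^+ m.+1 * q)%R.
  have /andP[zl zr] := floor_itv (2 ^+ m.+1 * q)%R; rewrite -/z in zl zr.
  have zE := divz_eq z 2; set k := (z %/ 2)%Z in zE *.
  have e0 : (0 <= (z %% 2)%Z)%R by rewrite modz_ge0.
  have e1 : ((z %% 2)%Z < 2)%R by rewrite ltz_pmod.
  have zk : (k * 2 <= z <= k * 2 + 1)%R by lia.
  have : ((k * 2)%:~R <= z%:~R :> R)%R by rewrite ler_int; case/andP: zk.
  have : (z%:~R <= (k * 2 + 1)%:~R :> R)%R by rewrite ler_int; case/andP: zk.
  move: zl zr; rewrite exprS !intrD intrM /= => zl zr h1 h2.
  by apply/andP; split; lra.
by rewrite !h rs.
Qed.

Lemma cubeS ts m x y : cube ts m.+1 x y -> cube ts m x y.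
Proof. by move=> xy t tts; apply: floor_half; exact: xy. Qed.

Lemma cubicalS ts m A : cubical ts m A -> cubical ts m.+1 A.
Proof. by move=> cA x y /cubeS; exact: cA. Qed.

Lemma cubical_le ts m n A : (m <= n)%N -> cubical ts m A -> cubical ts n A.
Proof.
move=> /subnKC <-; elim: (n - m)%N => [|k IH]; first by rewrite addn0.
by move=> /IH; rewrite addnS; exact: cubicalS.
Qed.

Lemma cubicalC ts m A : cubical ts m A -> cubical ts m (~` A).
Proof. by move=> cA x y /cube_sym xy nAx Ay; apply: nAx; exact: cA xy Ay. Qed.

Lemma cubicalI ts m A B :
  cubical ts m A -> cubical ts m B -> cubical ts m (A `&` B).
Proof. by move=> cA cB x y xy [Ax Bx]; split; [exact: cA xy Ax|exact: cB xy Bx]. Qed.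

(** Enumerates the cubes meeting [A]: a cube is named by its list of floors, and such lists are
    countable. Codes of no list, or of a cube missing [A], give an empty cell. *)
Definition cell ts m (A : set env) (k : nat) : set env :=
  [set y | A y /\ pickle_inv k = Some (key ts m y)].

Lemma bigcup_cell ts m A : \bigcup_k cell ts m A k = A.
Proof.
apply/seteqP; split=> [y [k _ []]//|y Ay].
by exists (pickle (key ts m y)) => //; split => //; rewrite pickleK_inv.
Qed.

Lemma trivIset_cell ts m A : trivIset setT (cell ts m A).
Proof.
apply/trivIsetP => i j _ _ ij; apply/seteqP; split => // y [[_ yi] [_ yj]].
move/eqP: ij; apply.
by rewrite -(@pickle_invK (seq int) i) -(@pickle_invK (seq int) j) yi yj.
Qed.

Lemma cell_cubical ts m A k : cubical ts m A ->
  cell ts m A k = set0 \/ exists x, cell ts m A k = cube ts m x.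
Proof.
move=> cA; have [[x [Ax xk]]|ne] := pselect (cell ts m A k !=set0); last first.
  by left; apply/eqP; apply: contra_notT ne => /set0P.
right; exists x; apply/seteqP; split => y.
  by move=> [_]; rewrite xk => -[/esym/cube_key].
move=> /[dup] xy /cube_key yx; split; first exact: cA xy Ax.
by rewrite xk yx.
Qed.

Lemma measurable_cubical ts m A : cubical ts m A -> measurable A.
Proof.
move=> cA; rewrite -(bigcup_cell ts m A); apply: bigcupT_measurable => k.
have [->|[x ->]] := cell_cubical k cA; first exact: measurable0.
exact: measurable_cube.
Qed.

End Cubes.

(** * An outer measure controlled on cubes, against Lebesgue measure *)

Section OuterLeb.
Context (R : realType) (T : choiceType).
Local Notation env := (env R T).
Local Open Scope ereal_scope.
Variables (ts : seq T) (eta : set env -> \bar R) (c : R) (x0 : env).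
Hypothesis uts : uniq ts.
Hypotheses (eta_le : forall A B, A `<=` B -> eta A <= eta B).
Hypotheses (eta_ge0 : forall A, 0 <= eta A) (eta0 : eta set0 = 0).
Hypotheses (eta_sub : sigma_subadditive eta).
Local Notation leb := (Leb ts x0).

(** A cubical set is a countable disjoint union of cubes; [eta] is countably subadditive there and
    [leb] countably additive. *)
Lemma outer_le_cubical m A :
  (forall x, eta (cube ts m x) <= (c * 2 ^- m ^+ size ts)%:E) ->
  cubical ts m A -> eta A <= c%:E * leb A.
Proof.
move=> eta_cube cA.
have mcell k : measurable (cell ts m A k).
  have [->|[x ->]] := cell_cubical k cA; first exact: measurable0.
  exact: measurable_cube.
rewrite -{1}(bigcup_cell ts m A); apply: le_trans (eta_sub _) _.
have -> : leb A = \sum_(0 <= k <oo) leb (cell ts m A k).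
  rewrite -{1}(bigcup_cell ts m A) measure_bigcup //.
    by apply: eq_eseriesl => k; rewrite in_setT.
  exact: trivIset_cell.
rewrite -nneseriesZl; last by move=> k _; exact: measure_ge0.
apply: lee_nneseries => [k _ _|k _]; first exact: eta_ge0.
have [->|[x ->]] := cell_cubical k cA; first by rewrite eta0 measure0 mule0.
by rewrite Leb_cube // -EFinM.
Qed.

Hypothesis eta_cube :
  forall m x, eta (cube ts m x) <= (c * 2 ^- m ^+ size ts)%:E.
Variables (K : set env) (M : nat).
Hypothesis K_bounded :
  forall x, K x -> forall t, t \in ts -> (`|x t| < 2 ^+ M)%R.
Hypothesis K_closed : forall x : env,
  (forall e : R, (0 < e)%R ->
    exists2 y, K y & forall t, t \in ts -> (`|x t - y t| <= e)%R) -> K x.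

Definition outer_cubes m : set env := [set y | exists2 x, K x & cube ts m x y].

Lemma cubical_outer m : cubical ts m (outer_cubes m).
Proof. by move=> x y xy [z Kz zx]; exists z => //; exact: cube_trans xy. Qed.

Lemma sub_outer m : K `<=` outer_cubes m.
Proof. by move=> x Kx; exists x. Qed.

Lemma outer_nonincreasing : nonincreasing_seq outer_cubes.
Proof.
move=> m n mn; apply/subsetPset => y [x Kx xy]; exists x => //.
move: mn xy => /subnKC <-; elim: (n - m)%N => [|k IH]; first by rewrite addn0.
by rewrite addnS => /cubeS; exact: IH.
Qed.

Lemma cube_dist m (x y : env) t : cube ts m x y -> t \in ts ->
  (`|y t - x t| <= 2 ^- m)%R.
Proof.
move=> xy tts; have {}xy := xy t tts; rewrite /= in xy.
have m0 : (0 < 2 ^+ m :> R)%R by rewrite exprn_gt0.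
have := floor_itv (2 ^+ m * y t)%R; have := floor_itv (2 ^+ m * x t)%R.
rewrite xy; set z := Num.floor _ => /andP[a1 a2] /andP[b1 b2].
rewrite -div1r ler_pdivlMr // -[X in (_ * X)%R](gtr0_norm m0) -normrM ler_norml.
by rewrite intrD in a2 b2; apply/andP; split; lra.
Qed.

Lemma bigcap_outer : \bigcap_m outer_cubes m = K.
Proof.
apply/seteqP; split; last by move=> x Kx m _; exact: sub_outer.
move=> x Kx; apply: K_closed => e e0.
have [m me] : exists m, (2 ^- m <= e)%R.
  have [m _ /(_ m (leqnn m))] := near_infty_natSinv_expn_lt (PosNum e0).
  by rewrite /= div1r => /ltW ?; exists m.
have [y Ky yx] := Kx m I.
by exists y => // t tts; apply: le_trans me; exact: cube_dist yx tts.
Qed.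

Lemma measurable_outer m : measurable (outer_cubes m).
Proof. exact: measurable_cubical (@cubical_outer m). Qed.

Lemma measurable_closed_bounded : measurable K.
Proof.
rewrite -bigcap_outer; apply: bigcapT_measurable => m; exact: measurable_outer.
Qed.

(** Half-open with integer ends, hence a union of unit cubes and cubical at every level. *)
Definition big_cube : set env :=
  box ts (fun=> `[- (2 ^+ M), 2 ^+ M[%classic)%R.

Lemma sub_big_cube : K `<=` big_cube.
Proof.
move=> x Kx t tts; have := K_bounded Kx tts.
by rewrite /= in_itv /= ltr_norml => /andP[/ltW -> ->].
Qed.

Lemma measurable_big_cube : measurable big_cube.
Proof. exact: measurable_box. Qed.

Lemma Leb_big_cube : leb big_cube = ((2 ^+ M.+1) ^+ size ts)%:E.
Proof.
rewrite (Leb_box (l := fun=> (2 ^+ M.+1)%R)) //.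
  by rewrite big_const_seq count_predT iter_mulr_1.
move=> t; rewrite lebesgue_itv_co; last first.
  by rewrite (@le_trans _ _ 0%R) // ?oppr_le0 exprn_ge0.
by congr EFin; rewrite opprK exprS; lra.
Qed.

Lemma cubical_big_cube : cubical ts 0 big_cube.
Proof.
move=> x y xy Cx t tts; have := Cx t tts; have := xy t tts.
rewrite /= !in_itv /= !expr0 !mul1r => yx /andP[h1 h2].
have e : (2 ^+ M = (2 ^+ M : int)%:~R :> R)%R by rewrite rmorphXn.
move: h1 h2; rewrite e -rmorphN /= -!floor_ge_int -!floor_lt_int yx.
by move=> -> ->.
Qed.

Lemma Leb_bounded_fin : leb K < +oo.
Proof.
apply: (@le_lt_trans _ _ (leb big_cube)); last by rewrite Leb_big_cube ltry.
apply: le_measure; rewrite ?inE; [exact: measurable_closed_bounded|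
  exact: measurable_big_cube|exact: sub_big_cube].
Qed.

Lemma outer_sub_big m : outer_cubes m `<=` big_cube.
Proof.
move=> y [x Kx xy]; apply: (cubical_le (leq0n m) cubical_big_cube) xy _.
exact: sub_big_cube.
Qed.

(** [K] is the decreasing intersection of the unions of cubes that meet it, and [leb] is continuous
    from above there because these unions stay inside [big_cube]. *)
Theorem outer_le_Leb : eta K <= c%:E * leb K.
Proof.
have h m : eta K <= c%:E * leb (outer_cubes m).
  apply: le_trans (outer_le_cubical (eta_cube m) (@cubical_outer m)).
  by apply: eta_le; exact: sub_outer.
have cv : c%:E * leb (outer_cubes m) @[m --> \oo] --> c%:E * leb K.
  apply: cvgeZl => //; rewrite -[in X in _ --> X]bigcap_outer.
  apply: nonincreasing_cvg_mu.
  - apply: (@le_lt_trans _ _ (leb big_cube)); last by rewrite Leb_big_cube ltry.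
    apply: le_measure; rewrite ?inE; [exact: measurable_outer|
      exact: measurable_big_cube|exact: outer_sub_big].
  - by move=> m; exact: measurable_outer.
  - by rewrite bigcap_outer; exact: measurable_closed_bounded.
  - exact: outer_nonincreasing.
rewrite -(cvg_lim (@ereal_hausdorff R) cv); apply: lime_ge.
  by apply/cvg_ex; eexists; exact: cv.
by apply: nearW => m; exact: h.
Qed.

(* The complement of K in a large cube is exhausted by layers of cubes of
   decreasing size, so the cubical upper bound applies to it. *)
Lemma outer_le_compl : eta (big_cube `\` K) <= c%:E * leb (big_cube `\` K).
Proof.
pose F m := big_cube `\` outer_cubes m.
have cF m : cubical ts m (F m).
  rewrite /F setDE; apply: cubicalI; last exact: cubicalC (@cubical_outer m).
  exact: cubical_le (leq0n m) cubical_big_cube.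
have ndF : nondecreasing_seq F.
  move=> m n mn; apply/subsetPset; apply: setDS; apply/subsetPset.
  exact: outer_nonincreasing.
have UF : big_cube `\` K = \bigcup_m seqD F m.
  rewrite eq_bigcup_seqD -bigcap_outer setDE setC_bigcap setI_bigcupr.
  by apply: eq_bigcupr => m _; rewrite /F setDE.
have cD m : cubical ts m (seqD F m).
  case: m => [|m]; first exact: cF.
  rewrite /= setDE; apply: cubicalI => //; apply: cubicalC; exact: cubicalS.
rewrite UF; apply: le_trans (eta_sub _) _.
rewrite measure_bigcup //; last 2 first.
- by move=> m _; exact: measurable_cubical (cD m).
- exact: trivIset_seqD.
rewrite -nneseriesZl; last by move=> k _; exact: measure_ge0.
rewrite [leRHS](eq_eseriesl (Q := xpredT)); last by move=> k; rewrite in_setT.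
apply: lee_nneseries => [k _ _|k _]; first exact: eta_ge0.
exact: outer_le_cubical (eta_cube k) (cD k).
Qed.

(** A lower bound obtained from upper bounds only: [eta big_cube] is at most [eta K] plus [eta] of
    the complement, and the latter is at most [c] times its Lebesgue measure. If [eta] is full on
    the big cube, nothing can be lost on [K]. *)
Theorem outer_ge_Leb :
  (c * (2 ^+ M.+1) ^+ size ts)%:E <= eta big_cube -> c%:E * leb K <= eta K.
Proof.
move=> etaC.
have [etaK|etaK] := leP +oo (eta K).
  by move: etaK; rewrite leye_eq => /eqP ->; exact: leey.
have mK := measurable_closed_bounded.
have etaU : eta big_cube <= eta K + eta (big_cube `\` K).
  apply: (@le_trans _ _ (eta (\bigcup_k bigcup2 K (big_cube `\` K) k))).
    apply: eta_le; rewrite bigcup2E => y Cy.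
    by have [?|?] := pselect (K y); [left|right].
  apply: le_trans (eta_sub _) _.
  rewrite (nneseries_split 0 2) // add0n eseries0; last by move=> [|[|k]].
  by rewrite /= adde0 !big_nat_recl // big_geq // adde0.
have lebD : leb (big_cube `\` K) = leb big_cube - leb K.
  rewrite -[in RHS](setIidr sub_big_cube); apply: measureD => //.
    exact: measurable_big_cube.
  by apply: (@le_lt_trans _ _ (leb big_cube)) => //; rewrite Leb_big_cube ltry.
have := le_trans etaC (le_trans etaU (leeD2l _ outer_le_compl)).
rewrite lebD Leb_big_cube.
have : leb K \is a fin_num by rewrite ge0_fin_numE // Leb_bounded_fin.
have : eta K \is a fin_num by rewrite ge0_fin_numE.
move=> /fineK <- /fineK <-; rewrite -!EFinB -!EFinM -EFinD !lee_fin => h.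
lra.
Qed.

End OuterLeb.

(** * Hausdorff measure of cubes *)

Section HausdorffCube.
Context (R : realType).
Local Open Scope ereal_scope.

Definition half_open_cube (T : choiceType) (ts : seq T) : set (env R T) :=
  cube ts 0 (fun=> 0%R).

Lemma half_open_cubeP (T : choiceType) (ts : seq T) (x : env R T) :
  half_open_cube ts x <-> forall t, t \in ts -> (0 <= x t < 1)%R.
Proof.
split=> h t /h; rewrite /= expr0 !mul1r floor0.
  by move=> e; have := floor_itv (x t); rewrite e add0r.
by move=> ?; apply: floor_def; rewrite add0r.
Qed.

Lemma cubical_half_open (T : choiceType) (ts : seq T) :
  cubical ts 0 (half_open_cube ts).
Proof. by move=> x y xy Qx; exact: cube_trans Qx xy. Qed.

Lemma image_sigma_subadditive (X : Type) (T : finType) d (phi : X -> T -> R) :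
  sigma_subadditive (fun A => hausdorff_raw d (phi @` A)).
Proof.
by move=> F; rewrite image_bigcup; exact: hausdorff_raw_sigma_subadditive.
Qed.

(** Each cube of side [2 ^- m] is a homothetic copy of the unit cube, up to coordinates outside
    [ts]; the hypothesis says that [phi] carries homotheties to maps scaling distances by at most
    their ratio. *)
Lemma hausdorff_affine_cube (T : choiceType) (ts : seq T) (S : finType) d
    (phi : env R T -> S -> R) :
  (forall (a : R) (z x y : env R T), (0 < a)%R ->
    (euclid_dist (phi (fun t => a * x t + z t)) (phi (fun t => a * y t + z t))
      <= a * euclid_dist (phi x) (phi y))%R) ->
  forall m x, hausdorff_raw d (phi @` cube ts m x) <=
    (2 ^- m ^+ d)%:E * hausdorff_raw d (phi @` half_open_cube ts).
Proof.
move=> phiP m x; have m0 : (0 < 2 ^+ m :> R)%R by rewrite exprn_gt0.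
have mV0 : (0 < 2 ^- m :> R)%R by rewrite invr_gt0.
pose z t : R := (2 ^- m * (Num.floor (2 ^+ m * x t))%:~R)%R.
pose g (y : env R T) := phi (fun t => 2 ^- m * y t + z t)%R.
apply: le_trans (hausdorff_raw_lipschitz _ mV0 (g := g) (h := phi) _); last first.
  by move=> a b _ _; exact: phiP.
apply: hausdorff_raw_le => _ [y xy <-].
exists (fun t => 2 ^+ m * y t - (Num.floor (2 ^+ m * x t))%:~R)%R.
  apply/half_open_cubeP => t tts; have := xy t tts => /= <-.
  have /andP[] := floor_itv (2 ^+ m * y t)%R.
  by rewrite intrD /= => ? ?; apply/andP; split; lra.
rewrite /g; congr phi; apply/funext => t; rewrite /z mulrBr subrK.
by rewrite mulrA mulVf ?mul1r // gt_eqF.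
Qed.

Variable d : nat.
Local Notation T := ('I_d : choiceType).
Local Notation ts := (enum 'I_d).
Local Notation Q := (@half_open_cube T ts).

Lemma euclid_dist_affine (a : R) (z x y : 'I_d -> R) : (0 <= a)%R ->
  euclid_dist (fun t => a * x t + z t)%R (fun t => a * y t + z t)%R =
  (a * euclid_dist x y)%R.
Proof.
move=> a0; rewrite /euclid_dist -[X in (X * _)%R](ger0_norm a0).
rewrite -sqrtr_sqr -sqrtrM ?sqr_ge0 //.
congr Num.sqrt; rewrite mulr_sumr; apply: eq_bigr => i _.
by rewrite -exprMn; congr (_ ^+ _)%R; lra.
Qed.

Lemma euclid_dist_le_sup (S : finType) (e : R) (x y : S -> R) :
  (forall t, `|x t - y t| <= e)%R ->
  (euclid_dist x y <= Num.sqrt #|S|%:R * e)%R.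
Proof.
case: (pickP [pred t : S | true]) => [s _|no] xy; last first.
  rewrite /euclid_dist big_pred0 ?sqrtr0; last by move=> t; have := no t.
  by rewrite (_ : #|S| = 0%N) ?sqrtr0 ?mul0r //; apply: eq_card0 => t; have := no t.
have e0 : (0 <= e)%R by apply: le_trans (xy s).
rewrite -[X in (_ * X)%R](ger0_norm e0) -sqrtr_sqr -sqrtrM // ler_sqrt;
  last first.
  by rewrite mulr_ge0 // sqr_ge0.
rewrite mulr_natl -sumr_const; apply: ler_sum => t _.
by rewrite -(real_normK (num_real _)) lerXn2r ?nnegrE.
Qed.

Lemma euclid_dist_coord (S : finType) (x y : S -> R) t :
  (`|x t - y t| <= euclid_dist x y)%R.
Proof.
rewrite -sqrtr_sqr ler_sqrt; last by apply: sumr_ge0 => i _; exact: sqr_ge0.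
by rewrite (bigD1 t) //= lerDl; apply: sumr_ge0 => i _; exact: sqr_ge0.
Qed.

Lemma Leb_half_open_cube (S : choiceType) (ss : seq S) (x : env R S) :
  uniq ss -> Leb ss x (half_open_cube ss) = 1.
Proof. by move=> us; rewrite Leb_cube // expr0 invr1 expr1n. Qed.

(** Subdividing into cubes of side [2 ^- m] gives covers of arbitrarily small mesh whose total
    weight is always at most [sqrt(d) ^ d]. *)
Lemma hausdorff_cube_fin : hausdorff_raw d Q < +oo.
Proof.
pose c := (Num.sqrt d%:R ^+ d : R)%R.
have c0 : (0 <= c)%R by rewrite exprn_ge0.
suff : hausdorff_raw d Q <= c%:E by move/le_lt_trans; apply; rewrite ltry.
apply/ereal_supP => _ [delta /= delta0 <-].
(* The added 1 keeps the divisor positive when [d] is 0. *)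
have e0 : (0 < delta / (Num.sqrt d%:R + 1))%R.
  by rewrite divr_gt0 // ltr_wpDl.
have [m _ /(_ m (leqnn m))] := near_infty_natSinv_expn_lt (PosNum e0).
rewrite /= div1r => me.
have {me}me : (Num.sqrt d%:R * 2 ^- m <= delta)%R.
  move: me; rewrite ltr_pdivlMr; last by rewrite ltr_wpDl.
  have : (0 <= 2 ^- m :> R)%R by rewrite invr_ge0 exprn_ge0.
  lra.
rewrite -[leRHS]mule1 -(@Leb_half_open_cube T ts (fun=> 0%R)) ?enum_uniq //.
apply: (@outer_le_cubical R T ts (hausdorff_pre d delta) c (fun=> 0%R) _ _ _ _ m).
- exact: enum_uniq.
- by move=> A; exact: hausdorff_pre_ge0.
- by rewrite hausdorff_pre0 // ltW.
- exact: hausdorff_pre_sigma_subadditive.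
- move=> x; have cxx : cube ts m x !=set0 by exists x.
  have dc : ediam (cube ts m x : set ('I_d -> R)) <=
      (Num.sqrt d%:R * 2 ^- m)%:E.
    apply/ereal_supP => _ [[y z] [/= xy xz] <-]; rewrite lee_fin -[d in d%:R]card_ord.
    apply: euclid_dist_le_sup => i; apply: (@cube_dist _ _ ts) => //.
      by apply: cube_trans (cube_sym xz) _.
    by rewrite mem_enum.
  apply: le_trans (hausdorff_pre_le_weight _ _ _) _; last first.
  + rewrite /hausdorff_weight; case: eqP => [e|_].
      by move: cxx; rewrite e => -[].
    rewrite size_enum_ord /c -exprMn EFin_expe; apply: lee_expe => //.
    exact: ediam_ge0.
  + exact: ltW.
  + by apply: le_trans dc _; rewrite lee_fin.
- exact: cubical_le (leq0n m) (@cubical_half_open _ _).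
Qed.

(** Every set of a cover lies in a box of side twice its diameter around one of its points. The
    boxes cover a set of volume 1, so the weights sum to at least [2 ^- d]. *)
Lemma hausdorff_cube_gt0 : 0 < hausdorff_raw d Q.
Proof.
apply: (@lt_le_trans _ _ (2 ^- d)%:E).
  by rewrite lte_fin invr_gt0 exprn_gt0.
apply: le_trans (hausdorff_pre_le_raw d Q (@ltr01 R)).
apply/ereal_infP => _ [U [QU dU] <-].
rewrite -[leLHS]mule1 lee_pdivrMl ?exprn_gt0 //.
rewrite -(@Leb_half_open_cube T ts (fun=> 0%R)) ?enum_uniq //.
pose u k := xget (fun=> 0%R) (U k).
pose r k := fine (ediam (U k)).
pose V k : set (env R T) := if U k == set0 then set0 else
  box ts (fun i => `[(u k i - r k)%R, (u k i + r k)%R]%classic).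
have mV k : measurable (V k) by rewrite /V; case: ifP => // _; exact: measurable_box.
have uU k : U k != set0 -> U k (u k) by move=> /set0P[y Uy]; exact: xgetI Uy.
have fU k : U k != set0 -> ediam (U k) = (r k)%:E.
  move=> Uk; rewrite /r fineK // ge0_fin_numE ?ediam_ge0 //; last exact/set0P.
  exact: le_lt_trans (dU k) (ltry _).
apply: (@le_trans _ _ (\sum_(0 <= k <oo) Leb ts (fun=> 0%R) (V k))).
  apply: measure_sigma_subadditive => //.
    exact: measurable_cube.
  move=> y /QU[k _ Uky]; exists k => //.
  have Uk : U k != set0 by apply/set0P; exists y.
  rewrite /V (negbTE Uk) => i _.
  have : (`|y i - u k i| <= r k)%R.
    rewrite -lee_fin -fU //; apply: le_trans (ereal_sup_ubound _); last first.
      by exists (y, u k) => //; split => //=; exact: uU.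
    by rewrite lee_fin; exact: euclid_dist_coord.
  by rewrite ler_norml /= in_itv /= => /andP[? ?]; apply/andP; split; lra.
rewrite -nneseriesZl; last by move=> k _; exact: hausdorff_weight_ge0.
apply: lee_nneseries => [k _ _|k _]; first exact: measure_ge0.
rewrite /V /hausdorff_weight; case: ifP => [_|/negbT Uk].
  by rewrite measure0 mule0.
have r0 : (0 <= r k)%R by rewrite -lee_fin -fU // ediam_ge0 //; exact/set0P.
rewrite (Leb_box (l := fun=> (2 * r k)%R)) ?enum_uniq //; last first.
  by move=> i; rewrite lebesgue_itv_cc; [congr EFin; lra|lra].
rewrite big_const_seq count_predT iter_mulr_1 size_enum_ord fU // -EFin_expe.
by rewrite -EFinM -exprMn.
Qed.

End HausdorffCube.

Lemma eq_ler (R : realType) (x y : R) : x = y -> (x <= y)%R.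
Proof. by move=> ->. Qed.

(** * Hausdorff measure of an image against Lebesgue measure of the parameters *)

Section VolumeComparison.
Context (R : realType).
Local Open Scope ereal_scope.

Lemma outer_measure_image (X : Type) (T : finType) d (phi : X -> T -> R) :
  [/\ forall A B, A `<=` B -> hausdorff_raw d (phi @` A) <= hausdorff_raw d (phi @` B),
    forall A, 0 <= hausdorff_raw d (phi @` A) & hausdorff_raw d (phi @` set0) = 0].
Proof.
split=> [A B AB|A|]; last by rewrite image_set0 hausdorff_raw0.
- by apply: hausdorff_raw_le; exact: image_subset.
- exact: hausdorff_raw_ge0.
Qed.

Definition cubeH d : R := fine (hausdorff_raw d (@half_open_cube R _ (enum 'I_d))).

Lemma cubeHE d :
  hausdorff_raw d (@half_open_cube R _ (enum 'I_d)) = (cubeH d)%:E.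
Proof.
by rewrite /cubeH fineK // ge0_fin_numE ?hausdorff_cube_fin ?hausdorff_raw_ge0.
Qed.

Lemma cubeH_gt0 d : (0 < cubeH d)%R.
Proof. by rewrite -lte_fin -cubeHE hausdorff_cube_gt0. Qed.

(** The closed cube of the normalisation has the same measure as the half-open one: it is closed and
    bounded with Lebesgue volume 1, so [outer_le_Leb] bounds it by [cubeH d]. *)
Lemma hausdorff_unit_cube d :
  hausdorff_raw d (@unit_cube R d) = (cubeH d)%:E.
Proof.
apply/eqP; rewrite eq_le -cubeHE; apply/andP; split; last first.
  apply: hausdorff_raw_le => x /half_open_cubeP Qx i.
  by have /andP[-> /ltW ->] := Qx i (mem_enum _ i).
rewrite cubeHE -[leRHS]mule1.
have -> : 1 = Leb (enum 'I_d) (fun=> 0%R) (unit_cube (R := R) (d := d)) :> \bar R.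
  rewrite (_ : unit_cube (d := d) = box (enum 'I_d) (fun=> `[0%R, 1%R]%classic)).
    rewrite (Leb_box (l := fun=> 1%R)) ?enum_uniq ?big1 // => _.
    by rewrite lebesgue_itv_cc ?ler01 // subr0.
  apply/seteqP; split=> x xP i; first by move=> _; rewrite /= in_itv; exact: xP.
  by have := xP i (mem_enum _ i); rewrite /= in_itv.
apply: (@outer_le_Leb R _ (enum 'I_d) (@hausdorff_raw R _ d) (cubeH d) (fun=> 0%R)
  (enum_uniq _) _ _ _ _ _ _ 1).
- by move=> A B; exact: hausdorff_raw_le.
- by move=> A; exact: hausdorff_raw_ge0.
- exact: hausdorff_raw0.
- exact: hausdorff_raw_sigma_subadditive.
- move=> m x; have := @hausdorff_affine_cube R _ (enum 'I_d) _ d id.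
  rewrite size_enum_ord => /(_ _ m x); rewrite !image_id cubeHE -EFinM mulrC.
  apply=> a z u v a0; by rewrite (euclid_dist_affine _ _ _ (ltW a0)).
- move=> x Kx t _; rewrite expr1; have /andP[x0 x1] := Kx t.
  by rewrite ger0_norm //; apply: le_lt_trans x1 _; lra.
- move=> x xP t; apply/andP; split; apply/ler_addgt0Pl => e e0.
    have [y Ky /(_ t (mem_enum _ t))] := xP e e0.
    by have /andP[y0 y1] := Ky t; rewrite ler_norml => /andP[? ?]; lra.
  have [y Ky /(_ t (mem_enum _ t))] := xP e e0.
  by have /andP[y0 y1] := Ky t; rewrite ler_norml => /andP[? ?]; lra.
Qed.

Lemma hausdorffE (T : finType) d (A : set (T -> R)) :
  hausdorff d A = ((cubeH d)^-1)%:E * hausdorff_raw d A.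
Proof.
rewrite /hausdorff hausdorff_unit_cube inver.
by rewrite gt_eqF ?cubeH_gt0 // muleC.
Qed.

Variables (T : choiceType) (ts : seq T) (S : finType) (phi : env R T -> S -> R).
Variables (K : set (env R T)) (M : nat) (x0 : env R T) (kappa : R).
Hypothesis uts : uniq ts.
Hypothesis K_bounded :
  forall x, K x -> forall t, t \in ts -> (`|x t| < 2 ^+ M)%R.
Hypothesis K_closed : forall x : env R T,
  (forall e : R, (0 < e)%R ->
    exists2 y, K y & forall t, t \in ts -> (`|x t - y t| <= e)%R) -> K x.
Hypothesis phiP : forall (a : R) (z x y : env R T), (0 < a)%R ->
  (euclid_dist (phi (fun t => a * x t + z t)) (phi (fun t => a * y t + z t))
    <= a * euclid_dist (phi x) (phi y))%R.

Definition restr (x : env R T) (i : 'I_(size ts)) : R := x (tnth (in_tuple ts) i).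

Definition extend (q : 'I_(size ts) -> R) : env R T :=
  fun t => if insub (index t ts) is Some i then q i else 0%R.

Lemma extendK q : restr (extend q) = q.
Proof.
apply/funext => i; rewrite /restr /extend.
have -> : index (tnth (in_tuple ts) i) ts = i.
  by rewrite (tnth_nth (tnth (in_tuple ts) i)) /= index_uniq.
by rewrite insubT //= => lt; congr q; exact: val_inj.
Qed.

(** Forgetting the other coordinates does not increase distances, so the projection of the image has
    smaller measure. For the projection, [outer_ge_Leb] needs the full measure of the big cube,
    which holds because a homothety of ratio [2 ^- M.+1] carries it over the unit cube. *)
Theorem Leb_le_hausdorff :
  (forall x y : env R T,
    (euclid_dist (restr x) (restr y) <= euclid_dist (phi x) (phi y))%R) ->
  Leb ts x0 K <= hausdorff (size ts) (phi @` K).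
Proof.
move=> le_phi; set d := size ts; have H0 := cubeH_gt0 d.
rewrite hausdorffE -lee_pdivrMl ?invr_gt0 // invrK.
apply: (@le_trans _ _ (hausdorff_raw d (restr @` K))); last first.
  by apply: hausdorff_raw_isometry => a b _ _; exact: le_phi.
have [le ge0 e0] := outer_measure_image d restr.
have restrP (a : R) (z x y : env R T) : (0 < a)%R ->
    (euclid_dist (restr (fun t => a * x t + z t))
      (restr (fun t => a * y t + z t)) = a * euclid_dist (restr x) (restr y))%R.
  by move=> a0; rewrite -(euclid_dist_affine (restr z) _ _ (ltW a0)).
apply: (@outer_ge_Leb R _ ts (fun A => hausdorff_raw d (restr @` A)) _ x0
  uts le ge0 e0 _ _ _ M K_bounded K_closed).
- exact: image_sigma_subadditive.
- move=> m x; rewrite mulrC EFinM -cubeHE.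
  have H := @hausdorff_affine_cube R T ts _ d restr
    (fun a z u v a0 => eq_ler (restrP a z u v a0)) m x.
  apply: le_trans H _.
  apply: lee_wpmul2l; first by rewrite lee_fin exprn_ge0 // invr_ge0 exprn_ge0.
  apply: hausdorff_raw_le => _ [y /half_open_cubeP Qy <-].
  by apply/half_open_cubeP => i _; apply: Qy; exact: mem_tnth.
- have L0 : (0 < 2 ^- M.+1 :> R)%R by rewrite invr_gt0 exprn_gt0.
  rewrite mulrC EFinM -lee_pdivlMl ?exprn_gt0 // -exprVn -cubeHE.
  pose g (x : env R T) := (fun i => 2 ^- M.+1 * restr x i + 2^-1)%R.
  apply: le_trans (hausdorff_raw_lipschitz (h := restr) (g := g) _ L0 _);
    last first.
    by move=> a b _ _; rewrite (euclid_dist_affine _ _ _ (ltW L0)).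
  apply: hausdorff_raw_le => q /half_open_cubeP Qq.
  exists (extend (fun i => 2 ^+ M.+1 * q i - 2 ^+ M)%R).
    move=> t tts; have [i ->] : exists i, t = tnth (in_tuple ts) i.
      by have /tnthP[i ->] : t \in in_tuple ts by []; exists i.
    rewrite -/(restr _ i) extendK /= in_itv /= exprS.
    have /andP[q0 q1] := Qq i (mem_enum _ i).
    have p0 : (0 < 2 ^+ M :> R)%R by rewrite exprn_gt0.
    by apply/andP; split; nra.
  rewrite /g extendK; apply/funext => i.
  have p0 : (2 ^+ M != 0 :> R)%R by rewrite expf_neq0.
  have e1 := mulVf p0; have e2 : (2 ^- M * 2 ^+ M * q i = q i)%R by rewrite e1 mul1r.
  rewrite exprS invfM; lra.
Qed.

(** An estimate on the unit cube suffices: homotheties carry it to every dyadic cube, and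
    [outer_le_Leb] to [K]. *)
Theorem hausdorff_le_Leb : (0 <= kappa)%R ->
  hausdorff_raw (size ts) (phi @` half_open_cube ts) <=
    (kappa * cubeH (size ts))%:E ->
  hausdorff (size ts) (phi @` K) <= kappa%:E * Leb ts x0 K.
Proof.
move=> k0 Hk; set d := size ts in Hk *; have H0 := cubeH_gt0 d.
rewrite hausdorffE lee_pdivrMl // muleA -EFinM mulrC.
have [le ge0 e0] := outer_measure_image d phi.
apply: (@outer_le_Leb R _ ts (fun A => hausdorff_raw d (phi @` A)) _ x0
  uts le ge0 e0 _ _ _ M K_bounded K_closed).
- exact: image_sigma_subadditive.
- move=> m x; rewrite -[X in _ <= X%:E]mulrC EFinM.
  have H := hausdorff_affine_cube ts d phiP m x.
  apply: le_trans H _.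
  by apply: lee_wpmul2l => //; rewrite lee_fin exprn_ge0 // invr_ge0 exprn_ge0.
Qed.

End VolumeComparison.

(** * Log-concavity and the Prekopa-Leindler inequality *)

Section Prekopa.
Context (R : realType).
Local Notation mu := (@lebesgue_measure R).
Local Open Scope ereal_scope.

Lemma convex_expR (th p q : R) : (0 <= th <= 1)%R ->
  (expR ((1 - th) * p + th * q) <= (1 - th) * expR p + th * expR q)%R.
Proof.
move=> /andP[th0 th1]; set m := ((1 - th) * p + th * q)%R.
have m0 := expR_gt0 m.
have tangent r : (expR m * (1 + (r - m)) <= expR r)%R.
  have -> : (expR r = expR m * expR (r - m))%R by rewrite -expRD; congr expR; lra.
  by rewrite ler_pM2l // expR_ge1Dx.
have hp : ((1 - th) * (expR m * (1 + (p - m))) <= (1 - th) * expR p)%R.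
  by apply: ler_wpM2l (tangent p); lra.
have hq : (th * (expR m * (1 + (q - m))) <= th * expR q)%R.
  exact: ler_wpM2l (tangent q).
apply: le_trans (lerD hp hq); rewrite le_eqVlt; apply/orP; left; apply/eqP.
by rewrite mulrCA (mulrCA th) -mulrDr -[LHS]mulr1; congr (_ * _)%R; rewrite /m; lra.
Qed.

Section BrunnMinkowski1.
Variables (th : R) (A B C : set R).
Hypothesis th01 : (0 <= th <= 1)%R.
Hypotheses (A0 : A !=set0) (B0 : B !=set0).
Hypotheses (A_ub : has_ubound A) (A_lb : has_lbound A).
Hypotheses (B_ub : has_ubound B) (B_lb : has_lbound B).
Hypotheses (mA : measurable A) (mB : measurable B) (mC : measurable C).
Hypothesis C_itv : forall a b c, C a -> C b -> (a <= c <= b)%R -> C c.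
Hypothesis ABC : forall a b, A a -> B b -> C ((1 - th) * a + th * b)%R.

Lemma lebesgue_le_diam (X : set R) : has_ubound X -> has_lbound X ->
  X !=set0 -> measurable X -> mu X <= (sup X - inf X)%:E.
Proof.
move=> Xu Xl X0 mX.
have XI x : X x -> (inf X <= x <= sup X)%R.
  by move=> Xx; rewrite ge_inf //= ub_le_sup.
have le : (inf X <= sup X)%R.
  by have [x /XI/andP[]] := X0; exact: le_trans.
rewrite -lebesgue_itv_cc //; by apply: le_measure; rewrite ?inE // => x /XI; rewrite /= in_itv.
Qed.

(** As [C] is an interval, [A] and [B] may be replaced by the intervals they span: their measures
    are at most their lengths, and points near the ends of [A] and [B] put the whole open interval
    from [lo] to [hi] into [C]. *)
Lemma brunn_minkowski1 : (1 - th)%:E * mu A + th%:E * mu B <= mu C.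
Proof.
have /andP[th0 th1] := th01.
have th1' : (0 <= 1 - th)%R by lra.
have hA := lebesgue_le_diam A_ub A_lb A0 mA.
have hB := lebesgue_le_diam B_ub B_lb B0 mB.
set lo := ((1 - th) * inf A + th * inf B)%R.
set hi := ((1 - th) * sup A + th * sup B)%R.
have lohi : (lo <= hi)%R.
  rewrite lerD //; apply: ler_wpM2l => //.
    by have [x Ax] := A0; apply: (@le_trans _ _ x); [exact: ge_inf|exact: ub_le_sup].
  by have [x Bx] := B0; apply: (@le_trans _ _ x); [exact: ge_inf|exact: ub_le_sup].
apply: (@le_trans _ _ (hi - lo)%:E).
  have -> : (hi - lo = (1 - th) * (sup A - inf A) + th * (sup B - inf B))%R.
    by rewrite /hi /lo; lra.
  rewrite [leRHS]EFinD; apply: leeD; rewrite EFinM; apply: lee_wpmul2l => //;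
    by rewrite ?lee_fin.
have -> : (hi - lo)%:E = mu `]lo, hi[.
  rewrite lebesgue_measure_itv /= lte_fin; case: ltgtP lohi => // -> _.
  by rewrite subrr.
apply: le_measure; rewrite ?inE // => c /=; rewrite in_itv /= => /andP[loc chi].
have [a1 Aa1 a1lt] : exists2 a, A a & (a < inf A + (c - lo))%R.
  by apply: inf_adherent; [rewrite subr_gt0|split].
have [b1 Bb1 b1lt] : exists2 b, B b & (b < inf B + (c - lo))%R.
  by apply: inf_adherent; [rewrite subr_gt0|split].
have [a2 Aa2 a2lt] : exists2 a, A a & (sup A - (hi - c) < a)%R.
  by apply: sup_adherent; [rewrite subr_gt0|split].
have [b2 Bb2 b2lt] : exists2 b, B b & (sup B - (hi - c) < b)%R.
  by apply: sup_adherent; [rewrite subr_gt0|split].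
apply: (C_itv (ABC Aa1 Bb1) (ABC Aa2 Bb2)).
have e1 : ((1 - th) * a1 <= (1 - th) * (inf A + (c - lo)))%R.
  by apply: ler_wpM2l => //; exact: ltW.
have e2 : (th * b1 <= th * (inf B + (c - lo)))%R by apply: ler_wpM2l => //; exact: ltW.
have e3 : ((1 - th) * (sup A - (hi - c)) <= (1 - th) * a2)%R.
  by apply: ler_wpM2l => //; exact: ltW.
have e4 : (th * (sup B - (hi - c)) <= th * b2)%R by apply: ler_wpM2l => //; exact: ltW.
by move: e1 e2 e3 e4; rewrite /lo /hi => *; apply/andP; split; lra.
Qed.

End BrunnMinkowski1.

(** * Layer-cake integration *)

Section LayerCake.
Variables (f : R -> \bar R) (A : R).
Hypotheses (mf : measurable_fun [set: R] f) (f0 : forall x, 0 <= f x).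
Hypothesis A0 : (0 < A)%R.

Definition layer (r : R) : set R := [set x | (r * A)%:E <= f x].

Lemma measurable_layer r : measurable (layer r).
Proof.
rewrite /layer -[X in measurable X]setTI.
exact: emeasurable_fun_c_infty.
Qed.

Let X2 := (measurableTypeR R * measurableTypeR R)%type.

Let S : set X2 := (snd @^-1` `]0%R, 1%R[) `&` [set p : X2 | (p.2 * A)%:E <= f p.1].

Let G (p : X2) : \bar R := (\1_S p)%:E.

Let mS : measurable S.
Proof.
apply: measurableI.
  by rewrite -[X in measurable X]setTI; exact: measurable_snd.
rewrite -[X in measurable X]setTI; apply: measurable_lee => //.
  by apply/measurable_EFinP; apply: measurable_funM => //; exact: measurable_snd.
exact: measurableT_comp mf measurable_fst.
Qed.

Let mG : measurable_fun [set: X2] G.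
Proof. by apply/measurable_EFinP; exact: measurable_indic. Qed.

Let G0 p : 0 <= G p. Proof. by rewrite lee_fin. Qed.

Let slice x : set R := `]0%R, 1%R[ `&` [set r : R | (r * A)%:E <= f x].

Let mslice x : measurable (slice x).
Proof.
apply: measurableI => //.
rewrite -[X in measurable X]setTI; apply: measurable_lee => //.
by apply/measurable_EFinP; apply: measurable_funM.
Qed.

Let intGr x : \int[mu]_r G (x, r) = mu (slice x).
Proof.
rewrite -[X in _ = mu X]setIT -integral_indic //.
exact: mslice.
Qed.

Let mmu_slice : measurable_fun [set: R] (fun x => mu (slice x)).
Proof.
rewrite (_ : (fun x => _) = fubini_F mu G); last first.
  by apply/funext => x; rewrite -intGr.
exact: measurable_fun_fubini_tonelli_F.
Qed.

Let intG : \int[mu]_(r in `]0%R, 1%R[) mu (layer r) = \int[mu]_x mu (slice x).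
Proof.
transitivity (\int[mu]_r \int[mu]_x G (x, r)).
  rewrite integral_mkcond; apply: eq_integral => r _.
  rewrite patchE; case: ifPn => [|rN].
    rewrite inE /= => r01.
    have ml := measurable_layer r.
    rewrite -[X in mu X = _]setIT -integral_indic //.
    apply: eq_integral => x _; rewrite /G !indicE; congr (nat_of_bool _)%:R%:E.
    by apply/idP/idP; rewrite !inE; [split|case].
  rewrite integral0_eq // => x _; rewrite /G indicE memNset //= => -[r01 _].
  by move/negP: rN; apply; rewrite inE.
rewrite -(fubini_tonelli (m1 := mu) (m2 := mu) G) //.
by apply: eq_integral => x _; rewrite intGr.
Qed.

(** By Tonelli the left side is the integral of the minimum of [f] and [A]. This gives one
    inequality for every [f], and the reverse one, [layer_cake_le], when [A] bounds [f]. *)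
Lemma layer_cake_ge :
  A%:E * \int[mu]_(r in `]0%R, 1%R[) mu (layer r) <= \int[mu]_x f x.
Proof.
rewrite intG -ge0_integralZl //; last by rewrite lee_fin ltW.
apply: ge0_le_integral => //.
- by move=> x _; rewrite mule_ge0 // lee_fin ltW.
- exact: measurable_funeM.
move=> x _; case fxE: (f x) => [y| |]; last 2 first.
- by rewrite leey.
- by have := f0 x; rewrite fxE.
have y0 : (0 <= y)%R by rewrite -lee_fin -fxE.
rewrite muleC -lee_pdivlMr // -EFinM.
apply: (@le_trans _ _ (mu `[0%R, (y / A)%R])).
  apply: le_measure; rewrite ?inE //; first exact: mslice.
  move=> r [] /=; rewrite !in_itv /= fxE lee_fin => /andP[/ltW -> _] /=.
  by rewrite ler_pdivlMr.
by rewrite lebesgue_itv_cc ?subr0 // divr_ge0 // ltW.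
Qed.

Lemma layer_cake_le : (forall x, f x <= A%:E) ->
  \int[mu]_x f x <= A%:E * \int[mu]_(r in `]0%R, 1%R[) mu (layer r).
Proof.
move=> fA; rewrite intG -ge0_integralZl //; last by rewrite lee_fin ltW.
apply: ge0_le_integral => //.
  exact: measurable_funeM.
move=> x _; have := fA x; case fxE: (f x) => [y| |] //; last by have := f0 x; rewrite fxE.
rewrite lee_fin => yA.
have y0 : (0 <= y)%R by rewrite -lee_fin -fxE.
have yA1 : (y / A <= 1)%R by rewrite ler_pdivrMr // mul1r.
rewrite muleC -lee_pdivrMr // -EFinM.
apply: (@le_trans _ _ (mu `]0%R, (y / A)%R[)).
  rewrite lebesgue_measure_itv /= lte_fin; case: ltP => [_|].
    by rewrite -EFinB subr0.
  by rewrite lee_fin.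
apply: le_measure; rewrite ?inE //; first exact: mslice.
move=> r /=; rewrite in_itv /= => /andP[r0 ry]; split => /=.
  by rewrite in_itv /= r0 (lt_le_trans ry yA1).
by rewrite fxE lee_fin -ler_pdivlMr // ltW.
Qed.

Lemma measurable_mu_layer :
  measurable_fun (`]0%R, 1%R[%classic : set R) (fun r : R => mu (layer r)).
Proof.
apply: (eq_measurable_fun (fubini_G mu G)); last first.
  by apply: measurable_funTS; exact: measurable_fun_fubini_tonelli_G.
move=> r; rewrite inE /= => r01; have ml := measurable_layer r.
rewrite /fubini_G -[X in _ = mu X]setIT -integral_indic //.
apply: eq_integral => x _; rewrite /G !indicE; congr (nat_of_bool _)%:R%:E.
by apply/idP/idP; rewrite !inE; [case|split].
Qed.

End LayerCake.

Section Prekopa1.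
Variables (th : R) (f g h : R -> \bar R) (M B : R).
Hypothesis th01 : (0 <= th <= 1)%R.
Hypotheses (mf : measurable_fun [set: R] f) (mg : measurable_fun [set: R] g)
  (mh : measurable_fun [set: R] h).
Hypotheses (f0 : forall x, 0 <= f x) (g0 : forall x, 0 <= g x)
  (h0 : forall x, 0 <= h x).
Hypotheses (fM : forall x, f x <= M%:E) (gM : forall x, g x <= M%:E).
Hypotheses (fB : forall x, (B < `|x|)%R -> f x = 0)
  (gB : forall x, (B < `|x|)%R -> g x = 0).
Hypothesis h_itv : forall a b c w, (expR w)%:E <= h a -> (expR w)%:E <= h b ->
  (a <= c <= b)%R -> (expR w)%:E <= h c.
Hypothesis fgh : forall a b u v, (expR u)%:E <= f a -> (expR v)%:E <= g b ->
  (expR ((1 - th) * u + th * v))%:E <= h ((1 - th) * a + th * b)%R.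

Let ereal_sup_exp (k : R -> \bar R) u : (forall x, k x <= M%:E) ->
  (forall x, 0 <= k x) -> (expR u)%:E <= \int[mu]_x k x ->
  exists2 a : R, (forall x, k x <= (expR a)%:E) &
    forall r, (0 < r < 1)%R -> exists x, (r * expR a)%:E <= k x.
Proof.
move=> kM k0 uk.
have [x0 kx0] : exists x, 0 < k x.
  apply: contrapT => /forallNP nk.
  suff : \int[mu]_x k x = 0.
    by move=> e; move: uk; rewrite e lee_fin leNgt expR_gt0.
  apply: integral0_eq => x _; apply/eqP; rewrite eq_le k0 andbT leNgt.
  exact/negP/nk.
have sM : ereal_sup (range k) <= M%:E by apply/ereal_supP => _ [x _ <-].
have s0 : 0 < ereal_sup (range k).
  by apply: lt_le_trans kx0 _; apply: ereal_sup_ubound; exists x0.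
case sE: (ereal_sup (range k)) sM s0 => [s| |] //; rewrite lee_fin lte_fin.
move=> sM s0; exists (ln s).
  by move=> x; rewrite lnK ?posrE // -sE; apply: ereal_sup_ubound; exists x.
move=> r /andP[r0 r1]; rewrite lnK ?posrE //.
have : (r * s)%:E < ereal_sup (range k).
  by rewrite sE lte_fin gtr_pMl.
by move=> /ereal_sup_gt[_ [x _ <-]] /ltW; exists x.
Qed.

Lemma layer_bounded k A : (0 < A)%R -> (forall x, (B < `|x|)%R -> k x = 0) ->
  forall r, (0 < r)%R -> has_ubound (layer k A r) /\ has_lbound (layer k A r).
Proof.
move=> A0 kB r r0.
have h1 x : layer k A r x -> (`|x| <= B)%R.
  rewrite leNgt => kx; apply/negP => /kB kx0; move: kx.
  by rewrite /layer /= kx0 lee_fin leNgt mulr_gt0.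
by split; [exists B|exists (- B)%R] => x /h1; rewrite ler_norml => /andP[].
Qed.

(** Layers are taken at heights relative to the suprema [expR al] and [expR be], so that both are
    nonempty for every [r < 1] and [brunn_minkowski1] applies level by level. Integration over [r]
    gives an additive inequality, which the weighted arithmetic-geometric mean inequality
    [convex_expR] makes multiplicative. *)
Lemma prekopa1 u v : (expR u)%:E <= \int[mu]_x f x ->
  (expR v)%:E <= \int[mu]_x g x ->
  (expR ((1 - th) * u + th * v))%:E <= \int[mu]_x h x.
Proof.
move=> uf vg; have /andP[th0 th1] := th01.
have th1' : (0 <= 1 - th)%R by lra.
have [al fal alne] := ereal_sup_exp fM f0 uf.
have [be gbe bene] := ereal_sup_exp gM g0 vg.
pose ga := ((1 - th) * al + th * be)%R.
have ea := expR_gt0 al; have eb := expR_gt0 be; have eg := expR_gt0 ga.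
have lev r : (0 < r < 1)%R ->
    (1 - th)%:E * mu (layer f (expR al) r) + th%:E * mu (layer g (expR be) r) <=
    mu (layer h (expR ga) r).
  move=> r01; have /andP[r0 r1] := r01.
  have expE a : (r * expR a = expR (ln r + a))%R by rewrite expRD lnK ?posrE.
  have [fu fl] := layer_bounded ea fB r0.
  have [gu gl] := layer_bounded eb gB r0.
  apply: brunn_minkowski1 => //; try exact: measurable_layer.
  - exact: alne.
  - exact: bene.
  - by move=> a b c; rewrite /layer /= expE; exact: h_itv.
  - move=> a b; rewrite /layer /= !expE => ha hb.
    have := fgh ha hb; congr (_%:E <= _); congr expR; rewrite /ga; lra.
have := layer_cake_ge mh h0 eg; apply: le_trans.
have intle : (1 - th)%:E * \int[mu]_(r in `]0%R, 1%R[) mu (layer f (expR al) r) +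
    th%:E * \int[mu]_(r in `]0%R, 1%R[) mu (layer g (expR be) r) <=
    \int[mu]_(r in `]0%R, 1%R[) mu (layer h (expR ga) r).
  have mf' := measurable_mu_layer (expR al) mf.
  have mg' := measurable_mu_layer (expR be) mg.
  have mh' := measurable_mu_layer (expR ga) mh.
  have nn c k A r : (0 <= c)%R -> 0 <= c%:E * mu (layer k A r).
    by move=> c0; rewrite mule_ge0.
  have mc (c : R) (k : R -> \bar R) : measurable_fun (`]0%R, 1%R[%classic : set R) k ->
      measurable_fun (`]0%R, 1%R[%classic : set R) (fun r : R => c%:E * k r).
    by move=> mk; exact: measurable_funeM.
  have -> : (1 - th)%:E * \int[mu]_(r in `]0%R, 1%R[) mu (layer f (expR al) r) +
      th%:E * \int[mu]_(r in `]0%R, 1%R[) mu (layer g (expR be) r) =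
      \int[mu]_(r in `]0%R, 1%R[) ((1 - th)%:E * mu (layer f (expR al) r) +
      th%:E * mu (layer g (expR be) r)).
    rewrite ge0_integralD ?ge0_integralZl //.
    1,3: by move=> r _; exact: nn.
    - exact: mc mf'.
    - exact: mc mg'.
  apply: ge0_le_integral => //.
  - by move=> r _; rewrite adde_ge0 // mule_ge0.
  - by apply: emeasurable_funD; exact: measurable_funeM.
have hf : (expR (u - al))%:E <= \int[mu]_(r in `]0%R, 1%R[) mu (layer f (expR al) r).
  rewrite expRB EFinM muleC lee_pdivrMl //.
  exact: le_trans uf (layer_cake_le mf f0 ea fal).
have hg : (expR (v - be))%:E <= \int[mu]_(r in `]0%R, 1%R[) mu (layer g (expR be) r).
  rewrite expRB EFinM muleC lee_pdivrMl //.
  exact: le_trans vg (layer_cake_le mg g0 eb gbe).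
apply: (@le_trans _ _ ((expR ga)%:E * (expR ((1 - th) * (u - al) + th * (v - be)))%:E)).
  rewrite -EFinM -expRD lee_fin ler_expR /ga; lra.
apply: lee_wpmul2l; first by rewrite lee_fin ltW.
apply: le_trans intle; apply: (@le_trans _ _
  ((1 - th)%:E * (expR (u - al))%:E + th%:E * (expR (v - be))%:E)).
  by rewrite -!EFinM -EFinD lee_fin convex_expR.
by apply: leeD; apply: lee_wpmul2l => //; rewrite lee_fin.
Qed.

End Prekopa1.

End Prekopa.

(** * Log-concave functions of several variables *)

Section LogConcave.
Context (R : realType) (T : choiceType).
Local Notation env := (env R T).
Local Open Scope ereal_scope.

(** Phrased through exponential lower bounds, so that no logarithm of 0 or of [+oo] is taken: where
    [F] vanishes the condition is void. *)
Definition logconcave (F : env -> \bar R) := forall (x y : env) (u v th : R),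
  (0 <= th <= 1)%R -> (expR u)%:E <= F x -> (expR v)%:E <= F y ->
  (expR ((1 - th) * u + th * v))%:E <= F (fun t => (1 - th) * x t + th * y t)%R.

Lemma logconcave_Iint1 t (F : env -> \bar R) (M B : R) : logconcave F ->
  measurable_fun [set: env] F -> (forall x, 0 <= F x) ->
  (forall x, F x <= M%:E) -> (forall x, (B < `|x t|)%R -> F x = 0) ->
  logconcave (Iint [:: t] F).
Proof.
move=> lF mF F0 FM FB x y u v th th01 /= Fx Fy.
have updE (z z' : env) r r' : (fun s => (1 - th) * upd z t r s + th * upd z' t r' s)%R =
    upd (fun s => (1 - th) * z s + th * z' s)%R t ((1 - th) * r + th * r')%R.
  by apply/funext => s; rewrite /upd; case: eqP.
apply: (@prekopa1 R th _ _ _ M B th01 _ _ _ _ _ _ _ _ _ _ _ _ _ _ Fx Fy) => //;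
  try exact: measurable_upd1F; try by move=> r; rewrite ?FM.
- by move=> r rB; rewrite FB // upd_id.
- by move=> r rB; rewrite FB // upd_id.
(* Upper level sets are intervals: log-concavity with equal exponents [w] at both ends, at the
   parameter [s] that reaches [c]. *)
- move=> a b c w Fa Fb /andP[ac cb].
  have [ab|ab] := eqVneq a b.
    by rewrite (_ : c = a) //; apply/eqP; rewrite eq_le ac andbT ab.
  have ba : (0 < b - a)%R by rewrite subr_gt0 lt_neqAle ab (le_trans ac).
  pose s := ((c - a) / (b - a))%R.
  have s01 : (0 <= s <= 1)%R.
    apply/andP; split; first by apply: divr_ge0; lra.
    by rewrite ler_pdivrMr // mul1r; lra.
  have := lF _ _ _ _ _ s01 Fa Fb.
  rewrite (_ : ((1 - s) * w + s * w = w)%R); last by lra.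
  congr (_ <= F _); apply/funext => q; rewrite /upd; case: eqP => _; last lra.
  have : (s * (b - a) = c - a)%R by rewrite /s divfK // gt_eqF.
  lra.
- by move=> a b u' v' Fa Fb; have := lF _ _ _ _ _ th01 Fa Fb; rewrite updE.
Qed.

Lemma Iint_bounded ts (F : env -> \bar R) (M B : R) : uniq ts -> (0 <= M)%R -> (0 <= B)%R ->
  measurable_fun [set: env] F -> (forall x, 0 <= F x) ->
  (forall x, F x <= M%:E) ->
  (forall x t, t \in ts -> (B < `|x t|)%R -> F x = 0) ->
  forall x, Iint ts F x <= (M * (2 * B) ^+ size ts)%:E.
Proof.
move=> + M0 B0 mF F0 FM; elim: ts => [|t ts IH] /=.
  by move=> _ _ x; rewrite expr0 mulr1.
move=> /andP[tts uts] FB x.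
have {}IH : forall y, Iint ts F y <= (M * (2 * B) ^+ size ts)%:E.
  by apply: IH => // y s sts; apply: FB; rewrite inE sts orbT.
have c0 : (0 <= M * (2 * B) ^+ size ts)%R.
  by rewrite mulr_ge0 // exprn_ge0 // mulr_ge0.
apply: (@le_trans _ _ (\int[lebesgue_measure]_(r in `[(- B)%R, B])
    (M * (2 * B) ^+ size ts)%:E)).
  rewrite [leRHS]integral_mkcond; apply: ge0_le_integral => //.
  - by move=> r _; exact: Iint_ge0.
  - by apply: measurable_upd1F; exact: measurable_Iint.
  - apply/(measurable_restrictT _ _).1 => //; exact: measurable_cst.
  move=> r _; rewrite patchE; case: ifPn => [_|]; first exact: IH.
  rewrite notin_setE /= in_itv /= => /negP rB.
  have rB' : (B < `|r|)%R by rewrite ltNge ler_norml.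
  rewrite (_ : Iint ts F _ = 0) //.
  rewrite -(_ : Iint ts (fun=> 0) (upd x t r) = 0); last first.
    by elim: (ts) (upd x t r) => //= s ss IHs z; apply: integral0_eq => q _.
  apply: Iint_ext => y yx; apply: (FB _ t); first by rewrite mem_head.
  by rewrite yx // upd_id.
rewrite integral_cst // [X in _ * X](_ : _ = (B - - B)%:E); last first.
  by apply: lebesgue_itv_cc; lra.
by rewrite -EFinM lee_fin exprS; lra.
Qed.

Lemma logconcave_Iint ts (F : env -> \bar R) (M B : R) : uniq ts ->
  (0 <= M)%R -> (0 <= B)%R -> logconcave F ->
  measurable_fun [set: env] F -> (forall x, 0 <= F x) ->
  (forall x, F x <= M%:E) ->
  (forall x t, t \in ts -> (B < `|x t|)%R -> F x = 0) ->
  logconcave (Iint ts F).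
Proof.
move=> + M0 B0 lF mF F0 FM; elim: ts => //= t ts IH /andP[tts uts] FB.
have FB' x s : s \in ts -> (B < `|x s|)%R -> F x = 0.
  by move=> sts; apply: FB; rewrite inE sts orbT.
apply: (@logconcave_Iint1 t _ (M * (2 * B) ^+ size ts) B).
- exact: IH.
- exact: measurable_Iint.
- exact: Iint_ge0.
- exact: Iint_bounded.
- move=> x xB; rewrite -(_ : Iint ts (fun=> 0) x = 0); last first.
    by elim: (ts) x {xB} => //= s ss IHs z; apply: integral0_eq => q _.
  by apply: Iint_ext => y yx; apply: (FB _ t); rewrite ?mem_head // yx.
Qed.

(* A supergradient of [log f] at an interior point of its support, built one
   coordinate at a time as in the Hahn-Banach theorem. *)
Lemma logconcave_supergradient_aux (f : env -> \bar R) (b : env) (w : R) ts :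
  uniq ts -> logconcave f -> f b = (expR w)%:E ->
  (forall t, t \in ts -> exists2 e : R, (0 < e)%R & forall h, (`|h| <= e)%R ->
    0 < f (upd b t (b t + h)%R)) ->
  exists c : T -> R, forall (x : env) (u : R),
    (forall t, t \notin ts -> x t = b t) -> (expR u)%:E <= f x ->
    (u <= w - \sum_(t <- ts) c t * (x t - b t))%R.
Proof.
move=> + lf fb; elim: ts => [|t ts IH] /=.
  move=> _ _; exists (fun=> 0%R) => x u xb; rewrite big_nil subr0.
  rewrite (_ : x = b) ?fb ?lee_fin ?ler_expR //.
  by apply/funext => s; exact: xb.
move=> /andP[tts uts] bint.
have [|c Hc] := IH uts; first by move=> s sts; apply: bint; rewrite inE sts orbT.
pose S (x : env) : R := (\sum_(s <- ts) c s * (x s - b s))%R.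
pose P (x : env) (u : R) := (forall s, s \notin t :: ts -> x s = b s) /\
  (expR u)%:E <= f x.
(* Each point with [x t] above [b t] bounds the new slope from above, each point with [x t] below it
   bounds the slope from below. *)
pose Up : set R := [set q | exists x u, [/\ P x u, (b t < x t)%R &
  q = ((w - S x - u) / (x t - b t))%R]].
pose Lo : set R := [set q | exists x u, [/\ P x u, (x t < b t)%R &
  q = ((u - w + S x) / (b t - x t))%R]].
have LoUp p q : Lo p -> Up q -> (p <= q)%R.
  move=> [x2 [u2 [[x2b fx2] x2t ->]]] [x1 [u1 [[x1b fx1] x1t ->]]].
  set p1 := (x1 t - b t)%R; set p2 := (b t - x2 t)%R.
  have p10 : (0 < p1)%R by rewrite subr_gt0.
  have p20 : (0 < p2)%R by rewrite subr_gt0.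
  have p120 : (0 < p1 + p2)%R by exact: addr_gt0.
  (* This weight brings the combination of the two points back to the hyperplane where coordinate
     [t] is [b t], on which the induction hypothesis holds. *)
  pose th := (p1 / (p1 + p2))%R.
  have th01 : (0 <= th <= 1)%R.
    by rewrite /th divr_ge0 ?(ltW p10) ?(ltW p120) //= ler_pdivrMr // mul1r; lra.
  have thE : (th * (p1 + p2) = p1)%R by rewrite /th divfK // gt_eqF.
  have := Hc _ _ _ (lf _ _ _ _ _ th01 fx1 fx2).
  have zb s : s \notin ts -> ((1 - th) * x1 s + th * x2 s)%R = b s.
    move=> sts; have [->|st] := eqVneq s t.
      by move: thE; rewrite /p1 /p2 => thE; lra.
    by rewrite x1b ?x2b ?inE ?(negbTE st) //; lra.
  move=> /(_ zb).
  have -> : (\sum_(s <- ts) c s * ((1 - th) * x1 s + th * x2 s - b s) =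
      (1 - th) * S x1 + th * S x2)%R.
    rewrite /S !mulr_sumr -big_split /=; apply: eq_bigr => s _; lra.
  move=> le; rewrite ler_pdivrMr // mulrAC ler_pdivlMr //.
  have : (0 <= ((1 - th) * (w - S x1 - u1) + th * (w - S x2 - u2)) * (p1 + p2))%R.
    by rewrite mulr_ge0 ?(ltW p120) //; lra.
  have -> : (((1 - th) * (w - S x1 - u1) + th * (w - S x2 - u2)) * (p1 + p2) =
    (p1 + p2 - th * (p1 + p2)) * (w - S x1 - u1) +
    (th * (p1 + p2)) * (w - S x2 - u2))%R by lra.
  rewrite thE; lra.
have [e e0 be] := bint t (mem_head _ _).
have pos_exp (y : \bar R) : 0 < y -> exists u, (expR u)%:E <= y.
  case: y => [r| |] //; last by exists 0%R; rewrite leey.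
  by rewrite lte_fin => r0; exists (ln r); rewrite lnK ?posrE.
have Upne : Up !=set0.
  have [u fu] : exists u, (expR u)%:E <= f (upd b t (b t + e)%R).
    by apply/pos_exp/be; rewrite ger0_norm // ltW.
  eexists; exists (upd b t (b t + e)%R), u; split; last reflexivity.
    by split=> // s; rewrite inE negb_or => /andP[st _]; rewrite upd_neq.
  by rewrite upd_id ltrDl.
have Lone : Lo !=set0.
  have [u fu] : exists u, (expR u)%:E <= f (upd b t (b t + - e)%R).
    by apply/pos_exp/be; rewrite normrN ger0_norm // ltW.
  eexists; exists (upd b t (b t + - e)%R), u; split; last reflexivity.
    by split=> // s; rewrite inE negb_or => /andP[st _]; rewrite upd_neq.
  by rewrite upd_id gtrDl oppr_lt0.
pose ct := inf Up.
have ctU q : Up q -> (ct <= q)%R.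
  by move=> Uq; apply: ge_inf => //; have [p Lp] := Lone; exists p => r; exact: LoUp.
have ctL p : Lo p -> (p <= ct)%R.
  by move=> Lp; apply: lb_le_inf => // q; exact: LoUp.
exists (upd c t ct) => x u xb fx.
rewrite big_cons upd_id.
have -> : (\sum_(s <- ts) upd c t ct s * (x s - b s) = S x)%R.
  apply: eq_big_seq => s sts; rewrite upd_neq //.
  by apply: contraNneq tts => <-.
case: (ltgtP (x t) (b t)) => xt.
- have : ((u - w + S x) / (b t - x t) <= ct)%R.
    by apply: ctL; exists x, u; split.
  by rewrite ler_pdivrMr ?subr_gt0 //; lra.
- have : (ct <= (w - S x - u) / (x t - b t))%R.
    by apply: ctU; exists x, u; split.
  by rewrite ler_pdivlMr ?subr_gt0 //; lra.
- rewrite xt subrr mulr0 add0r; apply: Hc fx => s sts.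
  by have [->|st] := eqVneq s t => //; apply: xb; rewrite inE negb_or st.
Qed.

Lemma logconcave_supergradient (f : env -> \bar R) (b : env) (w : R) ts :
  uniq ts -> logconcave f -> (forall x, 0 <= f x) -> f b = (expR w)%:E ->
  (forall t, t \in ts -> exists2 e : R, (0 < e)%R & forall h, (`|h| <= e)%R ->
    0 < f (upd b t (b t + h)%R)) ->
  exists c : T -> R, forall x : env, (forall t, t \notin ts -> x t = b t) ->
    f x <= (expR (- \sum_(t <- ts) c t * (x t - b t)))%:E * f b.
Proof.
move=> uts lf f0 fb bint.
have [c Hc] := logconcave_supergradient_aux uts lf fb bint.
exists c => x xb; rewrite fb -EFinM -expRD addrC.
have {}Hc u := Hc x u xb.
case fx: (f x) Hc (f0 x) => [r| |] // Hc.
- rewrite le_eqVlt => /predU1P[<-|r0]; first by rewrite lee_fin expR_ge0.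
  rewrite lte_fin in r0.
  by rewrite lee_fin -[r]lnK ?posrE // ler_expR Hc // lee_fin lnK ?posrE.
- move=> _; have := Hc (w - \sum_(t <- ts) c t * (x t - b t) + 1)%R (leey _).
  by rewrite gerDl ler10.
Qed.

End LogConcave.

(** * The integral formula for the exponential Schur function *)

Section Determinants.
Context (R : realType).

Lemma det_scale_col (m : nat) (A : 'M[R]_m) (d : 'I_m -> R) :
  \det (\matrix_(i, j) (A i j * d j)) = \det A * \prod_j d j.
Proof.
rewrite (_ : \matrix_(i, j) _ = A *m diag_mx (\row_j d j)).
  by rewrite det_mulmx det_diag; congr (_ * _); apply: eq_bigr => j _; rewrite mxE.
by apply/matrixP => i j; rewrite mul_mx_diag !mxE.
Qed.

Lemma det_scale_row (m : nat) (A : 'M[R]_m) (d : 'I_m -> R) :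
  \det (\matrix_(i, j) (d i * A i j)) = (\prod_i d i) * \det A.
Proof.
rewrite (_ : \matrix_(i, j) _ = diag_mx (\row_j d j) *m A).
  by rewrite det_mulmx det_diag; congr (_ * _); apply: eq_bigr => j _; rewrite mxE.
by apply/matrixP => i j; rewrite mul_diag_mx !mxE.
Qed.

(* Subtract from each column its right neighbour, then expand along the
   last row. *)
Lemma det_col_differences (m : nat) (g : nat -> nat -> R) :
  (forall j, g m j = 1) ->
  \det (\matrix_(i < m, j < m) (g i j - g i j.+1)) =
  \det (\matrix_(i < m.+1, j < m.+1) g i j).
Proof.
move=> g1.
pose U : 'M[R]_m.+1 := \matrix_(i, j)
  ((i == j)%:R - (i == j.+1 :> nat)%:R).
have detU : \det U = 1.
  rewrite det_trig; last first.
    apply/is_trig_mxP => i j ij; rewrite mxE.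
    have -> : (i == j) = false by apply/eqP => e; move: ij; rewrite e ltnn.
    have -> : (i == j.+1 :> nat) = false by apply/eqP => e; move: ij; rewrite e; lia.
    by rewrite subrr.
  rewrite big1 // => i _; rewrite mxE eqxx (_ : (i == i.+1 :> nat) = false) ?subr0 //.
  by apply/eqP; lia.
rewrite -[RHS]mulr1 -detU -det_mulmx.
set N := _ *m U.
have NE (i j : 'I_m.+1) : N i j = g i j - (if (j.+1 < m.+1)%N then g i j.+1 else 0).
  rewrite mxE; under eq_bigr => l _ do rewrite !mxE mulrBr.
  rewrite sumrB; congr (_ - _).
    rewrite (bigD1 j) //= eqxx mulr1 big1 ?addr0 // => l lj.
    by rewrite (negbTE lj) mulr0.
  case: ifP => jm.
    rewrite (bigD1 (Ordinal jm)) //= eqxx mulr1 big1 ?addr0 // => l lj.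
    rewrite (_ : (l == j.+1 :> nat) = false) ?mulr0 //.
    by apply/eqP => e; move/eqP: lj; apply; apply: val_inj.
  apply: big1 => l _; rewrite (_ : (l == j.+1 :> nat) = false) ?mulr0 //.
  by apply/eqP => e; move: jm; rewrite -e ltn_ord.
rewrite (expand_det_row N ord_max) (bigD1 ord_max) //= big1 ?addr0; last first.
  move=> j jmax; rewrite NE /= g1 ifT ?g1 ?subrr ?mul0r //.
  rewrite ltnS ltn_neqAle -ltnS ltn_ord andbT.
  by apply: contra_neq jmax => e; apply: val_inj.
rewrite NE /= ltnn subr0 g1 mul1r /cofactor -signr_odd addnn odd_double expr0 mul1r.
congr (\det _); apply/matrixP => i j; rewrite mxE [RHS]mxE [RHS]mxE NE /=.
have bE (l : 'I_m) : bump m l = l by rewrite /bump leqNgt ltn_ord.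
by rewrite !bE ltnS ltn_ord.
Qed.

End Determinants.

Section ExpIntegral.
Context (R : realType).
Local Notation mu := (@lebesgue_measure R).

Lemma integral_exp_sum (m : nat) (c C : 'I_m -> R) (a b : R) :
  (forall i, c i != 0) -> a <= b ->
  (\int[mu]_(r in `[a, b]) (\sum_i C i * expR (c i * r))%:E)%E =
  (\sum_i C i * ((expR (c i * b) - expR (c i * a)) / c i))%:E.
Proof.
move=> c0; rewrite le_eqVlt => /predU1P[->|ab].
  rewrite set_itv1 integral_set1; congr EFin; rewrite big1 // => i _.
  by rewrite subrr mul0r mulr0.
pose f r := \sum_i C i * expR (c i * r).
pose F (r : R) := \sum_i C i * (expR (c i * r) / c i).
have dF (x : R) : is_derive x (1 : R) F (f x).
  rewrite /F /f (_ : (fun r => _) =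
    \sum_(i < m) (fun r => C i * (expR (c i * r) / c i))); last first.
    by apply/funext => r; rewrite fct_sumE.
  apply: is_derive_sum => i.
  apply: is_derive_eq.
  rewrite /GRing.scale /= !mulr0 add0r mulr1 (mulrC (expR _)) mulKf //.
have cF : continuous F.
  by move=> x; apply: differentiable_continuous; apply/derivable1_diffP.
have cf : continuous f.
  rewrite (_ : f = \sum_(i < m) (fun r => C i * expR (c i * r))); last first.
    by apply/funext => r; rewrite fct_sumE.
  apply: (big_ind (fun h : R -> R => continuous h)).
  - by move=> x; exact: cvg_cst.
  - by move=> h k ch ck x; apply: cvgD; [exact: ch|exact: ck].
  - move=> i _ x; apply: cvgM; first exact: cvg_cst.
    apply: (@continuous_comp _ _ _ (fun r => c i * r) expR x); last exact: continuous_expR.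
    by apply: cvgM; [exact: cvg_cst|exact: cvg_id].
rewrite (continuous_FTC2 (F := F) ab) //.
- rewrite -EFinB; congr EFin; rewrite -sumrB; apply: eq_bigr => i _.
  by rewrite -mulrBr mulrBl.
- exact: continuous_subspaceT.
- split.
  + by move=> x _; exact: ex_derive.
  + by apply: cvg_at_right_filter; exact: cF.
  + by apply: cvg_at_left_filter; exact: cF.
- by move=> x _; rewrite derive1E; apply: derive_val.
Qed.

End ExpIntegral.

Section SchurIntegral.
Context (R : realType).
Local Notation T := (nat * nat)%type.
Local Notation env := (env R T).
Local Notation mu := (@lebesgue_measure R).

(** Each variable occurs in a single column and the determinant is linear in that column, so the
    integral can be taken inside, column after column. Columns not yet treated keep their
    exponentials and their constraint. *)
Lemma Iint_columns (m row : nat) (a b c : 'I_m -> R) (K : R) (js : seq 'I_m)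
    (z : env) : uniq js -> (forall j, a j <= b j) -> (forall i, c i != 0) ->
  Iint [seq (row, nat_of_ord j) | j <- js] (fun y : env =>
    (if [forall j : 'I_m, a j <= y (row, nat_of_ord j) <= b j]
     then K * \det (\matrix_(i < m, j < m) expR (c i * y (row, nat_of_ord j)))
     else 0)%:E) z =
  (if [forall j : 'I_m, (j \in js) || (a j <= z (row, nat_of_ord j) <= b j)]
   then K * \det (\matrix_(i < m, j < m)
     (if j \in js then (expR (c i * b j) - expR (c i * a j)) / c i
      else expR (c i * z (row, nat_of_ord j)))) else 0)%:E.
Proof.
move=> + ab c0; elim: js z => [|j0 js IH] z //=.
move=> /andP[j0js ujs].
pose M (q : 'I_m -> R) : 'M[R]_m := \matrix_(i < m, j < m)
  (if j == j0 then q i else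
   if j \in js then (expR (c i * b j) - expR (c i * a j)) / c i
      else expR (c i * z (row, nat_of_ord j))).
have updE (j : 'I_m) (r : R) :
    upd z (row, nat_of_ord j0) r (row, nat_of_ord j) =
    if j == j0 then r else z (row, nat_of_ord j).
  by rewrite /upd xpair_eqE eqxx.
(* Expansion along column [j0]: its cofactors do not see that column, so they are constants for the
   current integral. *)
have detM q : \det (M q) = \sum_i q i * cofactor (M (fun=> 0)) i j0.
  rewrite (expand_det_col _ j0); apply: eq_bigr => i _.
  rewrite mxE eqxx /cofactor; congr (_ * (_ * \det _)).
  by apply/matrixP => i' j'; rewrite !mxE eq_sym (negbTE (neq_lift _ _)).
have step r : Iint [seq (row, nat_of_ord j) | j <- js] (fun y : env =>
    (if [forall j : 'I_m, a j <= y (row, nat_of_ord j) <= b j]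
     then K * \det (\matrix_(i < m, j < m) expR (c i * y (row, nat_of_ord j)))
     else 0)%:E) (upd z (row, nat_of_ord j0) r) =
  (if [forall j : 'I_m, (j \in j0 :: js) || (a j <= z (row, nat_of_ord j) <= b j)]
      && (a j0 <= r <= b j0)
   then \sum_i (K * cofactor (M (fun=> 0)) i j0) * expR (c i * r) else 0)%:E.
  rewrite IH //; congr EFin.
  have -> : [forall j : 'I_m, (j \in js) ||
        (a j <= upd z (row, nat_of_ord j0) r (row, nat_of_ord j) <= b j)] =
      [forall j : 'I_m, (j \in j0 :: js) || (a j <= z (row, nat_of_ord j) <= b j)]
      && (a j0 <= r <= b j0).
    apply/forallP/andP => [h|[/forallP h hr] j].
      split; last by have := h j0; rewrite (negbTE j0js) updE eqxx.
      apply/forallP => j; have := h j; rewrite inE updE.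
      by case: eqVneq.
    have := h j; rewrite inE updE; case: eqVneq => [->|] //.
    by rewrite hr orbT.
  case: ifP => // _.
  rewrite (_ : \matrix_(i, j) _ = M (fun i => expR (c i * r))); last first.
    apply/matrixP => i j; rewrite !mxE updE.
    by case: eqVneq => [->|//]; rewrite (negbTE j0js).
  by rewrite detM mulr_sumr; apply: eq_bigr => i _; lra.
under eq_integral => r _ do rewrite step.
case: ifPn => [hall|hall]; last first.
  by rewrite integral0_eq.
rewrite /=.
transitivity (\int[mu]_(r in `[a j0, b j0])
   (\sum_i (K * cofactor (M (fun=> 0)) i j0) * expR (c i * r))%:E)%E.
  rewrite [RHS]integral_mkcond; apply: eq_integral => r _.
  rewrite patchE; case: ifPn => h; case: ifPn => h' //.
    by move: h'; rewrite notin_setE /= in_itv /= h.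
  by move: h'; rewrite inE /= in_itv /= (negbTE h).
rewrite integral_exp_sum //; congr EFin.
rewrite (_ : \matrix_(i, j) _ = M (fun i => (expR (c i * b j0) - expR (c i * a j0)) / c i)).
  by rewrite detM mulr_sumr; apply: eq_bigr => i _; lra.
by apply/matrixP => i j; rewrite !mxE inE; case: eqVneq => [->|//].
Qed.

Definition rowc (i : nat) : seq T := [seq (i, j) | j <- iota 0 i.+1].

(** Row [k'] comes first, hence outermost: with that row fixed, the inner integral is the same
    problem with one row fewer. *)
Fixpoint below (k : nat) : seq T :=
  if k is k'.+1 then rowc k' ++ below k' else [::].

Lemma belowS k : below k.+1 = rowc k ++ below k. Proof. by []. Qed.

Definition rsum (z : env) (i : nat) : R := \sum_(j < i.+1) z (i, nat_of_ord j).

Definition inter (i : nat) (z : env) : bool :=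
  [forall j : 'I_i.+1, z (i.+1, j.+1) <= z (i, nat_of_ord j) <= z (i.+1, nat_of_ord j)].

Fixpoint patt (k : nat) (z : env) : bool :=
  if k is k'.+1 then patt k' z && inter k' z else true.

(** The pairing of [x] with the weight of the pattern, its vector of row-sum differences. *)
Fixpoint wt (x : nat -> R) (k : nat) (z : env) : R :=
  if k is k'.+1 then wt x k' z + x k * (rsum z k - rsum z k') else x 0%N * rsum z 0.

Definition wpatt (x : nat -> R) (k : nat) (z : env) : \bar R :=
  (if patt k z then expR (wt x k z) else 0)%:E.

Definition vand (x : nat -> R) (k : nat) : R :=
  \prod_(i < k.+1) \prod_(j < k.+1 | (i < j)%N) (x i - x j).

Definition alternant (x y : nat -> R) (k : nat) : R :=
  \det (\matrix_(i < k.+1, j < k.+1) expR (x i * y j)) / vand x k.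

Lemma measurable_rsum i : measurable_fun [set: env] (fun z : env => rsum z i).
Proof. by apply: measurable_sum => j; exact: measurable_coord. Qed.

Lemma measurable_wt x k : measurable_fun [set: env] (wt x k).
Proof.
elim: k => [|k IH] /=.
  by apply: measurable_funM => //; exact: measurable_rsum.
apply: measurable_funD => //; apply: measurable_funM => //.
by apply: measurable_funB; exact: measurable_rsum.
Qed.

Lemma measurable_inter i : measurable [set z : env | inter i z].
Proof.
rewrite (_ : [set z : env | _] = \bigcap_(j in [set: 'I_i.+1])
  ([set z : env | z (i.+1, j.+1) <= z (i, nat_of_ord j)] `&`
   [set z : env | z (i, nat_of_ord j) <= z (i.+1, nat_of_ord j)])); last first.
  apply/seteqP; split=> z /=.
    by move=> /forallP h j _; have /andP[] := h j.
  by move=> h; apply/forallP => j; have [-> ->] := h j I.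
apply: fin_bigcap_measurable => // j _.
by apply: measurableI; rewrite -[X in measurable X]setTI;
  apply: measurable_fun_le => //; exact: measurable_coord.
Qed.

Lemma measurable_patt k : measurable [set z : env | patt k z].
Proof.
elim: k => [|k IH] /=; first by rewrite (_ : [set z : env | _] = setT);
  [exact: measurableT|apply/seteqP; split].
rewrite (_ : [set z : env | _] = [set z | patt k z] `&` [set z | inter k z]).
  by apply: measurableI => //; exact: measurable_inter.
by apply/seteqP; split=> z /= /andP.
Qed.

Lemma wpattE x k z :
  wpatt x k z = ((\1_[set z : env | patt k z] z)%:E * (expR (wt x k z))%:E)%E.
Proof.
rewrite /wpatt -EFinM indicE; case: ifPn => h; first by rewrite mem_set ?mul1r.
by rewrite memNset ?mul0r //=; exact/negP.
Qed.

Lemma measurable_wpatt x k : measurable_fun [set: env] (wpatt x k).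
Proof.
rewrite (_ : wpatt x k = fun z =>
    ((\1_[set z : env | patt k z] z)%:E * (expR (wt x k z))%:E)%E); last first.
  by apply/funext => z; exact: wpattE.
apply: emeasurable_funM; first by apply: measurable_indicE; exact: measurable_patt.
by apply/measurable_EFinP; apply: measurableT_comp => //; exact: measurable_wt.
Qed.

Lemma wpatt_ge0 x k z : (0 <= wpatt x k z)%E.
Proof. by rewrite lee_fin; case: ifP => // _; exact: expR_ge0. Qed.

Lemma mem_rowc i t : (t \in rowc i) = (t.1 == i) && (t.2 <= i)%N.
Proof.
case: t => t1 t2 /=; apply/mapP/andP => [[j + [-> ->]]|[/eqP -> le]].
  by rewrite mem_iota.
by exists t2; rewrite ?mem_iota.
Qed.

Lemma mem_below k t : (t \in below k) = (t.1 < k)%N && (t.2 <= t.1)%N.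
Proof.
elim: k => [|k IH]; [by []|rewrite belowS mem_cat IH mem_rowc].
case: t {IH} => t1 t2 /=; case: (ltngtP t1 k) => [lt|gt|->] /=.
- by rewrite ltnS (ltnW lt).
- by rewrite ltnS leqNgt gt.
- by rewrite ltnSn orbF.
Qed.

Lemma uniq_below k : uniq (below k).
Proof.
elim: k => [|k IH]; [by []|rewrite belowS cat_uniq IH andbT]; apply/andP; split.
  by rewrite map_inj_uniq ?iota_uniq // => i j [].
apply/hasPn => t; rewrite mem_below mem_rowc => /andP[lt _].
by rewrite ltn_eqF.
Qed.

Lemma rsum_agree (y z : env) i :
  (forall j, (j <= i)%N -> y (i, j) = z (i, j)) -> rsum y i = rsum z i.
Proof. by move=> yz; apply: eq_bigr => j _; apply: yz; rewrite -ltnS. Qed.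

Lemma rowcE k : rowc k = [seq (k, nat_of_ord j) | j <- enum 'I_k.+1].
Proof. by rewrite /rowc -val_enum_ord -map_comp. Qed.

(** A continuous branching rule, by induction on the rows. With row [k] fixed, the inner integral is
    a quotient of alternants. The new factor [expR (- (x k.+1 * rsum y k))], spread over the
    columns, changes each [x i] into [d i]. Integrating the columns leaves differences divided by
    [d i]: [det_col_differences] turns the differences into a determinant one size larger, and the
    divisors complete the Vandermonde product. *)
Theorem Iint_below_alternant (x : nat -> R) k (z : env) :
  (forall i j, (i < j <= k)%N -> x i != x j) ->
  (forall j, (j < k)%N -> z (k, j.+1) <= z (k, j)) ->
  Iint (below k) (wpatt x k) z = (alternant x (fun j => z (k, j)) k)%:E.
Proof.
elim: k z => [|k IH] z xd zd.
  rewrite /= /wpatt /alternant /vand /= det_mx11 mxE /rsum !big_ord1 big_pred0.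
    by rewrite invr1 mulr1.
  by move=> j; rewrite (ord1 j).
rewrite belowS Iint_cat.
pose c (y : env) : \bar R := (if inter k y then
  expR (x k.+1 * (rsum y k.+1 - rsum y k)) else 0)%:E.
have c0 y : (0 <= c y)%E.
  by rewrite lee_fin; case: ifP => // _; exact: expR_ge0.
pose d (i : 'I_k.+1) := x i - x k.+1.
have d0 i : d i != 0.
  by rewrite subr_eq0; apply: xd; rewrite ltn_ord leqnn.
pose a (j : 'I_k.+1) := z (k.+1, j.+1); pose b (j : 'I_k.+1) := z (k.+1, nat_of_ord j).
have ab j : a j <= b j by apply: zd.
pose K := expR (x k.+1 * rsum z k.+1) / vand x k.
transitivity (Iint (rowc k) (fun y : env =>
    (if [forall j : 'I_k.+1, a j <= y (k, nat_of_ord j) <= b j]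
     then K * \det (\matrix_(i < k.+1, j < k.+1) expR (d i * y (k, nat_of_ord j)))
     else 0)%:E) z).
  apply: Iint_ext => y yz.
  have yz1 j : y (k.+1, j) = z (k.+1, j).
    by apply: yz; rewrite mem_rowc /= gtn_eqF.
  have -> : wpatt x k.+1 = fun y => (c y * wpatt x k y)%E.
    apply/funext => w; rewrite /wpatt /c -EFinM /= addrC expRD.
    by case: (patt k w); case: (inter k w); rewrite /= ?mulr0 ?mul0r.
  rewrite (@IintZ_fun _ _ (below k) c); last 4 first.
  - exact: measurable_wpatt.
  - exact: wpatt_ge0.
  - exact: c0.
  - move=> t w r tb; have tk : t.1 != k.
      by move: tb; rewrite mem_below => /andP[lt _]; rewrite ltn_eqF.
    have tk1 : t.1 != k.+1.
      by move: tb; rewrite mem_below => /andP[lt _]; rewrite ltn_eqF // ltnW.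
    have u1 i j : t.1 != i -> upd w t r (i, j) = w (i, j).
      by move=> ti; rewrite upd_neq //; apply: contraNneq ti => <-.
    rewrite /c /rsum; under eq_bigr do rewrite u1 //.
    under [X in _ - X]eq_bigr do rewrite u1 //.
    congr (if _ then _ else _)%:E; apply: eq_forallb => j.
    by rewrite !u1.
  have intE : inter k y = [forall j : 'I_k.+1, a j <= y (k, nat_of_ord j) <= b j].
    by apply: eq_forallb => j; rewrite !yz1.
  rewrite /c intE; case: ifP => [/forallP yin|_]; last by rewrite mul0e.
  rewrite IH; last 2 first.
  - by move=> i j /andP[ij jk]; apply: xd; rewrite ij ltnW.
  - move=> j jk; have jk0 : (j < k.+1)%N by rewrite ltnS ltnW.
    have jk1 : (j.+1 < k.+1)%N by [].
    have /andP[h1 _] := yin (Ordinal jk0).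
    have /andP[_ h2] := yin (Ordinal jk1).
    exact: le_trans h2 h1.
  rewrite -EFinM; congr EFin.
  have -> : \det (\matrix_(i < k.+1, j < k.+1) expR (d i * y (k, nat_of_ord j))) =
      \det (\matrix_(i < k.+1, j < k.+1) expR (x i * y (k, nat_of_ord j))) *
      expR (- (x k.+1 * rsum y k)).
    rewrite (_ : \matrix_(i, j) expR (d i * _) = \matrix_(i < k.+1, j < k.+1)
      ((\matrix_(i < k.+1, j < k.+1) expR (x i * y (k, nat_of_ord j))) i j *
        expR (- (x k.+1 * y (k, nat_of_ord j))))); last first.
      by apply/matrixP => i j; rewrite !mxE -expRD; congr expR; rewrite /d; lra.
    by rewrite det_scale_col -expR_sum sumrN -mulr_sumr.
  rewrite (rsum_agree (y := y) (z := z)) // /alternant mulrBr expRD /K.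
  lra.
rewrite rowcE Iint_columns ?enum_uniq // ifT; last first.
  by apply/forallP => j; rewrite mem_enum.
congr EFin; rewrite /K /alternant.
(* The row [k.+1] of [g] is constantly 1, as [det_col_differences] asks of the last row. *)
pose g (i j : nat) := expR ((x i - x k.+1) * z (k.+1, j)).
rewrite (_ : \matrix_(i, j) (if _ then _ else _) = \matrix_(i < k.+1, j < k.+1)
  ((d i)^-1 * (\matrix_(i < k.+1, j < k.+1) (g i j - g i j.+1)) i j)); last first.
  by apply/matrixP => i j; rewrite !mxE mem_enum /= mulrC.
rewrite det_scale_row det_col_differences; last by move=> j; rewrite /g subrr mul0r expR0.
have -> : \det (\matrix_(i < k.+2, j < k.+2) expR (x i * z (k.+1, nat_of_ord j))) =
    \det (\matrix_(i < k.+2, j < k.+2) g i j) * expR (x k.+1 * rsum z k.+1).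
  rewrite (_ : \matrix_(i, j) expR _ = \matrix_(i < k.+2, j < k.+2)
    ((\matrix_(i < k.+2, j < k.+2) g i j) i j *
      expR (x k.+1 * z (k.+1, nat_of_ord j)))); last first.
    by apply/matrixP => i j; rewrite !mxE -expRD; congr expR; lra.
  by rewrite det_scale_col -expR_sum -mulr_sumr.
have -> : vand x k.+1 = vand x k * \prod_(i < k.+1) d i.
  rewrite /vand big_ord_recr /= [X in _ * X]big_pred0; last first.
    by move=> j /=; apply/negbTE; rewrite -leqNgt -ltnS.
  rewrite mulr1 -big_split /=; apply: eq_bigr => i _.
  by rewrite big_mkcond big_ord_recr /= ltn_ord -big_mkcond.
rewrite prodfV invfM.
lra.
Qed.

End SchurIntegral.

(** * From distinct entries to all points *)

Section SchurExp.
Context (R : realType).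
Local Notation T := (nat * nat)%type.
Local Notation env := (env R T).

Lemma inter_bounds k (z : env) j : inter k z -> (j <= k)%N ->
  z (k.+1, j.+1) <= z (k, j) <= z (k.+1, j).
Proof. by move=> /forallP h jk; exact: (h (Ordinal (jk : (j < k.+1)%N))). Qed.

Lemma row_decreasing k (z : env) : inter k z ->
  forall i j, (i <= j <= k.+1)%N -> z (k.+1, j) <= z (k.+1, i).
Proof.
move=> hz i j /andP[/subnKC <-].
elim: (j - i)%N => [|d IH]; first by rewrite addn0.
rewrite addnS => le; apply: le_trans (IH (ltnW le)).
have /andP[h1 h2] := inter_bounds hz (le : (i + d <= k)%N).
exact: le_trans h1 h2.
Qed.

Lemma patt_bounds k (z : env) : patt k z -> forall i j, (j <= i <= k)%N ->
  z (k, k) <= z (i, j) <= z (k, 0%N).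
Proof.
elim: k => [|k IH] /=.
  move=> _ i j /andP[+ /[!leqn0]/eqP i0]; rewrite i0 leqn0 => /eqP ->.
  by rewrite lexx.
move=> /andP[pk ik] i j /andP[ji]; rewrite leq_eqVlt => /predU1P[ie|ik1].
  by rewrite ie in ji *; apply/andP; split; apply: row_decreasing => //; lia.
have ji' : (j <= i <= k)%N by rewrite ji -ltnS.
have /andP[h1 h2] := IH pk i j ji'.
have /andP[h3 _] := inter_bounds ik (leqnn k).
have /andP[_ h4] := inter_bounds ik (leq0n k).
by rewrite (le_trans h3 h1) (le_trans h2 h4).
Qed.

Lemma rsum_bound (z : env) i (B : R) :
  (forall j, (j <= i)%N -> `|z (i, j)| <= B) -> `|rsum z i| <= i.+1%:R * B.
Proof.
move=> zB; apply: le_trans (ler_norm_sum _ _ _) _.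
apply: (@le_trans _ _ (\sum_(j < i.+1) B)).
  by apply: ler_sum => j _; apply: zB; rewrite -ltnS.
by rewrite sumr_const card_ord mulr_natl.
Qed.

Lemma wt_lipschitz (x y : nat -> R) k (z : env) (C e : R) :
  (forall i, (i <= k)%N -> `|rsum z i| <= C) ->
  (forall i, (i <= k)%N -> `|x i - y i| <= e) ->
  `|wt x k z - wt y k z| <= k.+1%:R * (e * (2 * C)).
Proof.
elim: k => [|k IH] zC xy /=.
  rewrite -mulrBl normrM mul1r; apply: ler_pM => //; first exact: xy.
  have := zC 0%N (leqnn 0); have := normr_ge0 (rsum z 0); lra.
have {}IH : `|wt x k z - wt y k z| <= k.+1%:R * (e * (2 * C)).
  by apply: IH => i ik; [apply: zC|apply: xy]; exact: leqW.
rewrite (_ : _ - _ = (wt x k z - wt y k z) +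
  (x k.+1 - y k.+1) * (rsum z k.+1 - rsum z k)); last lra.
apply: le_trans (ler_normD _ _) _.
rewrite -(natr1 k.+1) [leRHS]mulrDl mul1r; apply: lerD => //.
rewrite normrM; apply: ler_pM => //; first exact: xy.
apply: le_trans (ler_normB _ _) _.
have h1 := zC k.+1 (leqnn _); have h2 := zC k (leqnSn _); lra.
Qed.

Variables (m : nat) (z : env).
Hypothesis z_dec : forall j, (j < m)%N -> z (m, j.+1) <= z (m, j).

Definition schur_int (x : nat -> R) : \bar R := Iint (below m) (wpatt x m) z.

Let B : R := `|z (m, 0%N)| + `|z (m, m)|.
Let C : R := m.+1%:R * B.

Lemma fibre_bound (y : env) : (forall t, t \notin below m -> y t = z t) ->
  patt m y -> forall i j, (j <= i <= m)%N -> `|y (i, j)| <= B.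
Proof.
move=> yz py i j ij; have /andP[] := patt_bounds py ij.
have yzm l : y (m, l) = z (m, l) by apply: yz; rewrite mem_below ltnn.
rewrite !yzm => h1 h2; rewrite ler_norml /B.
have := ler_norm (z (m, 0%N)); have := ler_norm (- z (m, m)).
have := normr_ge0 (z (m, 0%N)); have := normr_ge0 (z (m, m)).
by rewrite normrN => *; apply/andP; split; lra.
Qed.

(** The entries of a pattern lie between the extreme entries of its top row, so row sums are bounded
    by [C] on the support and the exponents differ by at most a constant times [e]. Used both ways,
    this makes the logarithm of the integral Lipschitz. *)
Lemma schur_int_le (x y : nat -> R) (e : R) :
  (forall i, (i <= m)%N -> `|x i - y i| <= e) ->
  (schur_int x <= (expR (m.+1%:R * (2 * C) * e))%:E * schur_int y)%E.
Proof.
move=> xy; rewrite /schur_int -IintZ; last 3 first.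
- exact: measurable_wpatt.
- exact: wpatt_ge0.
- by rewrite lee_fin expR_ge0.
apply: le_Iint_fibre.
- exact: measurable_wpatt.
- exact: wpatt_ge0.
- by apply: measurable_funeM; exact: measurable_wpatt.
- by move=> w; rewrite mule_ge0 ?wpatt_ge0 // lee_fin expR_ge0.
move=> w wz; rewrite /wpatt; case: ifPn => pw; last by rewrite mule0.
rewrite -EFinM lee_fin -expRD ler_expR.
have := @wt_lipschitz x y m w C e.
have h1 i : (i <= m)%N -> `|rsum w i| <= C.
  move=> im; apply: (@le_trans _ _ (i.+1%:R * B)).
    by apply: rsum_bound => j ji; apply: fibre_bound; rewrite ?ji.
  by apply: ler_wpM2r; rewrite ?ler_nat // addr_ge0.
move=> /(_ h1 xy); have := ler_norm (wt x m w - wt y m w); lra.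
Qed.

Definition coords (x : 'rV[R]_m.+1) (i : nat) : R := x ord0 (inord i).

Lemma schur_int_ratio (lam x : 'rV[R]_m.+1) :
  (forall j : 'I_m.+1, lam ord0 j = z (m, nat_of_ord j)) ->
  distinct_entries x -> schur_int (coords x) = (schur_ratio lam x)%:E.
Proof.
move=> lamz xd; rewrite /schur_int Iint_below_alternant //; last first.
  move=> i j /andP[ij jm]; apply/eqP => /xd /(congr1 val).
  by rewrite /= !inordK ?ltnS //; lia.
congr EFin; rewrite /alternant /schur_ratio; congr (\det _ / _).
  by apply/matrixP => i j; rewrite !mxE lamz /coords inord_val.
by apply: eq_bigr => i _; apply: eq_bigr => j _; rewrite /coords !inord_val.
Qed.

Lemma distinct_dense (x : 'rV[R]_m.+1) (e : R) : 0 < e ->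
  exists2 y, distinct_entries y & forall i, `|y ord0 i - x ord0 i| <= e.
Proof.
move=> e0.
(* The least gap between different entries, 1 if there is none. The perturbations [d * i] separate
   equal entries, and as they differ by at most half of [g], different entries do not collide. *)
pose g := \big[Num.min/1]_(p : 'I_m.+1 * 'I_m.+1 | x ord0 p.1 != x ord0 p.2)
  `|x ord0 p.1 - x ord0 p.2|.
have g0 : 0 < g.
  by apply: lt_bigmin => // p; rewrite normr_gt0 subr_eq0.
pose d := Num.min e g / (m.+1)%:R / 2.
have mn0 : 0 < Num.min e g by rewrite lt_min e0.
have m0 : 0 < (m.+1)%:R :> R by rewrite ltr0n.
have d0 : 0 < d by rewrite !divr_gt0.
have dm : d * m.+1%:R = Num.min e g / 2 by rewrite /d mulrAC divfK // gt_eqF.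
exists (\row_i (x ord0 i + d * (nat_of_ord i)%:R)).
  move=> i j; rewrite !mxE => xij.
  have dij : `|d * i%:R - d * j%:R| <= d * m.+1%:R.
    rewrite -mulrBr normrM gtr0_norm //; apply: ler_wpM2l; first exact: ltW.
    have hi : i%:R <= m.+1%:R :> R by rewrite ler_nat ltnW.
    have hj : j%:R <= m.+1%:R :> R by rewrite ler_nat ltnW.
    have : 0 <= i%:R :> R by []. have : 0 <= j%:R :> R by [].
    by rewrite ler_norml => *; apply/andP; split; lra.
  have [xe|xne] := eqVneq (x ord0 i) (x ord0 j).
    move: xij; rewrite xe => /addrI /(mulfI (lt0r_neq0 d0)) /eqP.
    by rewrite eqr_nat => /eqP /val_inj.
  have : g <= `|x ord0 i - x ord0 j| by exact: (bigmin_le_cond _ (j := (i, j))).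
  rewrite (_ : x ord0 i - _ = - (d * i%:R - d * j%:R)); last by lra.
  rewrite normrN => gd.
  have : Num.min e g <= g by rewrite ge_min lexx orbT.
  by move=> gle; exfalso; move: dij; rewrite dm; lra.
move=> i; rewrite mxE addrC addKr ger0_norm; last by rewrite mulr_ge0 // ltW.
apply: (@le_trans _ _ (d * m.+1%:R)).
  by apply: ler_wpM2l; [exact: ltW|rewrite ler_nat ltnW].
have h : Num.min e g <= e by rewrite ge_min lexx.
rewrite dm; lra.
Qed.

Lemma schur_int_fin (lam : 'rV[R]_m.+1) :
  (forall j : 'I_m.+1, lam ord0 j = z (m, nat_of_ord j)) ->
  forall x : 'rV[R]_m.+1, schur_int (coords x) \is a fin_num.
Proof.
move=> lamz x; have [y yd xy] := distinct_dense x (@ltr01 R).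
rewrite ge0_fin_numE; last by apply: Iint_ge0; exact: wpatt_ge0.
apply: le_lt_trans (@schur_int_le (coords x) (coords y) 1 _) _.
  by move=> i im; rewrite distrC; exact: xy.
by rewrite (schur_int_ratio lamz yd) -EFinM ltry.
Qed.

Lemma mx_entry_le_norm (p q : nat) (x : 'M[R]_(p, q)) i j : `|x i j| <= `|x|.
Proof.
by rewrite [leRHS]mx_normrE; exact: (le_bigmax _ _ (i, j)).
Qed.

(** Near [x] the ratio equals the integral at points with distinct entries, where [schur_int_le]
    squeezes it between [s] times [expR (- M * e)] and [s] times [expR (M * e)], with [e] the
    distance to [x]. *)
Theorem schur_expE (lam : 'rV[R]_m.+1) :
  (forall j : 'I_m.+1, lam ord0 j = z (m, nat_of_ord j)) ->
  forall x : 'rV[R]_m.+1, (schur_exp lam x)%:E = schur_int (coords x).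
Proof.
move=> lamz x; have fin := schur_int_fin lamz.
(* Density of the points with distinct entries makes the filter proper, so that its limit is
   unique. *)
have PF : ProperFilter (within (@distinct_entries R m.+1) (nbhs x)).
  apply: Build_ProperFilter_ex => A /=; rewrite /within /= => /nbhs_ballP[e /= e0 eA].
  have e20 : 0 < e / 2 by rewrite divr_gt0.
  have [y yd xy] := distinct_dense x e20.
  exists y; apply: eA => //; split => // i j; rewrite (ord1 i) /= /ball /= distrC.
  by apply: le_lt_trans (xy j) _; lra.
rewrite -(fineK (fin x)); congr EFin.
apply: cvg_lim => //; set s := fine _.
pose M := m.+1%:R * (2 * C).
have cexp (a : R) : s * expR (a * `|y - x|) @[y --> within (@distinct_entries R m.+1) (nbhs x)] --> s.
  have : (fun y => s * expR (a * `|y - x|)) @ nbhs x --> s * expR (a * `|x - x|).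
    apply: cvgMl_tmp.
    apply: (@cvg_comp _ _ _ (fun y : 'rV[R]_m.+1 => a * `|y - x|) expR (nbhs x)
      (nbhs (a * `|x - x|))); last exact: continuous_expR.
    apply: cvgMl_tmp.
    by apply: cvg_norm; apply: cvgB; [exact: cvg_id|exact: cvg_cst].
  rewrite subrr normr0 mulr0 expR0 mulr1 => H.
  by apply: cvg_trans H; apply: cvg_app; exact: cvg_within.
apply: (squeeze_cvgr _ (cexp (- M)) (cexp M)).
rewrite near_withinE; apply: nearW => y yd.
have le : forall i, (i <= m)%N -> `|coords x i - coords y i| <= `|y - x|.
  move=> i im; rewrite distrC; have := mx_entry_le_norm (y - x) ord0 (inord i).
  by rewrite !mxE.
have := schur_int_le le.
have := @schur_int_le (coords y) (coords x) `|y - x|.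
rewrite (schur_int_ratio lamz yd) -(fineK (fin x)) -!EFinM !lee_fin -/s -/M.
have -> : expR (- M * `|y - x|) = (expR (M * `|y - x|))^-1 by rewrite mulNr expRN.
move=> h1 h2; have {}h1 : schur_ratio lam y <= expR (M * `|y - x|) * s.
  by apply: h1 => i im; rewrite distrC; exact: le.
apply/andP; split; last by rewrite mulrC.
by rewrite ler_pdivrMr ?expR_gt0 // mulrC.
Qed.

End SchurExp.

(** * Rado's theorem and row-sum coordinates *)

Section Rado.
Context (R : realType).
Local Notation T := (nat * nat)%type.
Local Notation env := (env R T).

Lemma patt_ext k (y w : env) :
  (forall i j, (j <= i <= k)%N -> y (i, j) = w (i, j)) -> patt k y = patt k w.
Proof.
elim: k => //= k IH yw; congr andb.
  by apply: IH => i j /andP[ji ik]; apply: yw; rewrite ji leqW.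
apply: eq_forallb => j; rewrite !yw //; have := ltn_ord j; lia.
Qed.

(** For decreasing [lam] the right side is the sum of as many largest entries as [P] has elements:
    these are the majorization inequalities, one for each subset. *)
Definition dominated (k : nat) (lam mu : nat -> R) := forall P : pred nat,
  \sum_(i < k.+1 | P i) mu i <= \sum_(i < count P (iota 0 k.+1)) lam i.

Lemma rado_split k (lam : nat -> R) (x : R) : lam k.+1 <= x <= lam 0%N ->
  exists2 p, (p <= k)%N & lam p.+1 <= x <= lam p.
Proof.
elim: k => [|k IH] /andP[h1 h2]; first by exists 0%N; rewrite // h1.
have [le|gt] := leP (lam k.+1) x.
  have [|p pk hp] := IH; first by rewrite le.
  by exists p => //; exact: leqW.
by exists k.+1; rewrite // h1 ltW.
Qed.

(* The last entry [mu (k+1)] is removed by merging it into the adjacent pair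
   of entries of [lam] between which it lies. *)
Lemma rado_pattern k (lam mu : nat -> R) :
  (forall i, (i < k)%N -> lam i.+1 <= lam i) -> dominated k lam mu ->
  \sum_(i < k.+1) mu i = \sum_(i < k.+1) lam i ->
  exists w : env, [/\ patt k w, forall j, (j <= k)%N -> w (k, j) = lam j &
    forall i, (i <= k)%N -> rsum w i = \sum_(l < i.+1) mu l].
Proof.
elim: k lam mu => [|k IH] lam mu dec dom tot.
  exists (fun=> lam 0%N); split=> // [j|i].
    by rewrite leqn0 => /eqP ->.
  by rewrite leqn0 => /eqP ->; rewrite tot /rsum !big_ord1.
(* The singleton of the last index bounds [mu k.+1] from above; its complement, with the equality of
   totals, bounds it from below. *)
have mu0 : mu k.+1 <= lam 0%N.
  have cnt : count (pred1 k.+1) (iota 0 k.+2) = 1%N.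
    by rewrite count_uniq_mem ?iota_uniq // mem_iota add0n ltnSn.
  have := dom (pred1 k.+1); rewrite cnt big_ord1 (bigD1 ord_max) //= big_pred0 ?addr0; last first.
    move=> i; apply/negbTE; rewrite negb_and negbK.
    by case: eqVneq => //= e; apply/eqP/val_inj.
  by [].
have mu1 : lam k.+1 <= mu k.+1.
  have := dom (fun i => i < k.+1)%N.
  have -> : count (fun i => i < k.+1)%N (iota 0 k.+2) = k.+1.
    have c1 : count (fun i => i < k.+1)%N (iota 0 k.+1) = k.+1.
      rewrite -[RHS](size_iota 0); apply/eqP; rewrite -all_count.
      by apply/allP => i; rewrite mem_iota.
    by rewrite -[k.+2]addn1 iotaD count_cat c1 [count _ (iota _ 1)]/= ltnn !addn0.
  rewrite big_mkcond big_ord_recr /= ltnn addr0 -big_mkcond /=.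
  rewrite (eq_bigl xpredT) => [|i]; last by rewrite ltn_ord.
  by move: tot; rewrite big_ord_recr [RHS]big_ord_recr /=; lra.
have [|p pk /andP[hp1 hp2]] := @rado_split k lam (mu k.+1); first by rewrite mu1.
pose lam' j := if (j < p)%N then lam j else
  if j == p then lam p + lam p.+1 - mu k.+1 else lam j.+1.
have lamE j : (j <= k)%N -> lam j.+1 <= lam' j <= lam j.
  move=> jk; rewrite /lam'; case: ltngtP => [jp|jp|->].
  - by rewrite lexx andbT dec.
  - by rewrite lexx dec.
  - by apply/andP; split; lra.
have sumlam' q : \sum_(j < q) lam' j =
    if (q <= p)%N then \sum_(j < q) lam j else \sum_(j < q.+1) lam j - mu k.+1.
  elim: q => [|q IHq]; first by rewrite !big_ord0.
  rewrite big_ord_recr /= IHq /lam'; case: (ltngtP q p) => [lt|gt|->].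
  - by rewrite big_ord_recr.
  - by rewrite [in RHS]big_ord_recr /=; lra.
  - by rewrite !big_ord_recr /=; lra.
have [i ik|P||w [pw wk wr]] := IH lam' mu.
- have /andP[h1 _] := lamE i (ltnW ik); have /andP[_ h2] := lamE i.+1 ik.
  exact: le_trans h2 h1.
- rewrite sumlam'; set c := count P _.
  have cE Q : count (fun i => (P i && (i < k.+1)%N) || (Q && (i == k.+1)))
      (iota 0 k.+2) = (c + Q)%N.
    rewrite -[k.+2]addn1 iotaD count_cat.
    rewrite [X in (_ + X)%N](_ : _ = nat_of_bool Q); last first.
      by rewrite /= add0n addn0 ltnn andbF eqxx andbT.
    congr addn; apply: eq_in_count => i; rewrite mem_iota add0n => /andP[_ ik].
    by rewrite ik andbT (ltn_eqF ik) andbF orbF.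
  have sE Q : \sum_(i < k.+2 | (P i && (i < k.+1)%N) || (Q && (i == k.+1 :> nat))) mu i =
      \sum_(i < k.+1 | P i) mu i + (if Q then mu k.+1 else 0).
    rewrite big_mkcond big_ord_recr /= ltnn andbF eqxx andbT /=; congr (_ + _).
    rewrite [RHS]big_mkcond; apply: eq_bigr => i _.
    by rewrite ltn_ord andbT (ltn_eqF (ltn_ord i)) andbF orbF.
  (* Up to [p] entries, [lam'] and [lam] agree. For longer sums, [lam'] has the sum of one more
     entry of [lam] minus [mu k.+1], so the inequality used is that of the set enlarged by the index
     [k.+1]. *)
  case: ifP => cp.
    have := dom (fun i => (P i && (i < k.+1)%N) || (false && (i == k.+1))).
    by rewrite cE sE addr0 addn0.
  have := dom (fun i => (P i && (i < k.+1)%N) || (true && (i == k.+1))).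
  by rewrite cE sE addn1; lra.
- rewrite sumlam' ltnNge pk /=; move: tot; rewrite big_ord_recr /=; lra.
pose w' : env := fun t => if t.1 == k.+1 then lam t.2 else w t.
have w'E i j : (i <= k)%N -> w' (i, j) = w (i, j).
  by move=> ik; rewrite /w' /= ltn_eqF.
exists w'; split.
- rewrite /= (@patt_ext k w' w) ?pw /=; last by move=> i j /andP[_ ik]; exact: w'E.
  have e2 i : w' (k.+1, i) = lam i by rewrite /w' /= eqxx.
  apply/forallP => j; have jk : (j <= k)%N by rewrite -ltnS.
  by rewrite !e2 (w'E k j (leqnn k)) wk // lamE.
- by move=> j _; rewrite /w' /= eqxx.
- move=> i; rewrite leq_eqVlt => /predU1P[->|ik].
    by rewrite tot /rsum; apply: eq_bigr => j _; rewrite /w' /= eqxx.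
  by rewrite -wr // /rsum; apply: eq_bigr => j _; rewrite w'E.
Qed.

End Rado.

(** * Row sums as diagonal coordinates *)

Section RowSumCoordinates.
Context (R : realType).
Local Notation T := (nat * nat)%type.
Local Notation env := (env R T).
Variable m : nat.

Definition freec : seq T := [seq t <- below m | (t.2 < t.1)%N].
Definition diagc : seq T := [seq (i, i) | i <- iota 0 m].

Lemma mem_freec t : (t \in freec) = (t.2 < t.1 < m)%N.
Proof.
rewrite mem_filter mem_below; case: t => i j /=.
by apply/idP/idP => [/and3P[-> ->]|/andP[ji im]] //; rewrite ji im ltnW.
Qed.

Lemma mem_diagc t : (t \in diagc) = (t.1 < m)%N && (t.2 == t.1).
Proof.
case: t => i j /=; apply/mapP/andP => [[l + [-> ->]]|[im /eqP ->]].
  by rewrite mem_iota.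
by exists i => //; rewrite mem_iota.
Qed.

Lemma uniq_freec : uniq freec. Proof. exact: filter_uniq (uniq_below m). Qed.

Lemma uniq_diagc : uniq diagc.
Proof. by rewrite map_inj_uniq ?iota_uniq // => i j []. Qed.

Lemma perm_below : perm_eq (below m) (freec ++ diagc).
Proof.
apply: uniq_perm; first exact: uniq_below.
  rewrite cat_uniq uniq_freec uniq_diagc andbT /=; apply/hasPn => t.
  by rewrite mem_diagc mem_freec => /andP[_ /eqP ->]; rewrite ltnn.
move=> t; rewrite mem_cat mem_below mem_freec mem_diagc.
case: t => i j /=; case: (ltngtP j i) => // _; rewrite ?andbT ?andbF ?orbF //.
Qed.

Definition off (z : env) (i : nat) : R := - \sum_(j < i) z (i, nat_of_ord j).

(** One row of [Phi]: a translation of the diagonal entry by an amount depending only on the free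
    entries of that row. *)
Definition shift (i : nat) (z : env) : env := upd z (i, i) (z (i, i) + off z i).

Fixpoint shifts (L : seq nat) (z : env) : env :=
  if L is i :: L' then shifts L' (shift i z) else z.

(* Row sums become the diagonal coordinates. *)
Definition Phi (z : env) : env := fun t =>
  if (t.1 < m)%N && (t.2 == t.1) then z t + off z t.1 else z t.

Lemma off_upd_diag z i l r : off (upd z (l, l) r) i = off z i.
Proof.
rewrite /off; congr (- _); apply: eq_bigr => j _.
by rewrite upd_neq //; apply/eqP => -[e1 e2]; have := ltn_ord j; rewrite e2 -e1 ltnn.
Qed.

Lemma shiftsE L z t : uniq L ->
  shifts L z t = if (t.1 \in L) && (t.2 == t.1) then z t + off z t.1 else z t.
Proof.
case: t => t1 t2; elim: L z => [|i L IH] z //= /andP[iL uL].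
rewrite IH // /shift off_upd_diag inE /=.
case: (eqVneq t1 i) => [->|ti] /=.
  rewrite (negbTE iL) /= /upd xpair_eqE eqxx /=; case: eqVneq => [->|] //.
by rewrite upd_neq // xpair_eqE negb_and ti.
Qed.

Lemma Phi_shifts z : Phi z = shifts (iota 0 m) z.
Proof.
apply/funext => t; rewrite shiftsE ?iota_uniq // mem_iota add0n leq0n //.
Qed.

Lemma measurable_off i : measurable_fun [set: env] (fun z : env => off z i).
Proof.
apply: measurableT_comp => //.
by apply: measurable_sum => j; exact: measurable_coord.
Qed.

Lemma measurable_shift i : measurable_fun [set: env] (shift i : env -> env).
Proof.
apply: measurable_envP => t; rewrite /shift /upd; case: (t == _).
  by apply: measurable_funD; [exact: measurable_coord|exact: measurable_off].
exact: measurable_coord.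
Qed.

Lemma measurable_shifts L : measurable_fun [set: env] (shifts L : env -> env).
Proof.
elim: L => [|i L IH] /=; first exact: measurable_id.
exact: (measurableT_comp IH (measurable_shift i)).
Qed.

Lemma measurable_Phi : measurable_fun [set: env] (Phi : env -> env).
Proof.
rewrite (_ : Phi = shifts (iota 0 m)); first exact: measurable_shifts.
by apply/funext => z; exact: Phi_shifts.
Qed.

Lemma Iint_comp_shift i L (G : env -> \bar R) y : i \notin L ->
  Iint [seq (l, l) | l <- L] (fun z => G (shift i z)) y =
  Iint [seq (l, l) | l <- L] G (shift i y).
Proof.
elim: L y => //= l L IH y; rewrite inE negb_or => /andP[il iL].
apply: eq_integral => r _; rewrite IH //; congr (Iint _ _ _).
by rewrite /shift off_upd_diag upd_neq ?xpair_eqE ?(negbTE il) // updC // xpair_eqE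
  eq_sym (negbTE il).
Qed.

Lemma Iint_shifts L (F : env -> \bar R) : uniq L ->
  measurable_fun [set: env] F -> (forall z, 0 <= F z)%E ->
  Iint [seq (l, l) | l <- L] (fun z => F (shifts L z)) = Iint [seq (l, l) | l <- L] F.
Proof.
elim: L F => [|i L IH] F //= /andP[iL uL] mF F0.
rewrite -/(Iint ((i, i) :: [seq (l, l) | l <- L]) F).
rewrite [RHS]Iint_cons -IH // -[LHS]/(Iint ((i, i) :: [seq (l, l) | l <- L])
  (fun z => F (shifts L (shift i z)))) [LHS]Iint_cons.
have mG : measurable_fun [set: env] (fun z : env => F (shifts L z)).
  exact: (measurableT_comp mF (measurable_shifts L)).
apply/funext => y.
transitivity (Iint [:: (i, i)] (fun w => Iint [seq (l, l) | l <- L]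
    (fun z => F (shifts L z)) (shift i w)) y).
  by apply: eq_integral => r _; exact: Iint_comp_shift.
apply: (Iint_shift1 (c := fun z => off z i)).
- exact: measurable_Iint.
- by move=> w; exact: Iint_ge0.
- by move=> r; rewrite off_upd_diag.
Qed.

(** The change of variables is a product of shears, so it has no Jacobian factor. The diagonal is
    integrated innermost for the substitution, then moved outermost by Tonelli. *)
Theorem Iint_below_Phi (F : env -> \bar R) :
  measurable_fun [set: env] F -> (forall z, 0 <= F z)%E ->
  Iint (below m) F = Iint diagc (Iint freec (fun z => F (Phi z))).
Proof.
move=> mF F0.
have mG : measurable_fun [set: env] (fun z : env => F (Phi z)).
  exact: (measurableT_comp mF measurable_Phi).
transitivity (Iint (freec ++ diagc) (fun z => F (Phi z))); last first.
  rewrite -Iint_cat; apply: Iint_perm => //; by rewrite perm_catC.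
rewrite (Iint_perm mF F0 perm_below) !Iint_cat; congr (Iint _ _).
rewrite -(Iint_shifts (iota_uniq 0 m) mF F0); congr (Iint _ _).
by apply/funext => z; rewrite Phi_shifts.
Qed.

Lemma rsum_Phi z i : rsum (Phi z) i = if (i < m)%N then z (i, i) else rsum z i.
Proof.
rewrite /rsum; case: ifP => im; last first.
  by apply: eq_bigr => j _; rewrite /Phi /= im.
rewrite big_ord_recr /= {2}/Phi /= im eqxx /= /off.
rewrite (eq_bigr (fun j : 'I_i => z (i, nat_of_ord j))); first lra.
by move=> j _; rewrite /Phi /= ltn_eqF // andbF.
Qed.

Lemma Phi_affine (a b : R) (x y : env) :
  Phi (fun t => a * x t + b * y t) = fun t => a * Phi x t + b * Phi y t.
Proof.
apply/funext => t; rewrite /Phi; case: ifP => // _; rewrite /off.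
rewrite (_ : \sum_(j < t.1) (a * x (t.1, nat_of_ord j) + b * y (t.1, nat_of_ord j)) =
  a * (\sum_(j < t.1) x (t.1, nat_of_ord j)) +
  b * (\sum_(j < t.1) y (t.1, nat_of_ord j))); first lra.
by rewrite big_split /= !mulr_sumr.
Qed.

Lemma wtE (x : nat -> R) k (w : env) :
  wt x k w = \sum_(i < k) (x i - x i.+1) * rsum w i + x k * rsum w k.
Proof.
elim: k => [|k IH] /=; first by rewrite big_ord0 add0r.
rewrite IH big_ord_recr /=; lra.
Qed.

End RowSumCoordinates.

(** * The permutohedron *)

Section Permutohedron.
Context (R : realType) (n : nat).

(** Exchange against the initial segment [B] of the same size: the entries over [A :\: B] are at
    most [v], those over [B :\: A] at least [v], and these two sets have equal size. *)
Lemma sum_le_top (l : nat -> R) (A : {set 'I_n}) :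
  (forall i j, (i <= j < n)%N -> l j <= l i) ->
  \sum_(i in A) l i <= \sum_(k < #|A|) l k.
Proof.
move=> dec; have cn : (#|A| <= n)%N by rewrite -[leqRHS]card_ord max_card.
pose B : {set 'I_n} := [set i : 'I_n | (i < #|A|)%N]%SET.
have -> : \sum_(k < #|A|) l k = \sum_(i in B) l i.
  rewrite (big_ord_widen n l cn); apply: eq_bigl => i; by rewrite inE.
have cB : #|B| = #|A|.
  rewrite -sum1_card (eq_bigl (fun i : 'I_n => (i < #|A|)%N)); last first.
    by move=> i; rewrite inE.
  by rewrite -(big_ord_widen n (fun=> 1%N)) // sum1_card card_ord.
pose v := l #|A|.-1.
have lA i : i \in A :\: B -> l i <= v.
  rewrite !inE -leqNgt => /andP[ci _]; apply: dec.
  by rewrite ltn_ord andbT (leq_trans (leq_pred _)).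
have lB i : i \in B :\: A -> v <= l i.
  rewrite !inE => /andP[_ ci]; apply: dec.
  rewrite -ltnS prednK ?(leq_ltn_trans (leq0n _) ci) // ci /=.
  exact: cn.
rewrite (big_setID B) /= [leRHS](big_setID A) /= finset.setIC; apply: lerD => //.
apply: (@le_trans _ _ (\sum_(i in A :\: B) v)); first exact: ler_sum.
apply: (@le_trans _ _ (\sum_(i in B :\: A) v)); last exact: ler_sum.
rewrite !sumr_const (_ : #|A :\: B| = #|B :\: A|) //.
by rewrite !cardsD cB finset.setIC.
Qed.

Variable lam : 'rV[R]_n.
Variable l : nat -> R.
Hypothesis lamE : forall i : 'I_n, lam ord0 i = l i.
Hypothesis dec : forall i j, (i < j < n)%N -> l j < l i.

Let decW i j : (i <= j < n)%N -> l j <= l i.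
Proof.
by move=> /andP[]; rewrite leq_eqVlt => /predU1P[-> //|ij jn]; rewrite ltW ?dec ?ij.
Qed.

Lemma SH_perm (s : {perm 'I_n}) : SH lam (\row_i lam ord0 (s i)).
Proof. by move=> A [_]; apply; exists s. Qed.

(** The vectors satisfying these relations form a convex set that contains all permutations of
    [lam]. *)
Lemma SH_inequalities (x : 'rV[R]_n) : SH lam x ->
  (forall A : {set 'I_n}, \sum_(i in A) x ord0 i <= \sum_(k < #|A|) l k) /\
  \sum_i x ord0 i = \sum_(k < n) l k.
Proof.
move=> /(_ [set x | (forall A : {set 'I_n},
    \sum_(i in A) x ord0 i <= \sum_(k < #|A|) l k) /\
  \sum_i x ord0 i = \sum_(k < n) l k]); apply; split.
- move=> u v t; rewrite !inE => -[u1 u2] [v1 v2].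
  set p := (t%:num : R).
  have p0 : 0 <= p by rewrite /p; exact: interval_inference.ge0.
  have p1 : p <= 1 by rewrite /p; exact: interval_inference.le1.
  have E i : (conv t u v : 'rV[R]_n) ord0 i = p * u ord0 i + (1 - p) * v ord0 i.
    by rewrite /conv /= !mxE.
  split=> [A|]; under eq_bigr do rewrite E; rewrite big_split /= -!mulr_sumr.
    have h1 : p * \sum_(i in A) u ord0 i <= p * \sum_(k < #|A|) l k.
      exact: ler_wpM2l.
    have h2 : (1 - p) * \sum_(i in A) v ord0 i <= (1 - p) * \sum_(k < #|A|) l k.
      by apply: ler_wpM2l => //; rewrite subr_ge0.
    lra.
  by rewrite u2 v2; lra.
- move=> _ [s _ <-]; split=> [A|].
    rewrite (eq_bigr (fun i => l (s i))); last by move=> i _; rewrite mxE lamE.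
    rewrite -(card_imset A (@perm_inj _ s)).
    rewrite -(big_imset (fun i : 'I_n => l i)) /=; last by move=> ? ? _ _; exact: perm_inj.
    exact: sum_le_top.
  rewrite (eq_bigr (fun i => l (s i))); last by move=> i _; rewrite mxE lamE.
  by rewrite [RHS](reindex_inj (@perm_inj _ s)).
Qed.

Lemma affine_hull_shift (x : 'rV[R]_n) (a b : 'I_n) (e : R) : a != b ->
  SH lam x ->
  affine_hull (SH lam) (x + e *: (delta_mx ord0 a - delta_mx ord0 b)).
Proof.
move=> ab Sx A [cA SA].
wlog lt : a b e ab / (a < b)%N.
  move=> h; case: (ltngtP a b) => [|ba|/val_inj /eqP]; last by rewrite (negbTE ab).
    exact: h.
  by have := h b a (- e); rewrite eq_sym ab ba scaleNr -scalerN opprB; exact.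
have d0 : 0 < l a - l b by rewrite subr_gt0 dec // lt ltn_ord.
pose c := e / (l a - l b).
pose w1 : 'rV[R]_n := \row_i lam ord0 ((1 : {perm 'I_n})%g i).
pose w2 : 'rV[R]_n := \row_i lam ord0 ((tperm a b) i).
have Aw1 : A w1 by apply: SA; exact: SH_perm.
have Aw2 : A w2 by apply: SA; exact: SH_perm.
have Ax : A x by exact: SA.
(* The midpoint of this point and the next is [x + c *: (w1 - w2)], and [w1 - w2] is the wanted
   direction times [l a - l b]. *)
have u1 : A ((1 - 2 * c) *: x + (1 - (1 - 2 * c)) *: w1) by exact: cA.
have u2 : A ((1 + 2 * c) *: x + (1 - (1 + 2 * c)) *: w2) by exact: cA.
have := cA _ _ (2^-1) u1 u2; congr A.
apply/rowP => i; rewrite !mxE !lamE perm1 /=.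
have [ia|ia] := eqVneq i a.
  rewrite ia tpermL (negbTE ab) /=.
  have : c * (l a - l b) = e by rewrite /c divfK // gt_eqF.
  by rewrite mulr1n mulr0n; lra.
have [ib|ib] := eqVneq i b.
  rewrite ib tpermR /=.
  have : c * (l a - l b) = e by rewrite /c divfK // gt_eqF.
  by rewrite mulr1n mulr0n; lra.
rewrite tpermD 1?eq_sym //= mulr0n; lra.
Qed.

(** Moving a little mass from an index outside [A] to one inside stays in the affine hull, hence in
    [SH lam], and raises the sum over [A]; that sum was therefore below its bound. *)
Lemma relative_interior_strict (x : 'rV[R]_n) (A : {set 'I_n}) :
  relative_interior (SH lam) x -> A != finset.set0 -> A != [set: 'I_n]%SET ->
  \sum_(i in A) x ord0 i < \sum_(k < #|A|) l k.
Proof.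
move=> [Sx /nbhs_ballP[e /= e0 xe]] /set0Pn[a aA] AT.
have [b bA] : exists b, b \notin A.
  apply/existsP; rewrite -negb_forall; apply: contra AT => /forallP h.
  by apply/eqP/setP => i; rewrite inE h.
have ab : a != b by apply: contraNneq bA => <-.
pose y := x + (e / 2) *: (delta_mx ord0 a - delta_mx ord0 b).
have e20 : 0 < e / 2 by rewrite divr_gt0.
have /SH_inequalities[/(_ A) + _] : SH lam y.
  apply: xe; last exact: affine_hull_shift.
  split => // i j; rewrite (ord1 i) /y /ball /= !mxE.
  rewrite opprD addrA subrr add0r normrN normrM gtr0_norm //.
  apply: (@le_lt_trans _ _ (e / 2 * 1)); last lra.
  apply: ler_wpM2l; first exact: ltW.
  have [->|ja] := eqVneq j a; first by rewrite (negbTE ab) subr0 normr1.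
  have [_|jb] := eqVneq j b; first by rewrite sub0r normrN normr1.
  by rewrite subr0 normr0.
move/(lt_le_trans _); apply.
have -> : \sum_(i in A) y ord0 i = \sum_(i in A) x ord0 i + e / 2.
  rewrite /y (eq_bigr (fun i => x ord0 i + e / 2 * (i == a)%:R)); last first.
    move=> i iA; rewrite !mxE /= (_ : (i == b) = false) ?subr0 //.
    by apply: contraNF bA => /eqP <-.
  rewrite big_split /= -mulr_sumr; congr (_ + _).
  rewrite (bigD1 a) //= eqxx big1 ?addr0 ?mulr1 // => i /andP[_ /negbTE -> //].
by rewrite ltrDl.
Qed.

End Permutohedron.

Section IntegralPermutohedron.
Context (R : realType) (n : nat) (lam : n.-tuple nat) (mu : n.-tuple int).
Hypothesis hlam : forall i j : 'I_n, (i < j)%N -> (tnth lam j < tnth lam i)%N.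

Local Notation lamR := (\row_i (tnth lam i)%:R : 'rV[R]_n).
Local Notation muR := (\row_i (tnth mu i)%:~R : 'rV[R]_n).
Local Notation l := (fun i : nat => (nth 0%N lam i)%:R : R).

Lemma nth_dec i j : (i < j < n)%N -> (nth 0%N lam j < nth 0%N lam i)%N.
Proof.
move=> /andP[ij jn]; have := hlam (i := Ordinal (ltn_trans ij jn)) (j := Ordinal jn) ij.
by rewrite !(tnth_nth 0%N).
Qed.

(** Both sides of the strict inequality are integers, so they differ by at least 1. Integrality of
    [lam] and [mu] enters the slack here. *)
Theorem integral_slack : relative_interior (SH lamR) muR ->
  \sum_i muR ord0 i = \sum_(k < n) l k /\
  forall A : {set 'I_n}, A != finset.set0 -> A != [set: 'I_n]%SET ->
    \sum_(i in A) muR ord0 i + 1 <= \sum_(k < #|A|) l k.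
Proof.
move=> rint.
have lamE (i : 'I_n) : lamR ord0 i = l i by rewrite mxE (tnth_nth 0%N).
have dec i j : (i < j < n)%N -> l j < l i by move=> ij; rewrite ltr_nat nth_dec.
split; first by have [_] := SH_inequalities lamE dec rint.1.
move=> A A0 AT; have := relative_interior_strict lamE dec rint A0 AT.
rewrite (eq_bigr (fun i => (tnth mu i)%:~R)); last by move=> i _; rewrite mxE.
have -> : \sum_(k < #|A|) l k = (\sum_(k < #|A|) (nth 0%N lam k)%:Z)%:~R.
  by rewrite rmorph_sum; apply: eq_bigr.
rewrite -rmorph_sum /= -[X in _ + X]/(1%:~R) -intrD ltr_int ler_int.
by rewrite lezD1.
Qed.

End IntegralPermutohedron.

(** * Gelfand-Tsetlin polytopes *)

Section GTCoordinates.
Context (R : realType) (m : nat).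
Local Notation T := (nat * nat)%type.
Local Notation env := (env R T).
Local Notation n := m.+1.

Definition pos (p : gt_index n) : T := (nat_of_ord (val p).1, nat_of_ord (val p).2).

Lemma pos_inj : injective pos.
Proof.
move=> [[a b] ab] [[c d] cd] [/= e1 e2]; apply: val_inj => /=.
by rewrite (val_inj e1) (val_inj e2).
Qed.

Lemma mem_pos p : pos p \in below n.
Proof. by rewrite mem_below /= ltn_ord (valP p). Qed.

Lemma pos_surj t : t \in below n -> exists p, pos p = t.
Proof.
case: t => i j; rewrite mem_below /= => /andP[im ji].
have jn : (j < n)%N := leq_ltn_trans ji im.
pose q : 'I_n * 'I_n := (Ordinal im, Ordinal jn).
by exists (exist _ q (ji : (q.2 <= q.1)%N)).
Qed.

Lemma perm_pos : perm_eq [seq pos p | p <- enum {: gt_index n}] (below n).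
Proof.
apply: uniq_perm; first by rewrite map_inj_uniq ?enum_uniq //; exact: pos_inj.
  exact: uniq_below.
move=> t; apply/mapP/idP => [[p _ ->]|/pos_surj[p <-]]; first exact: mem_pos.
by exists p; rewrite // mem_enum.
Qed.

Lemma sum_gt (P : pred T) (X : T -> R) :
  \sum_(p : gt_index n | P (pos p)) X (pos p) = \sum_(t <- below n | P t) X t.
Proof. by rewrite -(perm_big _ perm_pos) big_map enumT. Qed.

Lemma sum_rowc (X : T -> R) i : \sum_(t <- rowc i) X t = \sum_(j < i.+1) X (i, nat_of_ord j).
Proof. by rewrite rowcE big_map enumT. Qed.

Definition to_gt (y : env) : gt_index n -> R := fun p => y (pos p).

Definition of_gt (x : gt_index n -> R) : env :=
  fun t => if [pick p | pos p == t] is Some p then x p else 0.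

Lemma of_gtK x : to_gt (of_gt x) = x.
Proof.
apply/funext => p; rewrite /to_gt /of_gt; case: pickP => [q /eqP /pos_inj -> //|].
by move/(_ p); rewrite eqxx.
Qed.

Lemma row_sum_to_gt y i : (i <= m)%N -> row_sum (to_gt y) i.+1 = rsum y i.
Proof.
move=> im; rewrite /row_sum /gt_row.
rewrite (eq_bigl (fun p => (fun t : T => t.1 == i) (pos p))); last first.
  by move=> p; rewrite /= eqSS.
rewrite (sum_gt (fun t => t.1 == i) y) /rsum -sum_rowc -big_filter.
apply: perm_big; apply: uniq_perm.
- exact: filter_uniq (uniq_below n).
- by rewrite map_inj_uniq ?iota_uniq // => a c [].
move=> t; rewrite mem_filter mem_below mem_rowc; case: eqVneq => //= ->.
by rewrite ltnS im.
Qed.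

Lemma row_sum0 (x : gt_index n -> R) : row_sum x 0 = 0.
Proof. by rewrite /row_sum big_pred0. Qed.

Lemma pattP k (y : env) : reflect (forall i j, (j <= i < k)%N ->
  y (i.+1, j.+1) <= y (i, j) <= y (i.+1, j)) (patt k y).
Proof.
apply: (iffP idP); elim: k => [|k IH] //=.
- move=> _ i j; lia.
- move=> /andP[pk ik] i j /andP[ji]; rewrite ltnS leq_eqVlt => /predU1P[ie|ik'].
    by rewrite ie in ji *; exact: inter_bounds.
  by apply: IH => //; rewrite ji.
- move=> h; apply/andP; split.
    by apply: IH => i j /andP[ji ik]; apply: h; rewrite ji leqW.
  by apply/forallP => j; apply: h; rewrite -ltnS ltn_ord ltnSn.
Qed.

Lemma is_gt_pattern_to_gt y : is_gt_pattern (to_gt y) <-> patt m y.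
Proof.
split=> [h|/pattP h p q].
  apply/pattP => i j /andP[ji im].
  have [p pE] : exists p, pos p = (i, j).
    by apply: pos_surj; rewrite mem_below /= ji ltnS ltnW.
  have [q qE] : exists p, pos p = (i.+1, j).
    by apply: pos_surj; rewrite mem_below /= ltnS im leqW.
  have [r rE] : exists p, pos p = (i.+1, j.+1).
    by apply: pos_surj; rewrite mem_below /= !ltnS im ji.
  rewrite -pE -qE -rE -/(to_gt y _) -/(to_gt y _) -/(to_gt y _).
  have [e1 e2] : gt_row p = i.+1 /\ gt_col p = j.+1.
    by move: pE; rewrite /pos /gt_row /gt_col => -[-> ->].
  have [f1 f2] : gt_row q = i.+2 /\ gt_col q = j.+1.
    by move: qE; rewrite /pos /gt_row /gt_col => -[-> ->].
  have [g1 g2] : gt_row r = i.+2 /\ gt_col r = j.+2.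
    by move: rE; rewrite /pos /gt_row /gt_col => -[-> ->].
  have [] := h p q; rewrite ?e1 ?f1 // ?e2 ?f2 => /(_ erefl) -> _.
  by have [] := h p r; rewrite ?e1 ?g1 // ?e2 ?g2 => _ /(_ erefl) ->.
rewrite /gt_row /gt_col /to_gt /pos => -[rE].
have im : ((val p).1 < m)%N by rewrite -ltnS -rE.
have /andP[h1 h2] := h (val p).1 (val p).2 (introT andP (conj (valP p) im)).
by rewrite rE; split=> [[->]|[->]].
Qed.

Variables (lamV muV : 'rV[R]_n).

Lemma coordsE (v : 'rV[R]_n) (i : 'I_n) : coords v i = v ord0 i.
Proof. by rewrite /coords inord_val. Qed.

Definition base : env := fun t =>
  if t.1 == m then coords lamV t.2 else
  if t.2 == t.1 then \sum_(l < t.1.+1) coords muV l else 0.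

(** All but the free coordinates are overwritten, so that [fibre] and [phi] depend on the free
    coordinates only, as the comparison of volumes demands. *)
Definition ins (z : env) : env := fun t => if t \in freec m then z t else base t.

Definition phi (z : env) : gt_index n -> R := to_gt (Phi m (ins z)).

Definition topped (y : env) : bool := [forall j : 'I_n, y (m, nat_of_ord j) == lamV ord0 j].

Definition feasible (y : env) : bool := patt m (Phi m y) && topped y.

Definition fibre : set env := [set z | feasible (ins z)].

Lemma Phi_insE z i j : (j <= i <= m)%N -> Phi m (ins z) (i, j) =
  if (j < i < m)%N then z (i, j) else
  if (i < m)%N then base (i, i) - \sum_(l < i) z (i, nat_of_ord l) else base (m, j).
Proof.
move=> /andP[ji im]; rewrite /Phi /= /ins !mem_freec /=.
case: (ltnP i m) => im'; rewrite ?andbT ?andbF /=; last first.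
  by have -> : i = m by apply/eqP; rewrite eqn_leq im.
case: (ltngtP j i) ji => //= -> _.
congr (_ + - _); apply: eq_bigr => l _.
by rewrite mem_freec /= ltn_ord im'.
Qed.

Lemma base_top j : (j <= m)%N -> base (m, j) = coords lamV j.
Proof. by rewrite /base /= eqxx. Qed.

Lemma base_diag i : (i < m)%N -> base (i, i) = \sum_(l < i.+1) coords muV l.
Proof. by move=> im; rewrite /base /= ltn_eqF // eqxx. Qed.

Lemma topped_ins z : topped (ins z).
Proof.
apply/forallP => j; have jm : (j <= m)%N by rewrite -ltnS.
by rewrite /ins mem_freec /= ltnn andbF base_top // coordsE.
Qed.

Lemma ins_id y : (forall t, t \notin freec m -> y t = base t) -> ins y = y.
Proof. by move=> yb; apply/funext => t; rewrite /ins; case: ifPn => // /yb. Qed.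

Hypothesis tot : \sum_i muV ord0 i = \sum_i lamV ord0 i.

Lemma sum_coords (v : 'rV[R]_n) : \sum_(l < n) coords v l = \sum_i v ord0 i.
Proof. by apply: eq_bigr => i _; rewrite coordsE. Qed.

(** The conditions on differences of row sums amount to prescribed partial sums. Below the top row
    these fix the diagonal coordinates; for the top row the condition is [tot]. *)
Lemma GT_fibre : GT lamV muV = phi @` fibre.
Proof.
apply/seteqP; split=> [x [gx xlam xmu]|_ [z Kz <-]].
  pose y := of_gt x; have xy : x = to_gt y by rewrite of_gtK.
  have ry i : (i <= m)%N -> rsum y i = \sum_(l < i.+1) coords muV l.
    elim: i => [|i IH] im; rewrite -row_sum_to_gt // -xy.
      have := xmu ord0; rewrite row_sum0 subr0 => ->.
      by rewrite big_ord1; exact: (esym (coordsE muV ord0)).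
    have im' : (i.+1 < n)%N by [].
    have := xmu (Ordinal im'); rewrite /= => e.
    rewrite big_ord_recr /= -IH 1?ltnW // -row_sum_to_gt 1?ltnW // -xy.
    have cE : coords muV i.+1 = muV ord0 (Ordinal im') := coordsE muV (Ordinal im').
    by rewrite cE -e; lra.
  have ytop j : (j <= m)%N -> y (m, j) = coords lamV j.
    move=> jm; have [p pE] : exists p, pos p = (m, j).
      by apply: pos_surj; rewrite mem_below /= ltnSn.
    have := xlam p; rewrite xy /to_gt pE /gt_row; move: pE => [e1 e2].
    by rewrite e1 -e2 coordsE => ->.
  have Py i j : (j <= i <= m)%N -> Phi m (ins y) (i, j) = y (i, j).
    move=> /[dup] /andP[ji im] jim; rewrite Phi_insE //.
    case: (ltnP i m) => im'; rewrite ?andbT ?andbF.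
      case: (ltngtP j i) ji => // [-> _].
      rewrite base_diag // -ry // /rsum big_ord_recr /=; lra.
    have -> : i = m by apply/eqP; rewrite eqn_leq im.
    by rewrite base_top ?ytop //; exact: leq_trans ji im.
  exists y.
    rewrite /fibre /= /feasible topped_ins andbT (patt_ext (w := y)) //.
    by rewrite -is_gt_pattern_to_gt -xy.
  rewrite xy; apply/funext => p; rewrite /phi /to_gt.
  case E : (pos p) (mem_pos p) => [i j]; rewrite mem_below /= => /andP[im ji].
  by rewrite Py // ji -ltnS.
have /andP[pz _] := Kz.
have rs i : (i <= m)%N -> rsum (Phi m (ins z)) i = \sum_(l < i.+1) coords muV l.
  rewrite leq_eqVlt rsum_Phi => /predU1P[->|im]; last first.
    by rewrite im /ins mem_freec /= ltnn base_diag.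
  rewrite ltnn sum_coords tot -sum_coords; apply: eq_bigr => j _.
  by rewrite /ins mem_freec /= ltnn andbF base_top // -ltnS.
split.
- by apply/is_gt_pattern_to_gt.
- move=> p; rewrite /gt_row => -[pm]; rewrite /phi /to_gt /pos pm.
  have jm : ((val p).2 <= m)%N by rewrite -ltnS ltn_ord.
  by rewrite Phi_insE ?jm ?leqnn // ltnn andbF base_top // coordsE.
- move=> i; have im0 : (i <= m)%N by rewrite -ltnS.
  rewrite row_sum_to_gt // rs //.
  case: i im0 => [[|i] im] /= im0.
    by rewrite row_sum0 subr0 big_ord1; exact: (coordsE muV (Ordinal im)).
  rewrite row_sum_to_gt 1?ltnW // rs 1?ltnW // big_ord_recr /= addrAC subrr add0r.
  exact: (coordsE muV (Ordinal im)).
Qed.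

Lemma size_freec : size (freec m) = (m * m.-1 %/ 2)%N.
Proof.
rewrite divn2 -bin2; elim: (m) => [|k IH] //.
rewrite binS bin1 -IH /freec belowS filter_cat size_cat addnC; congr addn.
rewrite size_filter /rowc count_map -[k.+1]addn1 iotaD count_cat.
rewrite [X in (_ + X)%N](_ : _ = 0%N) ?addn0; last by rewrite /= ltnn.
rewrite -[RHS](size_iota 0); apply/eqP; rewrite -all_count.
by apply/allP => i; rewrite mem_iota.
Qed.

End GTCoordinates.

Lemma fin_subadditive (R : realType) (X : Type) (eta : set X -> \bar R) (I : finType)
    (A : I -> set X) (B : set X) (c : R) :
  (forall A B, A `<=` B -> (eta A <= eta B)%E) -> (forall A, 0 <= eta A)%E ->
  eta set0 = 0%E -> sigma_subadditive eta -> (forall x, B x -> exists i, A i x) ->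
  (forall i, eta (A i) <= c%:E)%E -> (eta B <= (#|I|%:R * c)%:E)%E.
Proof.
move=> le ge0 e0 sub BA Ac.
pose F (k : nat) : set X := if insub k is Some o then A (enum_val (o : 'I_#|I|)) else set0.
apply: (@le_trans _ _ (eta (\bigcup_k F k))).
  apply: le => x /BA[i Aix]; exists (enum_rank i) => //.
  by rewrite /F valK enum_rankK.
apply: le_trans (sub F) _.
rewrite (nneseries_split 0 #|I|) // add0n eseries0 ?adde0; last first.
  by move=> k Ik _; rewrite /F insubN // -leqNgt.
apply: (@le_trans _ _ (\sum_(0 <= k < #|I|) c%:E)%E); last first.
  by rewrite sumEFin sumr_const_nat subn0 mulr_natl.
rewrite !big_mkord; apply: lee_sum => k _; rewrite /F valK; exact: Ac.
Qed.

(** * Volume of the polytope against volume of the fibre *)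

Section GTVolume.
Context (R : realType) (k : nat).
Local Notation T := (nat * nat)%type.
Local Notation env := (env R T).
Local Notation m := k.+1.
Local Notation n := m.+1.
Variables (lamV muV : 'rV[R]_n).
Local Notation base := (base lamV muV).
Local Notation phi := (phi lamV muV).
Local Notation fibre := (fibre lamV muV).
Local Notation ts := (freec m).
Local Notation D := (size (freec m)).

Lemma sum_freec (X : T -> R) l :
  \sum_(t <- freec l) X t = \sum_(i < l) \sum_(j < i) X (nat_of_ord i, nat_of_ord j).
Proof.
elim: l => [|l IH]; first by rewrite big_ord0 /freec big_nil.
rewrite big_ord_recr /= -IH /freec belowS filter_cat big_cat [LHS]addrC; congr (_ + _).
rewrite big_filter /rowc big_map -[l.+1]addn1 iotaD big_cat /= add0n.
rewrite [X in _ + X](_ : _ = 0) ?addr0; last by rewrite big_cons big_nil ltnn.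
rewrite big_seq_cond (eq_bigl (fun j => j \in iota 0 l)); last first.
  by move=> j; rewrite mem_iota /=; case: ltnP => //; rewrite ?andbF.
by rewrite -big_seq -(big_mkord xpredT (fun j => X (l, j))) /index_iota subn0.
Qed.

Definition phiT (z : env) (t : T) : R :=
  if (t.2 < t.1 < m)%N then z t else
  if (t.1 < m)%N then base (t.1, t.1) - \sum_(l < t.1) z (t.1, nat_of_ord l)
  else base (m, t.2).

Lemma phi_phiT z p : phi z p = phiT z (pos p).
Proof.
rewrite /phi /to_gt; case E : (pos p) (mem_pos p) => [i j].
rewrite mem_below /= => /andP[im ji]; rewrite Phi_insE //.
by rewrite ji -ltnS.
Qed.

(** The top row is constant and each diagonal entry is a constant minus the sum of the free entries
    of its row. *)
Lemma dist_phi x y : \sum_p (phi x p - phi y p) ^+ 2 =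
  \sum_(t <- ts) (x t - y t) ^+ 2 +
  \sum_(i < m) (\sum_(l < i) (x (nat_of_ord i, nat_of_ord l) - y (nat_of_ord i, nat_of_ord l))) ^+ 2.
Proof.
rewrite (eq_bigr (fun p => (fun t => (phiT x t - phiT y t) ^+ 2) (pos p))); last first.
  by move=> p _; rewrite !phi_phiT.
rewrite (sum_gt m xpredT (fun t => (phiT x t - phiT y t) ^+ 2)) belowS big_cat /=.
rewrite [X in X + _]big1_seq ?add0r; last first.
  move=> t /andP[_]; rewrite mem_rowc => /andP[/eqP tm _].
  by rewrite /phiT tm ltnn andbF subrr expr0n.
rewrite (perm_big _ (perm_below m)) big_cat /=; congr (_ + _).
  apply: eq_big_seq => t; rewrite mem_freec => tf.
  by rewrite /phiT tf.
rewrite /diagc big_map -[iota 0 m]/(index_iota 0 m) big_mkord.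
apply: eq_bigr => i _; rewrite /phiT /= ltnn ltn_ord /= sumrB -sqrrN.
by congr (_ ^+ 2); lra.
Qed.

Lemma phi_affine (a : R) (z x y : env) : 0 < a ->
  euclid_dist (phi (fun t => a * x t + z t)) (phi (fun t => a * y t + z t))
    <= a * euclid_dist (phi x) (phi y).
Proof.
move=> a0; rewrite /euclid_dist -[X in X * _](gtr0_norm a0) -sqrtr_sqr -sqrtrM ?sqr_ge0 //.
apply: eq_ler; congr Num.sqrt; rewrite !dist_phi mulrDr !mulr_sumr.
congr (_ + _); apply: eq_bigr => i _; rewrite -exprMn; congr (_ ^+ 2); first lra.
by rewrite mulr_sumr; apply: eq_bigr => j _; lra.
Qed.

Lemma dist_restr (x y : env) :
  \sum_i (restr (ts := ts) x i - restr (ts := ts) y i) ^+ 2 =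
  \sum_(t <- ts) (x t - y t) ^+ 2.
Proof. by rewrite [RHS]big_tnth. Qed.

Lemma restr_le_phi (x y : env) :
  euclid_dist (restr (ts := ts) x) (restr (ts := ts) y) <= euclid_dist (phi x) (phi y).
Proof.
rewrite /euclid_dist dist_restr dist_phi ler_sqrt ?lerDl.
  by apply: sumr_ge0 => i _; exact: sqr_ge0.
by rewrite addr_ge0 //; apply: sumr_ge0 => i _; exact: sqr_ge0.
Qed.

(* A linear map of the free coordinates that stretches distances at least as
   much as [phi] does. *)
Definition stretch (x : env) : env :=
  fun t => x t + 2^-1 * \sum_(l < t.1) x (t.1, nat_of_ord l).

(** In a row with differences [d j] of sum [S], the squares of [d j + S / 2] add up to those of
    [d j], plus [S ^+ 2] from the cross terms, plus a nonnegative rest. The factor [2^-1] in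
    [stretch] is chosen so that the cross terms give exactly the diagonal contribution. *)
Lemma phi_le_stretch (x y : env) :
  euclid_dist (phi x) (phi y) <=
  euclid_dist (restr (ts := ts) (stretch x)) (restr (ts := ts) (stretch y)).
Proof.
rewrite /euclid_dist dist_restr dist_phi ler_sqrt; last first.
  by apply: sumr_ge0 => i _; exact: sqr_ge0.
rewrite !sum_freec -big_split /=; apply: ler_sum => i _.
pose d (j : 'I_i) := x (nat_of_ord i, nat_of_ord j) - y (nat_of_ord i, nat_of_ord j).
pose S := \sum_j d j.
rewrite (eq_bigr (fun j => d j ^+ 2)) // -/S.
rewrite [leRHS](eq_bigr (fun j => d j ^+ 2 + (d j * S + 4^-1 * S ^+ 2))); last first.
  move=> j _; rewrite /stretch /=.
  have -> : S = \sum_(l < i) x (nat_of_ord i, nat_of_ord l) -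
      \sum_(l < i) y (nat_of_ord i, nat_of_ord l) by rewrite /S sumrB.
  by rewrite /d; lra.
rewrite !big_split /= -mulr_suml sumr_const -/S lerD2l -expr2 lerDl.
by rewrite mulrn_wge0 // mulr_ge0 // sqr_ge0.
Qed.

(* The integer parts of [n / 2] times the [m] row sums split the image of the
   unit cube into [(n k)^m] pieces; on each, [phi_le_stretch] compares with a cube
   of side [1 + 1/n]. *)
Definition kappa : R :=
  ((n * k) ^ m)%:R * (1 + n%:R^-1) ^+ D.

Lemma kappa_ge0 : 0 <= kappa.
Proof. by rewrite mulr_ge0 // exprn_ge0 // addr_ge0. Qed.

Lemma hausdorff_phi_cube : (0 < k)%N ->
  (hausdorff_raw D (phi @` half_open_cube ts) <= (kappa * cubeH R D)%:E)%E.
Proof.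
move=> k0.
pose q := (n * k)%N.
have n0 : 0 < n%:R :> R by rewrite ltr0n.
have L0 : 0 < 1 + n%:R^-1 :> R by rewrite addr_gt0 // invr_gt0.
pose S (x : env) i := \sum_(l < i) x (i, nat_of_ord l).
pose A (v : {ffun 'I_m -> 'I_q}) : set env := half_open_cube ts `&`
  [set x | forall i : 'I_m, Num.floor (n%:R * (2^-1 * S x i)) = (v i : nat)%:Z].
have [le ge0 e0] := outer_measure_image (R := R) D phi.
have -> : kappa * cubeH R D =
    #|{ffun 'I_m -> 'I_q}|%:R * ((1 + n%:R^-1) ^+ D * cubeH R D).
  by rewrite card_ffun !card_ord /kappa mulrA.
apply: (fin_subadditive (A := A) le ge0 e0) => [|x Qx|v].
- exact: image_sigma_subadditive.
- have /half_open_cubeP Qx' := Qx.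
  have S01 (i : 'I_m) : 0 <= S x i <= k%:R.
    have xi (l : 'I_i) : 0 <= x (nat_of_ord i, nat_of_ord l) <= 1.
      have il : (nat_of_ord i, nat_of_ord l) \in ts by rewrite mem_freec /= !ltn_ord.
      by have /andP[-> /ltW ->] := Qx' _ il.
    apply/andP; split; first by apply: sumr_ge0 => l _; have /andP[] := xi l.
    apply: (@le_trans _ _ (\sum_(l < i) 1)).
      by apply: ler_sum => l _; have /andP[] := xi l.
    by rewrite sumr_const card_ord ler_nat -ltnS.
  (* A row has at most [k] free entries, so half its sum is at most [k / 2], and the floor stays
     below [n * k]. *)
  have fl (i : 'I_m) : exists o : 'I_q,
      Num.floor (n%:R * (2^-1 * S x i)) == (o : nat)%:Z.
    have /andP[s0 s1] := S01 i.
    have f0 : (0 <= Num.floor (n%:R * (2^-1 * S x i)))%R.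
      by rewrite floor_ge0 !mulr_ge0.
    have lt : (`|Num.floor (n%:R * (2^-1 * S x i))| < q)%N.
      rewrite -ltz_nat gez0_abs // floor_lt_int -pmulrn /q natrM ltr_pM2l //.
      have : 0 < k%:R :> R by rewrite ltr0n.
      lra.
    by exists (Ordinal lt); rewrite /= gez0_abs.
  exists [ffun i => xchoose (fl i)]; split => // i; rewrite ffunE.
  by apply/eqP; exact: (xchooseP (fl i)).
- apply: (@le_trans _ _ (hausdorff_raw D ((fun x => restr (ts := ts) (stretch x)) @` A v))).
    by apply: hausdorff_raw_isometry => a b _ _; exact: phi_le_stretch.
  pose row (i : 'I_D) : 'I_m := inord (tnth (in_tuple ts) i).1.
  (* On this piece half the row sum lies within [1 / n] above [v / n], and the entry itself in [[0,
     1[]; their sum ranges over an interval of length [1 + 1 / n] starting at [v / n]. *)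
  pose g (w : 'I_D -> R) (i : 'I_D) := (1 + n%:R^-1) * w i + (v (row i))%:R / n%:R.
  rewrite EFinM -(cubeHE R D).
  have -> : half_open_cube (enum {: 'I_D}) = id @` half_open_cube (R := R) (enum {: 'I_D}) by rewrite image_id.
  apply: le_trans (hausdorff_raw_lipschitz (g := g) (h := id) D L0 _); last first.
    by move=> a b _ _; rewrite (euclid_dist_affine _ _ _ (ltW L0)).
  apply: hausdorff_raw_le => _ [x [/half_open_cubeP Qx Ax] <-].
  have tm i : (tnth (in_tuple ts) i) \in ts by exact: mem_tnth.
  exists (fun i => (stretch x (tnth (in_tuple ts) i) - (v (row i))%:R / n%:R) / (1 + n%:R^-1)).
    apply/half_open_cubeP => i _; have ti := tm i.
    have /andP[x0 x1] := Qx _ ti.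
    move: ti; rewrite mem_freec => /andP[_ im].
    have := Ax (row i); rewrite /row inordK // => fE.
    have := floor_itv (n%:R * (2^-1 * S x (tnth (in_tuple ts) i).1)).
    rewrite fE /= intrD /= -/(row i) => /andP[h1 h2].
    rewrite divr_ge0 ?(ltW L0) ?ltr_pdivrMr // /stretch -/(S x _); last first.
      rewrite subr_ge0 ler_pdivrMr // mulrC mulrDr.
      by apply: le_trans h1 _; rewrite lerDr mulr_ge0.
    have h3 : 2^-1 * S x (tnth (in_tuple ts) i).1 < (v (row i))%:R / n%:R + n%:R^-1.
      by rewrite -[X in _ + X]mul1r -mulrDl ltr_pdivlMr // mulrC.
    clear -x1 h3; move: x1 h3; rewrite /= mul1r.
    move: (2^-1 * _) (_ / n%:R) (x _) => a b c; move: (n%:R^-1) => d; lra.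
  apply/funext => i; rewrite /g mulrC divfK ?gt_eqF // subrK //.
Qed.

Let B : R := `|base (m, 0%N)| + `|base (m, m)|.

Lemma fibre_entries z i j : fibre z -> (j <= i <= m)%N ->
  `|Phi m (ins lamV muV z) (i, j)| <= B.
Proof.
rewrite /fibre /= /feasible => /andP[pz _] ij.
have /andP[] := patt_bounds pz ij.
rewrite !Phi_insE ?leqnn // !ltnn !andbF /= => h1 h2; rewrite ler_norml /B.
have := ler_norm (base (m, 0%N)); have := ler_norm (- base (m, m)).
have := normr_ge0 (base (m, 0%N)); have := normr_ge0 (base (m, m)).
by rewrite normrN => *; apply/andP; split; lra.
Qed.

Lemma fibre_bounded : exists M, forall z, fibre z -> forall t, t \in ts ->
  `|z t| < 2 ^+ M.
Proof.
exists (Num.truncn B).+1 => z Kz t; rewrite mem_freec => tf.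
have := fibre_entries (i := t.1) (j := t.2) Kz.
move: (tf) => /andP[t12 t1m]; rewrite (ltnW t12) (ltnW t1m) => /(_ isT).
rewrite Phi_insE ?(ltnW t12) ?(ltnW t1m) // tf -surjective_pairing.
move/le_lt_trans; apply.
apply: (@lt_le_trans _ _ (Num.truncn B).+1%:R); first exact: truncnS_gt.
by rewrite -natrX ler_nat ltnW // ltn_expl.
Qed.

(** An error [e] in the free coordinates changes each entry of the array by at most [n%:R * e], so
    the weak inequalities pass to the limit. *)
Lemma fibre_closed (x : env) : (forall e : R, 0 < e ->
  exists2 y, fibre y & forall t, t \in ts -> `|x t - y t| <= e) -> fibre x.
Proof.
move=> xP; rewrite /fibre /= /feasible topped_ins andbT; apply/pattP => i j ji.
have close (e : R) : 0 < e -> exists2 y, fibre y & forall i j, (j <= i <= m)%N ->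
    `|Phi m (ins lamV muV x) (i, j) - Phi m (ins lamV muV y) (i, j)| <= n%:R * e.
  move=> e0; have [y Ky xy] := xP e e0; exists y => // a b /[dup] ab /andP[ba am].
  rewrite !Phi_insE //; case: ifPn => [/andP[b1 b2]|_].
    apply: le_trans (xy (a, b) _) _; first by rewrite mem_freec /= b1.
    by rewrite ler_peMl ?(ltW e0) // ler1n.
  case: ifPn => a1; last by rewrite subrr normr0 mulr_ge0 // ltW.
  rewrite (_ : _ - _ = \sum_(l < a) (y (a, nat_of_ord l) - x (a, nat_of_ord l))); last first.
    by rewrite sumrB; lra.
  apply: le_trans (ler_norm_sum _ _ _) _.
  apply: (@le_trans _ _ (\sum_(l < a) e)).
    apply: ler_sum => l _; rewrite distrC; apply: xy.
    by rewrite mem_freec /= ltn_ord a1.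
  rewrite sumr_const card_ord -[e *+ a]mulr_natl ler_wpM2r ?(ltW e0) // ler_nat.
  by rewrite leqW // ltnW.
have /andP[ji1 im1] := ji.
have Pj : (j <= i <= m)%N by rewrite ji1 ltnW.
have Pj1 : (j <= i.+1 <= m)%N by rewrite im1 leqW.
have Pj2 : (j.+1 <= i.+1 <= m)%N by rewrite im1 ltnS ji1.
have n0 : 0 < n%:R :> R by rewrite ltr0n.
have lim (a b : R) : (forall e, 0 < e -> a <= b + 2 * (n%:R * e)) -> a <= b.
  move=> h; apply/ler_addgt0Pl => e e0.
  have n2 : 0 < 2 * n%:R :> R by rewrite mulr_gt0.
  have := h (e / (2 * n%:R)) (divr_gt0 e0 n2).
  have -> : 2 * (n%:R * (e / (2 * n%:R))) = e.
    by rewrite mulrA mulrC divfK // gt_eqF // mulr_gt0.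
  by rewrite addrC.
apply/andP; split; apply: lim => e e0; have [y Ky xy] := close e e0;
  have /andP[/pattP/(_ i j ji)/andP[p1 p2] _] := Ky;
  have := xy _ _ Pj; have := xy _ _ Pj1; have := xy _ _ Pj2;
  by rewrite !ler_norml => /andP[? ?] /andP[? ?] /andP[? ?]; lra.
Qed.

Hypothesis tot : \sum_i muV ord0 i = \sum_i lamV ord0 i.

Theorem GT_vol_bounds : (0 < k)%N ->
  (Leb ts base fibre <= GT_vol lamV muV <= kappa%:E * Leb ts base fibre)%E.
Proof.
move=> k0; have [M KM] := fibre_bounded.
have -> : GT_vol lamV muV = hausdorff D (phi @` fibre).
  rewrite /GT_vol -GT_fibre //; congr (hausdorff _ _); rewrite size_freec.
    by congr (_ %/ _)%N; lia.
apply/andP; split.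
  exact: (Leb_le_hausdorff base (uniq_freec m) KM fibre_closed restr_le_phi).
apply: (hausdorff_le_Leb base (uniq_freec m) KM fibre_closed phi_affine kappa_ge0).
exact: hausdorff_phi_cube.
Qed.

End GTVolume.

(** * Bounds on the infimum *)

Section WeightFibres.
Context (R : realType) (m : nat).
Local Notation T := (nat * nat)%type.
Local Notation env := (env R T).
Local Notation n := m.+1.
Variables (lamV muV : 'rV[R]_n).
Local Notation b := (base lamV muV).
Local Notation l := (coords lamV).

Hypothesis m_gt0 : (0 < m)%N.
Hypothesis l_gap : forall j, (j < m)%N -> l j.+1 + 1 <= l j.
Hypothesis l_ge0 : 0 <= l m.
Hypothesis tot : \sum_i muV ord0 i = \sum_i lamV ord0 i.
Hypothesis slack : forall A : {set 'I_n}, A != finset.set0 -> A != [set: 'I_n]%SET ->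
  \sum_(i in A) muV ord0 i + 1 <= \sum_(j < #|A|) l j.

Let n_gt0 : 0 < n%:R :> R. Proof. by rewrite ltr0n. Qed.

Definition interp (th : R) (x y : env) : env := fun t => (1 - th) * x t + th * y t.

Lemma toppedP (y : env) : reflect (forall j, (j <= m)%N -> y (m, j) = l j) (topped lamV y).
Proof.
apply: (iffP forallP) => [h j jm|h j].
  by have /eqP := h (Ordinal (jm : (j < n)%N)); rewrite /= -coordsE => ->.
by rewrite h ?coordsE // -ltnS.
Qed.

Lemma feasible_interp th x y : 0 <= th <= 1 -> feasible lamV x -> feasible lamV y ->
  feasible lamV (interp th x y).
Proof.
move=> /andP[t0 t1] /andP[/pattP px /toppedP tx] /andP[/pattP py /toppedP ty].
have t1' : 0 <= 1 - th by rewrite subr_ge0.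
apply/andP; split; last by apply/toppedP => j jm; rewrite /interp tx // ty //; lra.
apply/pattP => i j ij; rewrite /interp Phi_affine.
have /andP[p1 p2] := px i j ij; have /andP[q1 q2] := py i j ij.
have := ler_wpM2l t1' p1; have := ler_wpM2l t1' p2.
have := ler_wpM2l t0 q1; have := ler_wpM2l t0 q2.
by move=> *; apply/andP; split; lra.
Qed.

Lemma feasible_entries y i j : feasible lamV y -> (j <= i <= m)%N ->
  0 <= Phi m y (i, j) <= l 0%N.
Proof.
move=> /andP[py /toppedP ty] ij; have /andP[] := patt_bounds py ij.
rewrite /Phi /= !ltnn /= !ty // => h1 h2.
by rewrite h2 andbT; apply: le_trans h1.
Qed.

Lemma feasible_free y t : feasible lamV y -> t \in freec m -> 0 <= y t <= l 0%N.
Proof.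
rewrite mem_freec => fy /andP[t21 t1m].
have := feasible_entries (i := t.1) (j := t.2) fy.
by rewrite (ltnW t21) (ltnW t1m) /Phi /= (ltn_eqF t21) andbF -surjective_pairing; apply.
Qed.

Lemma feasible_diag y i : feasible lamV y -> (i < m)%N -> 0 <= y (i, i) <= n%:R * l 0%N.
Proof.
move=> fy im; have := rsum_Phi m y i; rewrite im => <-; rewrite /rsum.
have E (j : 'I_i.+1) : 0 <= Phi m y (i, nat_of_ord j) <= l 0%N.
  by apply: feasible_entries => //; rewrite -ltnS ltn_ord ltnW.
apply/andP; split; first by apply: sumr_ge0 => j _; have /andP[] := E j.
apply: (@le_trans _ _ (\sum_(j < i.+1) l 0%N)).
  by apply: ler_sum => j _; have /andP[] := E j.
rewrite sumr_const card_ord -[_ *+ _]mulr_natl ler_wpM2r ?ler_nat 1?ltnW //.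
by have /andP[h1 h2] := E ord0; apply: le_trans h1 h2.
Qed.

Lemma measurable_feasible : measurable [set y : env | feasible lamV y].
Proof.
rewrite (_ : [set y | _] = (Phi m @^-1` [set z | patt m z]) `&`
  \bigcap_(j in [set: 'I_n]) [set y : env | y (m, nat_of_ord j) = lamV ord0 j]).
  apply: measurableI.
    rewrite -[X in measurable X]setTI; apply: measurable_Phi => //.
    exact: measurable_patt.
  apply: fin_bigcap_measurable; first exact: finite_finset.
  move=> j _; rewrite -[X in measurable X]setTI.
  exact: (measurable_coord (R := R) (m, nat_of_ord j) measurableT
    (measurable_set1 (lamV ord0 j))).
apply/seteqP; split=> y /=.
  by move=> /andP[py /forallP ty]; split=> // j _; exact/eqP/ty.
by move=> [py ty]; apply/andP; split=> //; apply/forallP => j; apply/eqP/ty.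
Qed.

Definition feas1 (y : env) : \bar R := (\1_[set y : env | feasible lamV y] y)%:E.

(** The slice volume [f]: it depends on its argument only through the diagonal coordinates, which
    are the row sums, and the top row. *)
Definition fvol : env -> \bar R := Iint (freec m) feas1.

Lemma feas1E y : feas1 y = (feasible lamV y)%:R%:E.
Proof.
rewrite /feas1 indicE; congr (nat_of_bool _)%:R%:E.
by case fy : (feasible lamV y); [exact: mem_set|apply: memNset; rewrite /= fy].
Qed.

Lemma feas1_ge0 y : (0 <= feas1 y)%E.
Proof. by rewrite feas1E lee_fin. Qed.

Lemma measurable_feas1 : measurable_fun [set: env] feas1.
Proof. exact: measurable_indicE measurable_feasible. Qed.

Lemma logconcave_feas1 : logconcave feas1.
Proof.
move=> x y u v th th01; rewrite !feas1E !lee_fin.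
case fx : (feasible lamV x); last by rewrite leNgt expR_gt0.
case fy : (feasible lamV y); last by move=> _; rewrite leNgt expR_gt0.
have le1 (r : R) : (expR r <= 1) = (r <= 0) by rewrite -[X in _ <= X]expR0 ler_expR.
rewrite (feasible_interp th01 fx fy) /= !le1 => u0 v0.
have /andP[t0 t1] := th01.
have : (1 - th) * u <= 0 by rewrite mulr_ge0_le0 // subr_ge0.
have : th * v <= 0 by rewrite mulr_ge0_le0.
lra.
Qed.

Lemma top_ge : m%:R <= l 0%N.
Proof.
suff h j : (j <= m)%N -> j%:R <= l (m - j)%N by have := h m (leqnn m); rewrite subnn.
elim: j => [|j IH] jm; first by rewrite subn0.
have h : (m - j.+1 < m)%N by rewrite ltn_subrL.
by have := l_gap h; rewrite subnSK // -natr1; have := IH (ltnW jm); lra.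
Qed.

Lemma l0_ge1 : 1 <= l 0%N.
Proof. by apply: le_trans top_ge; rewrite ler1n. Qed.

Lemma fvol_ge0 y : (0 <= fvol y)%E.
Proof. by apply: Iint_ge0; exact: feas1_ge0. Qed.

Lemma feas1_le1 y : (feas1 y <= 1%:E)%E.
Proof. by rewrite feas1E lee_fin; case: feasible. Qed.

Lemma feas1_support y t : t \in freec m -> l 0%N < `|y t| -> feas1 y = 0%E.
Proof.
move=> tf; rewrite feas1E; case fy : feasible => //.
have /andP[h1 h2] := feasible_free fy tf.
by rewrite ger0_norm // ltNge h2.
Qed.

Let l0_ge0 : 0 <= l 0%N := le_trans ler01 l0_ge1.

Lemma logconcave_fvol : logconcave fvol.
Proof.
exact: (logconcave_Iint (uniq_freec m) ler01 l0_ge0 logconcave_feas1 measurable_feas1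
  feas1_ge0 feas1_le1 (fun x t => @feas1_support x t)).
Qed.

Lemma fvol_fin y : fvol y \is a fin_num.
Proof.
rewrite ge0_fin_numE ?fvol_ge0 //.
apply: le_lt_trans (Iint_bounded (uniq_freec m) ler01 l0_ge0 measurable_feas1
  feas1_ge0 feas1_le1 (fun x t => @feas1_support x t) y) _.
exact: ltry.
Qed.

Lemma measurable_fvol : measurable_fun [set: env] fvol.
Proof. by apply: measurable_Iint; [exact: measurable_feas1|exact: feas1_ge0]. Qed.

Lemma fvol_fibre : fvol b = Leb (freec m) b (fibre lamV muV).
Proof.
apply: Iint_ext => y yb; rewrite feas1E indicE /fibre.
have E : fibre lamV muV y = feasible lamV y by rewrite /fibre /= ins_id.
congr (nat_of_bool _)%:R%:E; rewrite -/(fibre lamV muV).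
by case fy : (feasible lamV y); [rewrite mem_set // E|rewrite memNset // E fy].
Qed.

(** By convexity the fibre over the interpolated point contains the fibre over [x] contracted
    towards [z] with ratio [1 - th]. A single feasible [z] is enough, even if its own fibre has
    volume 0. *)
Lemma fvol_interp z th x : 0 <= th < 1 -> feasible lamV z ->
  (((1 - th) ^+ size (freec m))%:E * fvol x <= fvol (interp th x z))%E.
Proof.
move=> /andP[t0 t1] fz; apply: Iint_affine_le => //.
- by rewrite subr_gt0.
- exact: measurable_feas1.
- exact: feas1_ge0.
- exact: measurable_feas1.
- exact: feas1_ge0.
move=> y; rewrite !feas1E lee_fin ler_nat; case fy : feasible => //.
by rewrite -/(interp th y z) feasible_interp // t0 ltW.
Qed.

Lemma fvol_agree x y : (forall t, t \notin freec m -> x t = y t) -> fvol x = fvol y.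
Proof. exact: Iint_agree. Qed.

(** A right inverse of [Phi] on arrays with top row [lam]: the diagonal entries become row sums
    again. *)
Definition inner (w : env) : env := fun t =>
  if t \in freec m ++ diagc m then (if t.2 == t.1 then rsum w t.1 else w t) else b t.

Lemma Phi_inner w i j : (forall j, (j <= m)%N -> w (m, j) = l j) ->
  (j <= i <= m)%N -> Phi m (inner w) (i, j) = w (i, j).
Proof.
move=> tw /andP[ji im].
have offw : (i < m)%N -> off (inner w) i = - \sum_(l < i) w (i, nat_of_ord l).
  move=> im'; rewrite /off; congr (- _); apply: eq_bigr => q _.
  by rewrite /inner mem_cat mem_freec /= ltn_ord im' /= ltn_eqF.
rewrite /Phi /=; case: (ltnP i m) => im' /=; last first.
  have -> : i = m by apply/eqP; rewrite eqn_leq im.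
  rewrite /inner mem_cat mem_freec mem_diagc /= !ltnn andbF /=.
  by rewrite base_top ?tw //; exact: leq_trans ji im.
rewrite offw // /inner mem_cat mem_freec mem_diagc /= im' /= !andbT.
case: eqVneq => [->|jn]; last by rewrite ltn_neqAle jn ji.
by rewrite orbT /rsum big_ord_recr /=; lra.
Qed.

Lemma feasible_inner w : patt m w -> (forall j, (j <= m)%N -> w (m, j) = l j) ->
  feasible lamV (inner w).
Proof.
move=> pw tw; apply/andP; split; last first.
  apply/toppedP => j jm; rewrite /inner mem_cat mem_freec mem_diagc /= !ltnn andbF /=.
  by rewrite base_top.
by rewrite (patt_ext (w := w)) // => i j ij; exact: Phi_inner.
Qed.

Lemma inner_off w t : t \notin freec m -> t \notin diagc m -> inner w t = b t.
Proof. by move=> /negbTE h1 /negbTE h2; rewrite /inner mem_cat h1 h2. Qed.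

Lemma inner_diag w i : (i < m)%N -> inner w (i, i) = rsum w i.
Proof. by move=> im; rewrite /inner mem_cat mem_freec mem_diagc /= im eqxx orbT. Qed.

(** Rado's theorem for a perturbed [mu]. Partial sums moved by at most [1 / (2 n)] move each entry
    of [mu] by at most [1 / n], hence each subset sum by at most 1, which is the slack. *)
Lemma feasible_near (h : nat -> R) : (forall i, (i < m)%N -> `|h i| <= (2 * n%:R)^-1) ->
  exists z : env, [/\ feasible lamV z,
    forall t, t \notin freec m -> t \notin diagc m -> z t = b t &
    forall i, (i < m)%N -> z (i, i) = b (i, i) + h i].
Proof.
move=> hn.
(* The perturbation stops at index [m], so that the total, which is the sum of the top row, is
   kept. *)
pose H i := if (i < m)%N then h i else 0.
have Hn i : `|H i| <= (2 * n%:R)^-1.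
  by rewrite /H; case: ifP => [/hn //|_]; rewrite normr0 invr_ge0 mulr_ge0.
pose dH i := H i - (if i is j.+1 then H j else 0).
have dHn i : `|dH i| <= n%:R^-1.
  have -> : n%:R^-1 = (2 * n%:R)^-1 + (2 * n%:R)^-1 :> R by rewrite invfM; move: (n%:R^-1) => d; lra.
  apply: le_trans (ler_normB _ _) _; apply: lerD => //.
  by case: i => [|i] //; rewrite normr0 invr_ge0 mulr_ge0.
have sdH i : \sum_(j < i.+1) dH j = H i.
  elim: i => [|i IH]; first by rewrite big_ord1 /dH subr0.
  by rewrite big_ord_recr IH /= /dH; lra.
pose mu' i := coords muV i + dH i.
have smu i : \sum_(j < i.+1) mu' j = \sum_(j < i.+1) coords muV j + H i.
  by rewrite big_split /= sdH.
have Hm : H m = 0 by rewrite /H ltnn.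
have [w [pw tw rw]] : exists w : env, [/\ patt m w, forall j, (j <= m)%N -> w (m, j) = l j &
    forall i, (i <= m)%N -> rsum w i = \sum_(j < i.+1) mu' j].
  apply: rado_pattern.
  - by move=> i im; have := l_gap im; lra.
  - move=> P; pose A : {set 'I_n} := [set i : 'I_n | P i]%SET.
    have cA : count P (iota 0 n) = #|A|.
      rewrite cardE /enum_mem size_filter -enumT -val_enum_ord count_map.
      by apply: eq_count => i; rewrite /= finset.inE.
    rewrite cA; have [A0|A0] := eqVneq A finset.set0.
      rewrite A0 finset.cards0 big_ord0 big_pred0 // => i.
      by have := congr1 (fun B : {set 'I_n} => i \in B) A0; rewrite !finset.inE.
    have [AT|AT] := eqVneq A [set: 'I_n]%SET.
      rewrite AT finset.cardsT card_ord (eq_bigl xpredT); last first.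
        by move=> i; have := congr1 (fun B : {set 'I_n} => i \in B) AT; rewrite !finset.inE.
      by rewrite smu Hm addr0 sum_coords tot -sum_coords.
    apply: le_trans (slack A0 AT).
    rewrite (eq_bigl (fun i => i \in A)); last by move=> i; rewrite finset.inE.
    rewrite big_split /=; apply: lerD.
      by apply: ler_sum => i _; rewrite coordsE.
    apply: (@le_trans _ _ (\sum_(i in A) n%:R^-1)).
      by apply: ler_sum => i _; apply: le_trans (ler_norm _) (dHn i).
    rewrite sumr_const -[_ *+ _]mulr_natr mulrC ler_pdivrMr // mul1r ler_nat.
    by apply: leq_trans (max_card _) _; rewrite card_ord.
  by rewrite smu Hm addr0 !sum_coords tot.
exists (inner w); split.
- exact: feasible_inner.
- by move=> t; exact: inner_off.
- move=> i im; rewrite inner_diag // rw 1?ltnW // smu base_diag //.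
  by rewrite /H im.
Qed.

Lemma Phi_close (x y : env) (e : R) i j : 0 <= e ->
  (forall t, t \in freec m -> `|x t - y t| <= e) ->
  (forall t, t \notin freec m -> x t = y t) -> (j <= i <= m)%N ->
  `|Phi m x (i, j) - Phi m y (i, j)| <= n%:R * e.
Proof.
move=> e0 xy1 xy2 /andP[ji im].
have ne : e <= n%:R * e by rewrite ler_peMl // ler1n.
have xy t : `|x t - y t| <= e.
  by case tf : (t \in freec m); [exact: xy1|rewrite xy2 ?tf // subrr normr0].
rewrite /Phi /=; case: ifP => [/andP[im' /eqP <-]|_]; last exact: le_trans (xy _) ne.
rewrite (xy2 (j, j)) ?mem_freec ?ltnn //.
rewrite (_ : _ - _ = \sum_(q < j) (y (j, nat_of_ord q) - x (j, nat_of_ord q))); last first.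
  by rewrite sumrB /off; lra.
apply: le_trans (ler_norm_sum _ _ _) _.
apply: (@le_trans _ _ (\sum_(q < j) e)).
  by apply: ler_sum => q _; rewrite distrC.
rewrite sumr_const card_ord -[e *+ j]mulr_natl ler_wpM2r // ler_nat.
by rewrite leqW // (leq_trans ji).
Qed.

(** Entry [j] of the row [d] steps below the top, the mean of its two upper neighbours. Gaps of at
    least 1 are inherited from row to row, so the interlacing inequalities hold with margin
    [1 / 2]. *)
Fixpoint average (d j : nat) : R :=
  if d is d'.+1 then (average d' j + average d' j.+1) / 2 else l j.

Lemma average_gap d j : (j + d < m)%N -> average d j.+1 + 1 <= average d j.
Proof.
elim: d j => [|d IH] j /=; first by rewrite addn0; exact: l_gap.
rewrite addnS => jd; have := IH j (ltnW jd); have := IH j.+1.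
by rewrite addSn => /(_ jd); lra.
Qed.

Lemma fvol_gt0_strict : exists z : env, (0 < fvol z)%E /\
  forall t, t \notin freec m -> t \notin diagc m -> z t = b t.
Proof.
pose w : env := fun t => average (m - t.1)%N t.2.
have tw j : (j <= m)%N -> w (m, j) = l j by rewrite /w /= subnn.
have pw i j : (j <= i < m)%N ->
    w (i.+1, j.+1) + 2^-1 <= w (i, j) /\ w (i, j) + 2^-1 <= w (i.+1, j).
  move=> /andP[ji im]; rewrite /w /= -(subnSK im) /=.
  have h : (j + (m - i.+1) < m)%N by lia.
  by have := average_gap h; split; lra.
exists (inner w); split; last by move=> t; exact: inner_off.
have patw : patt m w.
  apply/pattP => i j ij; have [h1 h2] := pw i j ij.
  by apply/andP; split; lra.
pose z := inner w.
(* Moving free coordinates by [e] moves entries by at most [n%:R * e = 1 / 4]; two such errors use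
   up exactly the margin [1 / 2]. *)
have e0 : 0 < (4 * n%:R)^-1 :> R by rewrite invr_gt0 mulr_gt0.
set e := (4 * n%:R)^-1 in e0.
have ne : n%:R * e = 4^-1 by rewrite /e invfM mulrA mulrAC mulfV ?gt_eqF // mul1r.
pose Bx (t : T) : set R := [set` `[z t - e, z t + e]].
have mBx t : measurable (Bx t) by exact: measurable_itv.
apply: (@lt_le_trans _ _ (Leb (freec m) z (box (freec m) Bx))).
  rewrite (Leb_box (l := fun=> 2 * e)) ?uniq_freec // => [|t].
    rewrite lte_fin big_const_seq count_predT iter_mulr_1 exprn_gt0 // mulr_gt0 //.
  by rewrite lebesgue_itv_cc; [congr EFin; lra|lra].
apply: le_Iint_fibre => //.
- by apply: measurable_indicE; exact: measurable_box.
- exact: measurable_feas1.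
- exact: feas1_ge0.
move=> y yz; rewrite feas1E lee_fin indicE ler_nat.
case: (boolP (y \in _)) => // /set_mem yB.
rewrite lt0b; apply/andP; split; last first.
  have /andP[_ /toppedP tz] := feasible_inner patw tw.
  by apply/toppedP => j jm; rewrite yz ?mem_freec ?ltnn ?andbF // /z tz.
have close i j : (j <= i <= m)%N -> `|Phi m y (i, j) - w (i, j)| <= 4^-1.
  move=> ij; rewrite -(Phi_inner tw ij) -ne; apply: Phi_close => //; first exact: ltW.
  by move=> t /yB; rewrite /Bx /= in_itv /= ler_distl => /andP[h1 h2]; rewrite h1.
apply/pattP => i j /[dup] ij /andP[ji im]; have [h1 h2] := pw i j ij.
have := close i j; rewrite ji ltnW // => /(_ isT).
have := close i.+1 j; rewrite leqW // im => /(_ isT).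
have := close i.+1 j.+1; rewrite ltnS ji im => /(_ isT).
rewrite !ler_norml => /andP[? ?] /andP[? ?] /andP[? ?].
by apply/andP; split; lra.
Qed.

(** The segment from [z], where the volume is positive, is prolonged beyond [b] to a feasible [z2]
    with diagonal [b - s (z - b)]. Outside the free coordinates [b] is the interpolation of [z] and
    [z2] with parameter [(1 + s)^-1 < 1], and [fvol_interp] applies. *)
Lemma fvol_base_gt0 : (0 < fvol b)%E.
Proof.
have [z [fz zb]] := fvol_gt0_strict.
pose M := \sum_(i < m) `|z (nat_of_ord i, nat_of_ord i) - b (nat_of_ord i, nat_of_ord i)|.
have M0 : 0 <= M by apply: sumr_ge0.
have zM i : (i < m)%N -> `|z (i, i) - b (i, i)| <= M.
  move=> im; rewrite /M (bigD1 (Ordinal im)) //= lerDl; exact: sumr_ge0.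
(* Small enough that the overshoot [s * M] stays in the range of [feasible_near]. *)
pose s := (2 * n%:R)^-1 / (1 + M).
have M1 : 0 < 1 + M by rewrite ltr_pwDl.
have s0 : 0 < s by rewrite divr_gt0 // invr_gt0 mulr_gt0.
have s1 : 0 < 1 + s by rewrite addr_gt0.
have [i im|z2 [fz2 z2b z2d]] := @feasible_near (fun i => - s * (z (i, i) - b (i, i))).
  rewrite normrM normrN (gtr0_norm s0) /s -mulrA ler_piMr //.
  by rewrite mulrC ler_pdivrMr // mul1r (le_trans (zM i im)) // lerDr.
have th : 0 <= (1 + s)^-1 < 1.
  by rewrite invr_ge0 (ltW s1) invf_lt1 // ltrDl.
have /andP[_ th1] := th.
rewrite (@fvol_agree b (interp (1 + s)^-1 z z2)).
  apply: lt_le_trans (fvol_interp z th fz2).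
  by rewrite mule_gt0 // lte_fin exprn_gt0 // subr_gt0.
move=> t tf; rewrite /interp; case td : (t \in diagc m); last first.
  by rewrite zb ?td // z2b ?td //; lra.
move: td; rewrite mem_diagc => /andP[im]; case: t tf im => i j /= _ im /eqP ->.
rewrite z2d //; apply: (mulIf (lt0r_neq0 s1)).
have E : (1 + s)^-1 * (1 + s) = 1 by rewrite mulVf // gt_eqF.
rewrite mulrDl mulrAC (mulrAC _ _ (1 + s)) mulrBl E mul1r.
lra.
Qed.

Lemma fvol_near th h (y : env) : 0 < th < 1 ->
  (forall i, (i < m)%N -> `|h i| <= (2 * n%:R)^-1) ->
  (forall t, t \notin freec m -> t \notin diagc m -> y t = b t) ->
  (forall i, (i < m)%N -> y (i, i) = b (i, i) + th * h i) ->
  (((1 - th) ^+ size (freec m))%:E * fvol b <= fvol y)%E.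
Proof.
move=> /andP[t0 t1] hn yb yd; have [z [fz zb zd]] := feasible_near hn.
rewrite (@fvol_agree y (interp th b z)).
  by apply: fvol_interp; rewrite // t1 ltW.
move=> t tf; rewrite /interp; case td : (t \in diagc m); last first.
  by rewrite zb ?td // yb ?td //; lra.
move: td; rewrite mem_diagc => /andP[im]; case: t tf im => i j /= _ im /eqP ->.
by rewrite zd // yd //; lra.
Qed.

Lemma fvol_supergradient : exists c : T -> R, forall y : env,
  (forall t, t \notin diagc m -> y t = b t) ->
  (fvol y <= (expR (- \sum_(t <- diagc m) c t * (y t - b t)))%:E * fvol b)%E.
Proof.
have fb := fvol_fin b; have f0 := fvol_base_gt0.
have r0 : 0 < fine (fvol b) by rewrite -lte_fin fineK.
apply: (logconcave_supergradient (w := ln (fine (fvol b))) (uniq_diagc m)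
  logconcave_fvol fvol_ge0).
  by rewrite lnK ?posrE // fineK.
move=> t; rewrite mem_diagc => /andP[im]; case: t im => i j /= im /eqP ->.
(* Half the radius of [feasible_near]: doubling [h] stays in range, and interpolation with parameter
   [1 / 2] comes back to [h]. *)
exists (4 * n%:R)^-1; first by rewrite invr_gt0 mulr_gt0.
move=> h hn; apply: (@lt_le_trans _ _ (((1 - 2^-1) ^+ size (freec m))%:E * fvol b)%E).
  by rewrite mule_gt0 // lte_fin exprn_gt0 //; lra.
apply: (@fvol_near _ (fun q => if q == i then 2 * h else 0)).
- by apply/andP; split; lra.
- move=> q _; case: ifP => _; last by rewrite normr0 invr_ge0 mulr_ge0.
  move: hn; rewrite normrM !invfM ger0_norm //.
  by move: (n%:R^-1) (`|h|) => d a; lra.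
- move=> t tf td; rewrite upd_neq //; apply: contraNneq td => ->.
  by rewrite mem_diagc im eqxx.
move=> q _; rewrite /upd xpair_eqE andbb; case: eqVneq => [->|_]; last by rewrite mulr0 addr0.
by lra.
Qed.

Definition tilt (x : 'rV[R]_n) (y : env) : R :=
  \sum_(i < m) (coords x i - coords x i.+1) *
    (y (nat_of_ord i, nat_of_ord i) - b (nat_of_ord i, nat_of_ord i)).

Lemma measurable_tilt x : measurable_fun [set: env] (fun y => (expR (tilt x y))%:E).
Proof.
apply/measurable_EFinP; apply: measurableT_comp => //.
apply: measurable_sum => i; apply: measurable_funM => //.
by apply: measurable_funB => //; exact: measurable_coord.
Qed.

(** Summation by parts writes both the weight of a pattern and the pairing of [x] with [mu] in terms
    of row sums. The top-row terms cancel by [tot], and [tilt] is what remains; it is constant on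
    each fibre, so the inner integral is [fvol]. *)
Lemma schur_fvol (x : 'rV[R]_n) :
  (schur_exp lamV x * expR (- \sum_i x ord0 i * muV ord0 i))%:E =
  Iint (diagc m) (fun y => (expR (tilt x y))%:E * fvol y)%E b.
Proof.
have bdec j : (j < m)%N -> b (m, j.+1) <= b (m, j).
  by move=> jm; rewrite !base_top ?(ltnW jm) //; have := l_gap jm; lra.
have lamb (j : 'I_n) : lamV ord0 j = b (m, nat_of_ord j).
  by rewrite base_top ?coordsE // -ltnS.
pose s0 := \sum_i x ord0 i * muV ord0 i.
rewrite EFinM (schur_expE bdec lamb) /schur_int muleC -/s0.
rewrite (Iint_below_Phi m (measurable_wpatt (coords x) m)); last exact: wpatt_ge0.
have mwP : measurable_fun [set: env] (fun z : env => wpatt (coords x) m (Phi m z)).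
  exact: (measurableT_comp (measurable_wpatt (coords x) m) (@measurable_Phi R m)).
rewrite -IintZ; last 3 first.
- by apply: measurable_Iint => // z; exact: wpatt_ge0.
- by apply: Iint_ge0 => z; exact: wpatt_ge0.
- by rewrite lee_fin expR_ge0.
apply: Iint_ext => y yb.
have yt j : (j <= m)%N -> y (m, j) = l j.
  by move=> jm; rewrite yb ?base_top // mem_diagc /= ltnn.
rewrite -IintZ //; last by move=> z; exact: wpatt_ge0.
rewrite -IintZ; last 3 first.
- exact: measurable_feas1.
- exact: feas1_ge0.
- by rewrite lee_fin expR_ge0.
apply: Iint_ext => z zy.
have zt j : (j <= m)%N -> z (m, j) = l j.
  by move=> jm; rewrite zy ?yt // mem_freec /= ltnn andbF.
have tz : topped lamV z by apply/toppedP.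
rewrite feas1E /wpatt /feasible tz andbT -!EFinM; congr EFin.
case: ifP => _; last by rewrite !mulr0.
rewrite mulr1 -expRD; congr expR.
rewrite wtE rsum_Phi ltnn /tilt.
have -> : rsum z m = \sum_i muV ord0 i.
  by rewrite tot -sum_coords; apply: eq_bigr => j _; rewrite zt // -ltnS.
have -> : s0 = \sum_(i < m) (coords x i - coords x i.+1) * b (nat_of_ord i, nat_of_ord i) +
    coords x m * \sum_i muV ord0 i.
  rewrite -sum_coords /s0 (eq_bigr (fun i : 'I_n => coords x i * coords muV i)); last first.
    by move=> i _; rewrite !coordsE.
  rewrite (eq_bigr (fun i : 'I_m => (coords x i - coords x i.+1) *
    \sum_(l < i.+1) coords muV l)); last by move=> i _; rewrite base_diag.
  move: (coords x) (coords muV) => X U.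
  elim: (m) => [|p IH]; first by rewrite big_ord0 add0r !big_ord1.
  have E : \sum_(q < p.+2) U q = \sum_(q < p.+1) U q + U p.+1 by rewrite big_ord_recr.
  by rewrite big_ord_recr IH E /= [X in _ = X + _]big_ord_recr /=; lra.
have cancel (p q r : R) : - (p + r) + (q + r) = q - p by lra.
rewrite cancel -sumrB; apply: eq_bigr => i _ /=.
by rewrite rsum_Phi ltn_ord zy ?mem_freec ?ltnn // mulrBr.
Qed.

Lemma fvol_out y i : (i < m)%N -> ~~ (0 <= y (i, i) <= n%:R * l 0%N) -> fvol y = 0%E.
Proof.
move=> im yi; transitivity (Iint (freec m) (fun z => 0 * feas1 z)%E y); last first.
  by rewrite IintZ ?mul0e //; [exact: measurable_feas1|exact: feas1_ge0].
apply: Iint_ext => z zy; rewrite feas1E mul0e; case fz : (feasible lamV z) => //.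
have := feasible_diag fz im.
by rewrite zy ?mem_freec ?ltnn // (negbTE yi).
Qed.

Lemma schur_exp_le : exists x : 'rV[R]_n,
  ((schur_exp lamV x * expR (- \sum_i x ord0 i * muV ord0 i))%:E <=
   ((n%:R * l 0%N) ^+ m)%:E * fvol b)%E.
Proof.
have [c cP] := fvol_supergradient.
(* Solves [x i - x i.+1 = c (i, i)] with last entry 0, so that [tilt] cancels the exponent of the
   supergradient exactly. *)
pose x : 'rV[R]_n := \row_(i < n) \sum_(i <= q < m) c (q, q).
have xE i : (i <= m)%N -> coords x i = \sum_(i <= q < m) c (q, q).
  by move=> im; rewrite /coords mxE inordK.
pose Bx (t : T) : set R := [set` `[0, n%:R * l 0%N]].
have mBx t : measurable (Bx t) by exact: measurable_itv.
exists x; rewrite schur_fvol.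
apply: (@le_trans _ _ (fvol b * Leb (diagc m) b (box (diagc m) Bx))%E); last first.
  rewrite (Leb_box (l := fun=> n%:R * l 0%N)) ?uniq_diagc // => [|t].
    by rewrite muleC big_const_seq count_predT iter_mulr_1 size_map size_iota.
  by rewrite lebesgue_itv_cc ?subr0 // mulr_ge0.
have mind := measurable_indicE (measurable_box (diagc m) mBx).
rewrite -IintZ; last 3 first.
- exact: mind.
- by move=> y; rewrite lee_fin.
- exact: fvol_ge0.
apply: le_Iint_fibre.
- by apply: emeasurable_funM; [exact: measurable_tilt|exact: measurable_fvol].
- by move=> y; rewrite mule_ge0 ?fvol_ge0 // lee_fin expR_ge0.
- by apply: emeasurable_funM => //; exact: mind.
- by move=> y; rewrite mule_ge0 ?fvol_ge0 // lee_fin.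
move=> y yb; rewrite indicE; case: (boolP (y \in _)) => [_|yB]; last first.
  suff -> : fvol y = 0%E by rewrite !mule0.
  suff [i im out] : exists2 i, (i < m)%N & ~~ (0 <= y (i, i) <= n%:R * l 0%N).
    exact: fvol_out im out.
  apply: contrapT => no; move/negP: yB; apply; apply: mem_set => t.
  rewrite mem_diagc => /andP[im]; case: t im => i j /= im /eqP ->.
  by rewrite /Bx /= in_itv /=; apply/negPn/negP => out; apply: no; exists i.
rewrite mule1; apply: le_trans (lee_wpmul2l _ (cP y yb)) _; first by rewrite lee_fin expR_ge0.
have iE : iota 0 m = index_iota 0 m by rewrite /index_iota subn0.
rewrite muleA -EFinM -expRD /tilt /diagc big_map iE big_mkord.
rewrite -sumrN -big_split big1 ?expR0 ?mul1e //= => i _.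
rewrite !xE ?ltn_ord // 1?ltnW // (big_ltn (ltn_ord i)); lra.
Qed.

Lemma schur_exp_ge (x : 'rV[R]_n) :
  (((1 - n%:R^-1) ^+ size (freec m) * ((2 * n%:R ^+ 2)^-1) ^+ m)%:E * fvol b <=
  (schur_exp lamV x * expR (- \sum_i x ord0 i * muV ord0 i))%:E)%E.
Proof.
pose rho : R := (2 * n%:R ^+ 2)^-1.
have rho0 : 0 < rho by rewrite invr_gt0 mulr_gt0 // exprn_gt0.
(* In each coordinate the interval of length [rho] lies on the side of [b] where the term of [tilt]
   is nonnegative, so the exponential is at least 1 on the box. *)
pose lo (t : T) : R := if coords x t.1.+1 <= coords x t.1 then b t else b t - rho.
pose Bx (t : T) : set R := [set` `[lo t, lo t + rho]].
have mBx t : measurable (Bx t) by exact: measurable_itv.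
have mind := measurable_indicE (measurable_box (diagc m) mBx).
pose C := (((1 - n%:R^-1) ^+ size (freec m))%:E * fvol b)%E.
have ninv : 0 < n%:R^-1 :> R by rewrite invr_gt0.
have n1 : n%:R^-1 < 1 :> R by rewrite invf_lt1 // ltr1n.
have C0 : (0 <= C)%E by rewrite mule_ge0 ?fvol_ge0 // lee_fin exprn_ge0 // subr_ge0 ltW.
rewrite schur_fvol.
apply: (@le_trans _ _ (C * Leb (diagc m) b (box (diagc m) Bx))%E).
  rewrite (Leb_box (l := fun=> rho)) ?uniq_diagc // => [|t].
    rewrite big_const_seq count_predT iter_mulr_1 size_map size_iota.
    by rewrite /C EFinM muleAC.
  by rewrite lebesgue_itv_cc; [congr EFin; lra|lra].
rewrite -IintZ; last 3 first.
- exact: mind.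
- by move=> y; rewrite lee_fin.
- exact: C0.
apply: le_Iint_fibre.
- by apply: emeasurable_funM => //; exact: mind.
- by move=> y; rewrite mule_ge0 // lee_fin.
- by apply: emeasurable_funM; [exact: measurable_tilt|exact: measurable_fvol].
- by move=> y; rewrite mule_ge0 ?fvol_ge0 // lee_fin expR_ge0.
move=> y yb; rewrite indicE; case: (boolP (y \in _)) => [/set_mem yB|_]; last first.
  by rewrite mule0 mule_ge0 ?fvol_ge0 // lee_fin expR_ge0.
have yBi i : (i < m)%N -> lo (i, i) <= y (i, i) <= lo (i, i) + rho.
  by move=> im; apply: yB; rewrite mem_diagc /= im eqxx.
rewrite mule1 -[C]mul1e; apply: lee_pmul => //; rewrite ?lee_fin //.
  rewrite -expR0 ler_expR; apply: sumr_ge0 => i _.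
  have := yBi i (ltn_ord i); rewrite /lo /=; case: ifP => cx /andP[h1 h2].
    by apply: mulr_ge0; lra.
  by apply: mulr_le0; first (rewrite subr_le0 ltW // ltNge cx); lra.
(* The parameter is [1 / n]: displacements of at most [rho] are magnified to at most
   [n%:R * rho = 1 / (2 n)], the range of [feasible_near]. *)
apply: (@fvol_near _ (fun i => n%:R * (y (i, i) - b (i, i)))).
- by rewrite ninv n1.
- move=> i im; rewrite normrM ger0_norm //.
  have -> : (2 * n%:R)^-1 = n%:R * rho :> R.
    rewrite /rho expr2 !invfM (mulrCA n%:R) (mulrA n%:R) mulfV ?gt_eqF // mul1r.
    by [].
  rewrite ler_pM2l //; have := yBi i im; rewrite /lo /= ler_norml.
  by case: ifP => _ /andP[h1 h2]; apply/andP; split; lra.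
- by move=> t _; exact: yb.
- by move=> i im; rewrite mulrA mulVf ?gt_eqF // mul1r; lra.
Qed.

End WeightFibres.

(** * Comparison of the constants *)

Section Numerics.
Context (R : realType).

Lemma ratio_bounds (V S : \bar R) (v a c q : R) : 0 < v -> 0 < a -> 0 < c ->
  (v%:E <= V)%E -> (V <= (q * v)%:E)%E -> ((c * v)%:E <= S)%E -> (S <= (a * v)%:E)%E ->
  (a^-1%:E <= V / S <= (q / c)%:E)%E.
Proof.
move=> v0 a0 c0; case: V => [V| |] //; case: S => [S| |] //.
rewrite !lee_fin => vV Vq cS Sa.
have cv0 : 0 < c * v by rewrite mulr_gt0.
have S0 : 0 < S by exact: lt_le_trans cS.
rewrite inver (gt_eqF S0) -EFinM !lee_fin; apply/andP; split.
  rewrite ler_pdivlMr // mulrC ler_pdivrMr //.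
  by apply: le_trans Sa _; rewrite mulrC ler_pM2r.
have q0 : 0 <= q.
  by rewrite -(pmulr_lge0 _ v0); apply: le_trans Vq; apply: le_trans vV; exact: ltW.
rewrite ler_pdivrMr // mulrAC ler_pdivlMr //.
apply: (@le_trans _ _ (q * v * c)); first by rewrite ler_pM2r.
by rewrite -!mulrA ler_wpM2l // mulrC.
Qed.

Lemma expR1_le4 : expR 1 <= 4 :> R.
Proof.
have h : expR (2^-1) <= 2 :> R.
  rewrite -[leLHS]invrK -expRN -[leRHS]invrK lef_pV2 ?posrE ?expR_gt0 ?invr_gt0 //.
  by apply: le_trans (expR_ge1Dx _); lra.
rewrite [X in expR X](_ : 1 = 2^-1 + 2^-1); last by lra.
have -> : (4 : R) = 2 * 2 by lra.
by rewrite expRD; apply: ler_pM => //; exact: expR_ge0.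
Qed.

Lemma sqrt_pi_le2 : Num.sqrt pi <= 2 :> R.
Proof.
have /andP[p0 p2] := @pihalf_02 R.
have -> : (2 : R) = Num.sqrt (2 ^+ 2) by rewrite sqrtr_sqr ger0_norm.
by rewrite ler_sqrt; [rewrite expr2; lra|rewrite exprn_ge0].
Qed.

(** A multiple of the exponential density of rate [1 / 2] dominates the Gamma integrand; this serves
    to show that the integral is finite. *)
Lemma powR_expR_le (a t : R) N : 0 <= a <= N.+1%:R -> 0 < t ->
  t `^ a * expR (- t) <=
  2 ^+ N.+1 * N.+1`!%:R * expR (2^-1) * 2 * exponential_pdf 2^-1 t.
Proof.
move=> /andP[a0 aN] t0; rewrite exponential_pdfE; last exact: ltW.
have t1 : 1 <= 1 + t by rewrite lerDl ltW.
have u0 : 0 <= (1 + t) / 2 by rewrite divr_ge0 // (le_trans ler01).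
have h : t `^ a <= 2 ^+ N.+1 * N.+1`!%:R * expR ((1 + t) / 2).
  apply: (@le_trans _ _ ((1 + t) ^+ N.+1)).
    rewrite -powR_mulrn ?(le_trans ler01) //.
    apply: le_trans (ler_powR t1 aN).
    by apply: ge0_ler_powR; rewrite // ?nnegrE ?ltW // ?lerDr //; lra.
  have -> : (1 + t) ^+ N.+1 = 2 ^+ N.+1 * ((1 + t) / 2) ^+ N.+1.
    by rewrite -exprMn mulrC divfK.
  rewrite -mulrA ler_wpM2l ?exprn_ge0 // [leRHS]mulrC -ler_pdivrMr ?ltr0n ?fact_gt0 //.
  by apply: le_trans (expR_ge1Dxn N u0); rewrite lerDr.
apply: le_trans (ler_wpM2r (expR_ge0 _) h) _.
rewrite -!mulrA ler_pM2l ?exprn_gt0 // ler_pM2l ?ltr0n ?fact_gt0 //.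
rewrite -expRD [2 * _]mulrA mulfV // mul1r -expRD ler_expR; lra.
Qed.

(** On [[1, 2]] the integrand is at least [expR (- 2)]. Finiteness must be shown first, because the
    real-valued integral would read 0 if the extended one were infinite. *)
Lemma Gamma_ge (s : R) : 1 <= s -> expR (- 2) <= Gamma s.
Proof.
move=> s1; rewrite /Gamma /Rintegral.
pose mu := @lebesgue_measure R.
pose g (t : R) := t `^ (s - 1) * expR (- t).
have mg D : measurable_fun D (fun t : R => (g t)%:E).
  apply/measurable_funTS/measurable_EFinP; apply: measurable_funM => //.
  by apply: measurableT_comp => //; exact: measurable_oppr.
have g0 t : (0 <= (g t)%:E)%E by rewrite lee_fin mulr_ge0 ?powR_ge0 ?expR_ge0.
have sN : 0 <= s - 1 <= (Num.truncn (s - 1)).+1%:R.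
  by rewrite subr_ge0 s1 ltW // truncnS_gt.
set N := Num.truncn (s - 1) in sN.
set C := 2 ^+ N.+1 * N.+1`!%:R * expR (2^-1) * 2 : R.
have C0 : 0 <= C by rewrite !mulr_ge0 ?exprn_ge0 ?expR_ge0.
have h2 : 0 < 2^-1 :> R by [].
have pdf0 t : (0 <= (exponential_pdf (2^-1 : R) t)%:E)%E.
  by rewrite lee_fin exponential_pdf_ge0 // ltW.
have mpdf : measurable_fun [set: R] (fun t => (exponential_pdf (2^-1 : R) t)%:E).
  by apply/measurable_EFinP; exact: measurable_exponential_pdf.
have fin : (\int[mu]_(t in `]0%R, +oo[) (g t)%:E <= C%:E)%E.
  apply: (@le_trans _ _ (\int[mu]_(t in `]0%R, +oo[) (C%:E * (exponential_pdf (2^-1 : R) t)%:E))%E).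
    apply: ge0_le_integral => //.
    - exact: mg.
    - by apply: emeasurable_funM => //; exact: measurable_funTS.
    - move=> t /=; rewrite in_itv /= andbT => t0.
      by rewrite -EFinM lee_fin; exact: powR_expR_le.
  apply: (@le_trans _ _ (\int[mu]_t (C%:E * (exponential_pdf (2^-1 : R) t)%:E))%E).
    apply: ge0_subset_integral => //.
      by apply: emeasurable_funM.
    by move=> t _; rewrite mule_ge0.
  rewrite ge0_integralZl //.
  by rewrite integral_exponential_pdf // mule1.
rewrite -lee_fin fineK; last first.
  rewrite ge0_fin_numE; last by apply: integral_ge0 => t _; exact: g0.
  by apply: le_lt_trans fin _; exact: ltry.
apply: (@le_trans _ _ (\int[mu]_(t in `[1%R, 2%R]) (cst (expR (- 2))%:E t))%E).
  have e : mu [set` `[1%R, 2%R]] = 1%:E.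
    by rewrite /mu lebesgue_itv_cc; [congr EFin|]; lra.
  by rewrite integral_cst // [X in (_ <= _ * X)%E]e mule1.
apply: (@le_trans _ _ (\int[mu]_(t in `[1%R, 2%R]) (g t)%:E)%E).
  apply: ge0_le_integral => //.
  - by move=> t _; rewrite lee_fin expR_ge0.
  - exact: mg.
  move=> t /=; rewrite in_itv /= => /andP[t1 t2]; rewrite lee_fin /g.
  rewrite -[leLHS]mul1r; apply: ler_pM; rewrite ?expR_ge0 //.
    have s10 : 0 <= s - 1 by rewrite subr_ge0.
    by have := ler_powR t1 s10; rewrite powRr0.
  by rewrite ler_expR lerN2.
apply: ge0_subset_integral => //; first exact: mg.
move=> t /=; rewrite !in_itv /= => /andP[t1 _].
by rewrite andbT; apply: lt_le_trans t1.
Qed.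

Variable k : nat.
Local Notation m := k.+1.
Local Notation n := k.+2.

Let n0 : 0 < n%:R :> R. Proof. by rewrite ltr0n. Qed.
Let m0 : 0 < m%:R :> R. Proof. by rewrite ltr0n. Qed.

Lemma lower_constant_le (l : R) : 1 <= l ->
  Num.sqrt m`!%:R * expR (- n%:R) / (l ^+ m * n%:R ^+ (2 * n)) <= ((n%:R * l) ^+ m)^-1.
Proof.
move=> l1; have l0 : 0 < l by exact: lt_le_trans l1.
have f1 : 1 <= m`!%:R :> R by rewrite ler1n fact_gt0.
have s1 : Num.sqrt m`!%:R <= m`!%:R :> R.
  rewrite -[leRHS]ger0_norm // -sqrtr_sqr ler_sqrt ?sqr_ge0 //.
  by rewrite expr2 ler_peMr.
have f2 : m`!%:R <= n%:R ^+ m :> R.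
  have fq q i : (i <= q)%N -> (i`! <= q ^ i)%N.
    by elim: i => // i IH iq; rewrite factS expnS leq_mul // IH // ltnW.
  by rewrite -natrX ler_nat fq.
have ab0 : 0 < l ^+ m * n%:R ^+ (2 * n) by apply: mulr_gt0; apply: exprn_gt0.
rewrite (ler_pdivrMr _ _ ab0) [(n%:R * l) ^+ m]exprMn.
(* One factor [n ^ m] matches that of the right side, a second one absorbs the square root of the
   factorial, and [n ^ 2] is to spare. *)
have -> : (2 * n = m + (m + 2))%N by lia.
rewrite exprD; set A := l ^+ m; set B := n%:R ^+ m.
have A0 : 0 < A by exact: exprn_gt0.
have B0 : 0 < B by exact: exprn_gt0.
have -> : (B * A)^-1 * (A * (B * n%:R ^+ (m + 2))) = n%:R ^+ (m + 2).
  by rewrite [A * _]mulrA [A * B]mulrC mulrA mulVf ?mul1r // mulf_neq0 // gt_eqF.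
rewrite exprD; apply: ler_pM; rewrite ?sqrtr_ge0 ?expR_ge0 //.
  exact: le_trans f2.
apply: (@le_trans _ _ 1); first by rewrite expR_le1 oppr_le0.
by rewrite exprn_ege1 // ler1n.
Qed.

(** The quotient of the two bases is exactly [1 + 2 / m], hence at most [expR (2 / m)], and the
    exponent [size (freec m)] is at most [m * k / 2]. *)
Lemma quotient_exp_le : (1 + n%:R^-1) ^+ size (freec m) <=
  (1 - n%:R^-1) ^+ size (freec m) * expR k%:R :> R.
Proof.
have n1 : n%:R^-1 < 1 :> R by rewrite invf_lt1 // ltr1n.
have h : 1 + n%:R^-1 <= (1 - n%:R^-1) * expR (2 / m%:R) :> R.
  apply: (@le_trans _ _ ((1 - n%:R^-1) * (1 + 2 / m%:R))); last first.
    by rewrite ler_wpM2l ?expR_ge1Dx // subr_ge0 ltW.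
  have nE : n%:R = m%:R + 1 :> R by rewrite natr1.
  have m1 : m%:R * m%:R^-1 = 1 :> R by rewrite mulfV // gt_eqF.
  have nn : n%:R * n%:R^-1 = 1 :> R by rewrite mulfV // gt_eqF.
  apply: eq_ler; apply: (mulfI (lt0r_neq0 n0)); apply: (mulfI (lt0r_neq0 m0)).
  have gen (a b c d : R) : d = c + 1 -> c * a = 1 -> d * b = 1 ->
      c * (d * (1 + b)) = c * (d * ((1 - b) * (1 + 2 * a))).
    move=> dc ca db.
    have -> : c * (d * (1 + b)) = c * (d + d * b) by lra.
    have -> : c * (d * ((1 - b) * (1 + 2 * a))) = (d - d * b) * (c + 2 * (c * a)) by lra.
    by rewrite ca db dc; lra.
  exact: gen.
apply: (@le_trans _ _ (((1 - n%:R^-1) * expR (2 / m%:R)) ^+ size (freec m))).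
  by apply: lerXn2r; rewrite ?nnegrE // ?addr_ge0 // (le_trans _ h) // addr_ge0.
rewrite exprMn ler_pM2l ?exprn_gt0 ?subr_gt0 //.
rewrite -expRM_natl ler_expR mulrA ler_pdivrMr // -!natrM ler_nat size_freec mulnC.
by rewrite [leqLHS]mulnC (leq_trans (leq_trunc_div _ _)) // mulnC.
Qed.

(** Per factor of the [m]-th power, the claimed constant exceeds [n * k] by at least 4. The spare
    [4 ^+ m], at least [expR m], together with [expR (n / 2)] and [G], pays for the factor [expR k]
    of [quotient_exp_le]. *)
Lemma upper_constant_le (l G : R) : m%:R <= l -> expR (- 2) <= G ->
  kappa R k / ((1 - n%:R^-1) ^+ size (freec m) * ((2 * n%:R ^+ 2)^-1) ^+ m) <=
  Num.sqrt m`!%:R * expR (n%:R / 2) * G *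
    (16 * l * n%:R ^+ 3 / Num.sqrt pi) ^+ m.
Proof.
move=> ml G2; have ml0 : 0 < l by exact: lt_le_trans ml.
have n1 : n%:R^-1 < 1 :> R by rewrite invf_lt1 // ltr1n.
set D := size (freec m); set q := 1 - n%:R^-1 : R.
have q0 : 0 < q by rewrite subr_gt0.
have f1 : 1 <= Num.sqrt m`!%:R :> R.
  by rewrite -[leLHS]sqrtr1 ler_sqrt // ler1n fact_gt0.
rewrite ler_pdivrMr ?mulr_gt0 ?exprn_gt0 ?invr_gt0 ?mulr_gt0 ?exprn_gt0 //.
rewrite /kappa natrX natrM.
apply: (@le_trans _ _ ((n%:R * k%:R) ^+ m * (q ^+ D * expR k%:R))).
  rewrite ler_wpM2l ?exprn_ge0 ?mulr_ge0 //; exact: quotient_exp_le.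
set c := (2 * n%:R ^+ 2)^-1.
set E := 16 * l * n%:R ^+ 3 / Num.sqrt pi.
have pi0 : 0 < Num.sqrt pi :> R by rewrite sqrtr_gt0 pi_gt0.
have c0 : 0 < c by rewrite invr_gt0 mulr_gt0 // exprn_gt0.
(* The bound [sqrt pi <= 2] leaves [8 * l * n ^ 3]; dividing by [2 * n ^ 2] gives [4 * l * n], and
   [l] is at least [m > k]. *)
have cE : 4 * (n%:R * k%:R) <= E * c.
  have EB : 8 * (k%:R * n%:R ^+ 3) <= E.
    rewrite /E ler_pdivlMr //.
    apply: (@le_trans _ _ (8 * (k%:R * n%:R ^+ 3) * 2)).
      by rewrite ler_wpM2l ?sqrt_pi_le2 // !mulr_ge0 ?exprn_ge0.
    have -> : 8 * (k%:R * n%:R ^+ 3) * 2 = 16 * (k%:R * n%:R ^+ 3) :> R by lra.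
    rewrite -[leRHS]mulrA ler_wpM2l // ler_wpM2r ?exprn_ge0 //.
    by apply: le_trans ml; rewrite ler_nat.
  apply: le_trans (ler_wpM2r (ltW c0) EB).
  rewrite /c ler_pdivlMr ?mulr_gt0 ?exprn_gt0 // !exprS expr0; lra.
set A := n%:R * k%:R in cE *; set H := expR (n%:R / 2).
have A0 : 0 <= A by rewrite mulr_ge0.
have H0 : 0 <= H by exact: expR_ge0.
have G0 : 0 <= G by apply: le_trans G2; exact: expR_ge0.
have key : expR k%:R <= Num.sqrt m`!%:R * (H * G) * 4 ^+ m.
  apply: (@le_trans _ _ (H * expR (- 2) * expR m%:R)).
    rewrite /H -!expRD ler_expR; have : 2 <= n%:R :> R by rewrite ler_nat.
    have -> : n%:R = k%:R + 2 :> R by rewrite -natrD addn2.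
    have -> : m%:R = k%:R + 1 :> R by rewrite natr1.
    lra.
  apply: ler_pM; rewrite ?mulr_ge0 ?expR_ge0 //.
    apply: (@le_trans _ _ (H * G)); first by rewrite ler_wpM2l.
    by rewrite ler_peMl // mulr_ge0.
  rewrite -[m%:R]mulr1 expRM_natl; apply: lerXn2r; rewrite ?nnegrE ?expR_ge0 //.
  exact: expR1_le4.
apply: (@le_trans _ _ (A ^+ m * (q ^+ D * (Num.sqrt m`!%:R * (H * G) * 4 ^+ m)))).
  by rewrite ler_wpM2l ?exprn_ge0 // ler_wpM2l ?exprn_ge0 // ltW.
have -> : A ^+ m * (q ^+ D * (Num.sqrt m`!%:R * (H * G) * 4 ^+ m)) =
    Num.sqrt m`!%:R * H * G * (4 * A) ^+ m * q ^+ D.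
  rewrite [(4 * A) ^+ m]exprMn; move: (A ^+ m) (q ^+ D) (4 ^+ m) (Num.sqrt _) => *; lra.
have -> : Num.sqrt m`!%:R * H * G * E ^+ m * (q ^+ D * c ^+ m) =
    Num.sqrt m`!%:R * H * G * (E * c) ^+ m * q ^+ D.
  rewrite [(E * c) ^+ m]exprMn; move: (E ^+ m) (q ^+ D) (c ^+ m) (Num.sqrt _) => *; lra.
rewrite ler_wpM2r ?exprn_ge0 ?(ltW q0) // ler_wpM2l ?mulr_ge0 ?sqrtr_ge0 //.
have A4 : 0 <= 4 * A by rewrite mulr_ge0.
by apply: lerXn2r; rewrite ?nnegrE // (le_trans A4 cE).
Qed.

End Numerics.

Theorem mainTheorem3 (R : realType) (n : nat) (hn : (3 <= n)%N)
    (lam : n.-tuple nat) (mu : n.-tuple int)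
    (hlam : forall i j : 'I_n, (i < j)%N -> (tnth lam j < tnth lam i)%N) :
  let lamR : 'rV[R]_n := \row_i (tnth lam i)%:R in
  let muR : 'rV[R]_n := \row_i (tnth mu i)%:~R in
  let lam1 : R := (nth 0%N lam 0)%:R in
  let S_inf : \bar R := ereal_inf
    [set (schur_exp lamR x * expR (- (\sum_i x ord0 i * muR ord0 i)))%:E
      | x in [set: 'rV[R]_n]] in
  relative_interior (SH lamR) muR ->
  ((Num.sqrt ((n - 1)`!)%:R * expR (- n%:R)
      / (lam1 ^+ (n - 1) * n%:R ^+ (2 * n)))%:E
    <= GT_vol lamR muR / S_inf
    <= (Num.sqrt ((n - 1)`!)%:R * expR (n%:R / 2) * Gamma ((n%:R + 1) / 2)
          * (16 * lam1 * n%:R ^+ 3 / Num.sqrt pi) ^+ (n - 1))%:E)%E.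
Proof.
(* Now [n] is [k.+3] and the top row has index [k.+2]; the volume and constant estimates are used
   with [k.+1] for their [k]. *)
case: n hn lam mu hlam => [|[|[|k]]] // _ lam mu hlam lamR muR lam1 S_inf rint.
have lamE i : (i < k.+3)%N -> coords lamR i = (nth 0%N lam i)%:R.
  by move=> ik; rewrite /coords mxE (tnth_nth 0%N) /= inordK.
have [tot0 slack0] := integral_slack hlam rint.
have tot : \sum_i muR ord0 i = \sum_i lamR ord0 i.
  by rewrite tot0; apply: eq_bigr => i _; rewrite mxE (tnth_nth 0%N).
have slack (A : {set 'I_k.+3}) : A != finset.set0 -> A != [set: 'I_k.+3]%SET ->
    \sum_(i in A) muR ord0 i + 1 <= \sum_(j < #|A|) coords lamR j.
  move=> A0 AT; apply: le_trans (slack0 A A0 AT) _; apply: ler_sum => j _.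
  rewrite lamE //; apply: leq_trans (ltn_ord j) _.
  by rewrite -[leqRHS]card_ord; exact: max_card.
have gap j : (j < k.+2)%N -> coords lamR j.+1 + 1 <= coords lamR j.
  move=> jk; rewrite !lamE ?ltnS ?(ltnW jk) // natr1 ler_nat.
  by apply: (nth_dec hlam); rewrite ltnSn.
have l_ge0 : 0 <= coords lamR k.+2 by rewrite lamE.
have l0E : coords lamR 0%N = lam1 by rewrite lamE.
have m_gt0 : (0 < k.+2)%N by [].
pose b := base lamR muR.
pose v := fine (fvol lamR b).
have vE : fvol lamR b = v%:E by rewrite fineK // fvol_fin.
have v0 : 0 < v by rewrite -lte_fin -vE; exact: fvol_base_gt0.
have /andP[V1 V2] := GT_vol_bounds tot (ltn0Sn k).
rewrite -fvol_fibre -/b vE in V1 V2.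
have [x xle] := schur_exp_le m_gt0 gap l_ge0 tot slack.
have xge y := schur_exp_ge m_gt0 gap tot slack y.
rewrite -/b vE l0E in xle; rewrite -/b vE in xge.
have l0_gt0 : 0 < lam1 by rewrite -l0E (lt_le_trans ltr01) // l0_ge1.
have top : k.+2%:R <= lam1 by rewrite -l0E top_ge.
set c := (1 - k.+3%:R^-1) ^+ _ * _ in xge.
have c0 : 0 < c.
  rewrite mulr_gt0 // exprn_gt0 ?invr_gt0 ?mulr_gt0 ?exprn_gt0 ?ltr0n //.
  by rewrite subr_gt0 invf_lt1 ?ltr1n ?ltr0n.
have S1 : ((c * v)%:E <= S_inf)%E.
  by apply/ereal_infP => _ [y _ <-]; exact: xge.
have S2 : (S_inf <= ((k.+3%:R * lam1) ^+ k.+2 * v)%:E)%E.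
  by apply: le_trans xle; apply: ereal_inf_lbound; exists x.
have a0 : 0 < (k.+3%:R * lam1) ^+ k.+2 by rewrite exprn_gt0 // mulr_gt0 // ltr0n.
have /andP[B1 B2] := ratio_bounds v0 a0 c0 V1 V2 S1 S2.
rewrite subn1 /=; apply/andP; split.
  apply: le_trans B1; rewrite lee_fin; apply: lower_constant_le => //.
  by apply: le_trans top; rewrite ler1n.
apply: le_trans B2 _; rewrite lee_fin; apply: upper_constant_le => //.
apply: Gamma_ge; rewrite ler_pdivlMr // -natr1 !mulr1n.
have : 2 <= k.+2%:R :> R by rewrite ler_nat.
lra.
Qed.
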